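(* Let $d\ge2$, $m\in\mathbb{N}$. Let $\{\mathsf{B}_n(t):n\in\mathbb{N}_0\}$ be stationary covariance matrix functions on $\mathbb{T}$ with $\sum_{n=0}^\infty\mathsf{B}_n(0)P_n^{(\alpha,\beta)}(1)$ convergent. Let $\{\mathbf{V}_n(t):n\in\mathbb{N}_0\}$ be a sequence of independent $m$-variate wide-sense stationary stochastic processes on $\mathbb{T}$ with $\mathsf{E}[\mathbf{V}_n(t)]=\mathbf{0}$ and $\operatorname{cov}(\mathbf{V}_n(t_1),\mathbf{V}_n(t_2))=a_n^2\mathsf{B}_n(t_1-t_2)$, $n\in\mathbb{N}_0$, and let $\mathbf{U}$ be a random element uniformly distributed on $\mathbb{M}^d$, independent of $\{\mathbf{V}_n(t)\}$. Then the series \[ \mathbf{Z}(\mathbf{x};t)=\sum_{n=0}^\infty\mathbf{V}_n(t)P_n^{(\alpha,\beta)}(\cos\rho(\mathbf{x},\mathbf{U})),\qquad\mathbf{x}\in\mathbb{M}^d,\ t\in\mathbb{T}, \] converges in mean square and defines an $m$-variate random field that is isotropic and mean square continuous on $\mathbb{M}^d$, stationary on $\mathbb{T}$, has mean $\mathbf{0}$, and has covariance matrix function \[ \operatorname{cov}(\mathbf{Z}(\mathbf{x}_1;t_1),\mathbf{Z}(\mathbf{x}_2;t_2))=\sum_{n=0}^\infty\mathsf{B}_n(t_1-t_2)P_n^{(\alpha,\beta)}(\cos\rho(\mathbf{x}_1,\mathbf{x}_2)),\qquad \mathbf{x}_1,\mathbf{x}_2\in\mathbb{M}^d,\ t_1,t_2\in\mathbb{T}.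 \]
   Context: A compact connected two-point homogeneous space $\mathbb{M}^d$ of real dimension $d$ is one of: the sphere $\mathbb{S}^d$, the real projective space $\mathbb{P}^d(\mathbb{R})$, the complex projective space $\mathbb{P}^d(\mathbb{C})$ ($d$ even, $d\ge4$), the quaternionic projective space $\mathbb{P}^d(\mathbb{H})$ ($d=8,12,\dots$), or the octonionic projective plane $\mathbb{P}^{16}(\mathbb{O})$. Each is a Riemannian manifold all of whose geodesics are closed; the metric is normalized so that every closed geodesic has length $2\pi$ (as for the unit sphere $\mathbb{S}^d\subset\mathbb{R}^{d+1}$ with $\rho(\mathbf{x}_1,\mathbf{x}_2)=\arccos(\mathbf{x}_1^\top\mathbf{x}_2)$). $\rho$ denotes the induced geodesic distance, $\mu$ the canonical Riemannian volume measure, $\omega_d=\mu(\mathbb{M}^d)$. The parameters $(\alpha,\beta)$ are: for $\mathbb{S}^d$, $\alpha=\beta=\frac{d-2}{2}$; for $\mathbb{P}^d(\mathbb{R})$, $\alpha=\frac{d-2}{2}$, $\beta=-\frac12$; for $\mathbb{P}^d(\mathbb{C})$, $\alpha=\frac{d-2}{2}$, $\beta=0$; for $\mathbb{P}^d(\mathbb{H})$, $\alpha=\frac{d-2}{2}$, $\beta=1$; for $\mathbb{P}^{16}(\mathbb{O})$, $\alpha=7$, $\beta=3$. $P_n^{(\alpha,\beta)}$ is the Jacobi polynomial of degree $n$ in the standard normalization $P_n^{(\alpha,\beta)}(1)=\frac{\Gamma(n+\alpha+1)}{\Gamma(n+1)\Gamma(\alpha+1)}$. The constants are $a_n=\left(\frac{\Gamma(\beta+1)(2n+\alpha+\beta+1)\Gamma(n+\alpha+\beta+1)}{\Gamma(\alpha+\beta+2)\Gamma(n+\beta+1)}\right)^{1/2}$.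 A random element $\mathbf{U}$ of $\mathbb{M}^d$ is uniformly distributed if its law is invariant under all isometries of $\mathbb{M}^d$; equivalently its law is $\mu/\omega_d$. The temporal domain $\mathbb{T}$ is either $\mathbb{R}$ or $\mathbb{Z}$. A stationary covariance matrix function on $\mathbb{T}$ is an $m\times m$ matrix function $\mathsf{B}(t)$ such that $\mathsf{B}(t_1-t_2)=\operatorname{cov}(\mathbf{V}(t_1),\mathbf{V}(t_2))$ for some $m$-variate second-order wide-sense stationary process $\mathbf{V}$ on $\mathbb{T}$. An $m$-variate random field on $\mathbb{M}^d\times\mathbb{T}$ is isotropic over $\mathbb{M}^d$ and stationary over $\mathbb{T}$ if its mean is constant and $\operatorname{cov}(\mathbf{Z}(\mathbf{x}_1;t_1),\mathbf{Z}(\mathbf{x}_2;t_2))=\mathsf{E}[(\mathbf{Z}(\mathbf{x}_1;t_1)-\mathsf{E}\mathbf{Z}(\mathbf{x}_1;t_1))(\mathbf{Z}(\mathbf{x}_2;t_2)-\mathsf{E}\mathbf{Z}(\mathbf{x}_2;t_2))^\top]$ depends only on $\rho(\mathbf{x}_1,\mathbf{x}_2)$ and $t_1-t_2$; it is mean square continuous on $\mathbb{M}^d$ if for each $t$ and each component $k$, $\mathsf{E}|Z_k(\mathbf{x}_1;t)-Z_k(\mathbf{x}_2;t)|^2\to0$ as $\rho(\mathbf{x}_1,\mathbf{x}_2)\to0$. A series of matrices converges if each entry converges. *)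

(* Defs.v *)
From HB Require Import structures.
From mathcomp Require Import all_boot all_order all_algebra.
From mathcomp Require Import all_classical all_reals all_analysis.
Set Implicit Arguments. Unset Strict Implicit. Unset Printing Implicit Defensive.
Import Order.TTheory GRing.Theory Num.Theory.
Import numFieldNormedType.Exports.
Local Open Scope classical_set_scope.
Local Open Scope ring_scope.

(* Cayley-Dickson algebras over R: level 0 = R, 1 = C, 2 = H, 3 = O.   *)
Section CD.
Variable R : realType.

Fixpoint CD (j : nat) : Type :=
  match j with 0 => R | j'.+1 => (CD j' * CD j')%type end.

Fixpoint cd0 (j : nat) : CD j :=
  match j return CD j with 0 => 0 | j'.+1 => (cd0 j', cd0 j') end.

Fixpoint cdadd (j : nat) : CD j -> CD j -> CD j :=
  match j return CD j -> CD j -> CD j with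
  | 0 => fun a b => a + b
  | j'.+1 => fun a b => (cdadd a.1 b.1, cdadd a.2 b.2)
  end.

Fixpoint cdopp (j : nat) : CD j -> CD j :=
  match j return CD j -> CD j with
  | 0 => fun a => - a
  | j'.+1 => fun a => (cdopp a.1, cdopp a.2)
  end.

Fixpoint cdconj (j : nat) : CD j -> CD j :=
  match j return CD j -> CD j with
  | 0 => fun a => a
  | j'.+1 => fun a => (cdconj a.1, cdopp a.2)
  end.

Fixpoint cdmul (j : nat) : CD j -> CD j -> CD j :=
  match j return CD j -> CD j -> CD j with
  | 0 => fun a b => a * b
  | j'.+1 => fun x y =>
      (cdadd (cdmul x.1 y.1) (cdopp (cdmul (cdconj y.2) x.2)),
       cdadd (cdmul y.2 x.1) (cdmul x.2 (cdconj y.1)))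
  end.

Fixpoint cdre (j : nat) : CD j -> R :=
  match j return CD j -> R with
  | 0 => fun a => a
  | j'.+1 => fun a => cdre a.1
  end.

Fixpoint cdreal (j : nat) (r : R) : CD j :=
  match j return CD j with 0 => r | j'.+1 => (cdreal j' r, cd0 j') end.

(* Projective space P^n(F), F = CD j, j <= 3 (with n = 2 if j = 3):     *)
(* rank-one projections = Hermitian idempotent (n+1)x(n+1) matrices of  *)
(* trace 1 over F (for F = O and n = 2 this is the Cayley plane).       *)
Definition cdmat (j N : nat) := 'I_N -> 'I_N -> CD j.

Definition cdmatmul (j N : nat) (p q : cdmat j N) : cdmat j N :=
  fun i k => foldr (@cdadd j) (cd0 j) [seq cdmul (p i l) (q l k) | l <- enum 'I_N].

Definition is_rank1_proj (j N : nat) (p : cdmat j N) : Prop :=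
  [/\ (forall i k, p i k = cdconj (p k i)),
      cdmatmul p p = p &
      \sum_(i < N) cdre (p i i) = 1].

Definition proj_pt (j n : nat) := {p : cdmat j n.+1 | is_rank1_proj p}.

(* cos rho(p,q) = 2 Re tr(pq) - 1 (geodesic length 2*pi normalization) *)
Definition proj_cosrho (j n : nat) (p q : proj_pt j n) : R :=
  2 * (\sum_(i < n.+1) cdre (cdmatmul (proj1_sig p) (proj1_sig q) i i)) - 1.

Definition proj_rho (j n : nat) (p q : proj_pt j n) : R := acos (proj_cosrho p q).

Definition sphere_pt (d : nat) := {x : 'I_d.+1 -> R | \sum_(i < d.+1) x i ^+ 2 = 1}.

Definition sphere_rho (d : nat) (x y : sphere_pt d) : R :=
  acos (\sum_(i < d.+1) proj1_sig x i * proj1_sig y i).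
End CD.

(* Compact connected two-point homogeneous spaces M^d                   *)
Inductive cthps := Sphere | RealProj | CplxProj | QuatProj | OctProj.

Definition valid_dim (K : cthps) (d : nat) : bool :=
  match K with
  | Sphere => (2 <= d)%N
  | RealProj => (2 <= d)%N
  | CplxProj => ~~ odd d && (4 <= d)%N
  | QuatProj => (4 %| d)%N && (8 <= d)%N
  | OctProj => d == 16%N
  end.

Definition Mspace (R : realType) (K : cthps) (d : nat) : Type :=
  match K with
  | Sphere => sphere_pt R d
  | RealProj => proj_pt R 0 d
  | CplxProj => proj_pt R 1 (d %/ 2)
  | QuatProj => proj_pt R 2 (d %/ 4)
  | OctProj => proj_pt R 3 (d %/ 8)
  end.

Definition Mrho (R : realType) (K : cthps) (d : nat) : Mspace R K d -> Mspace R K d -> R :=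
  match K return Mspace R K d -> Mspace R K d -> R with
  | Sphere => @sphere_rho R d
  | RealProj => @proj_rho R 0 d
  | CplxProj => @proj_rho R 1 (d %/ 2)
  | QuatProj => @proj_rho R 2 (d %/ 4)
  | OctProj => @proj_rho R 3 (d %/ 8)
  end.

Definition jac_alpha (R : realType) (K : cthps) (d : nat) : R :=
  match K with OctProj => 7 | _ => (d%:R - 2) / 2 end.

Definition jac_beta (R : realType) (K : cthps) (d : nat) : R :=
  match K with
  | Sphere => (d%:R - 2) / 2
  | RealProj => - (1 / 2)
  | CplxProj => 0
  | QuatProj => 1
  | OctProj => 3
  end.

Section Jacobi.
Variable R : realType.

Definition gbinom (z : R) (k : nat) : R := (\prod_(i < k) (z - i%:R)) / (k`!)%:R.

(* P_n^{(al,be)}(x) = sum_s C(n+al, n-s) C(n+be, s) ((x-1)/2)^s ((x+1)/2)^(n-s);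
   standard normalization P_n(1) = Gamma(n+al+1)/(Gamma(n+1)Gamma(al+1)). *)
Definition jacobiP (al be : R) (n : nat) (x : R) : R :=
  \sum_(s < n.+1) gbinom (n%:R + al) (n - s) * gbinom (n%:R + be) s
     * ((x - 1) / 2) ^+ s * ((x + 1) / 2) ^+ (n - s).

Definition poch (z : R) (n : nat) : R := \prod_(i < n) (z + i%:R).

(* a_n^2 = Gamma(be+1)(2n+al+be+1)Gamma(n+al+be+1) / (Gamma(al+be+2)Gamma(n+be+1)),
   written with Pochhammer symbols:  with c = al+be+1 > 0,
   Gamma(n+c)/Gamma(c+1) = (c)_n / c  and  Gamma(be+1)/Gamma(n+be+1) = 1/(be+1)_n. *)
Definition a_sq (al be : R) (n : nat) : R :=
  (2 * n%:R + al + be + 1) * poch (al + be + 1) n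
    / ((al + be + 1) * poch (be + 1) n).
End Jacobi.

Definition Tdom (R : realType) (discrete : bool) : zmodType :=
  if discrete then (int : zmodType) else (R : zmodType).

Section Prob.
Context {R : realType} {dd : measure_display} {Omega : measurableType dd}.
Variable P : probability Omega R.

Definition Rexp (f : Omega -> R) : R := fine (\int[P]_w (f w)%:E).

Definition rvec2 (m : nat) (X : Omega -> 'I_m -> R) : Prop :=
  forall i, measurable_fun setT (fun w => X w i) /\
            P.-integrable setT (fun w => ((X w i) ^+ 2)%:E).

Definition meanv (m : nat) (X : Omega -> 'I_m -> R) : 'I_m -> R :=
  fun i => Rexp (fun w => X w i).

Definition covm (m : nat) (X Y : Omega -> 'I_m -> R) : 'M[R]_m :=
  \matrix_(i, j) Rexp (fun w => (X w i - meanv X i) * (Y w j - meanv Y j)).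

Definition msd (f g : Omega -> R) : \bar R := \int[P]_w (((f w - g w) ^+ 2)%:E).

Definition Pr (A : set Omega) : R := fine (P A).

Definition sigma_proc (I : Type) (m : nat) (W : I -> Omega -> 'I_m -> R) : set (set Omega) :=
  <<s [set A | exists t i (B : set R), measurable B /\ A = (fun w => W t w i) @^-1` B] >>.

Definition mutually_independent (F : nat -> set (set Omega)) : Prop :=
  forall (I : seq nat) (A : nat -> set Omega), uniq I ->
    (forall i, i \in I -> F i (A i)) ->
    Pr (\bigcap_(i in [set` I]) A i) = \prod_(i <- I) Pr (A i).

Definition independent2 (F G : set (set Omega)) : Prop :=
  forall A B, F A -> G B -> Pr (A `&` B) = Pr A * Pr B.
End Prob.

Section Metric.
Context {R : realType} {M : Type}.
Variable rho : M -> M -> R.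

Definition rho_open (A : set M) : Prop :=
  forall x, A x -> exists2 e : R, 0 < e & forall y, rho x y < e -> A y.

Definition rho_borel : set (set M) := <<s rho_open >>.

Definition rho_isometry (f : M -> M) : Prop :=
  bijective f /\ forall x y, rho (f x) (f y) = rho x y.

Context {dd : measure_display} {Omega : measurableType dd}.
Variable P : probability Omega R.

Definition random_element (U : Omega -> M) : Prop :=
  forall A, rho_borel A -> measurable (U @^-1` A).

Definition sigma_elem (U : Omega -> M) : set (set Omega) :=
  [set B | exists2 A, rho_borel A & B = U @^-1` A].

Definition uniform_on (U : Omega -> M) : Prop :=
  random_element U /\
  forall f, rho_isometry f -> forall A, rho_borel A ->
     P (U @^-1` (f @^-1` A)) = P (U @^-1` A).
End Metric.

Section Fields.
Context {R : realType}.

Definition stat_cov_fun (T : zmodType) (m : nat) (B : T -> 'M[R]_m) : Prop :=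
  exists (d' : measure_display) (Om : measurableType d') (Q : probability Om R)
         (W : T -> Om -> 'I_m -> R),
    (forall t, rvec2 Q (W t)) /\
    (exists mu, forall t, meanv Q (W t) = mu) /\
    (forall t1 t2, B (t1 - t2) = covm Q (W t1) (W t2)).

Context {dd : measure_display} {Omega : measurableType dd}.
Variable P : probability Omega R.

Definition iso_stat (M : Type) (rho : M -> M -> R) (T : zmodType) (m : nat)
    (Z : M -> T -> Omega -> 'I_m -> R) : Prop :=
  (forall x t, rvec2 P (Z x t)) /\
  (exists mu, forall x t, meanv P (Z x t) = mu) /\
  (exists C : R -> T -> 'M[R]_m, forall x1 x2 t1 t2,
      covm P (Z x1 t1) (Z x2 t2) = C (rho x1 x2) (t1 - t2)).

Definition ms_continuous (M : Type) (rho : M -> M -> R) (T : Type) (m : nat)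
    (Z : M -> T -> Omega -> 'I_m -> R) : Prop :=
  forall t k (e : R), 0 < e -> exists2 delta : R, 0 < delta &
    forall x1 x2, rho x1 x2 < delta ->
      (msd P (fun w => Z x1 t w k) (fun w => Z x2 t w k) < e%:E)%E.
End Fields.

(* Main.v *)
(** Since the processes [V_n] are independent and centred, everything reduces to the
    reproducing formula [E (Q_n(t(x,U)) Q_n(t(y,U))) = Q_n(t(x,y)) / a_n^2], where
    [t = (1 + cos rho) / 2] and [Q_n(t)] is the Jacobi polynomial in the variable [t].

    For polynomials [q] and [h], two-point homogeneity makes [E (q(t(x,U)) h(t(y,U)))] a
    polynomial [k] in [t(x,y)].  Taking second differences in [x] along orthogonal
    geodesics shows that applying the Jacobi operator [L] to [q] amounts to applying it to
    [k]; by symmetry the same holds for [h], so [L] can be moved from [q] to [h].  With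
    [h = Q_n], an eigenfunction of [L], this gives a two-term recursion for the moments
    [E (t(x,U)^m h(t(y,U)))].  As [m] grows, the weights [t(x,U)^m] concentrate at [x], so
    these moments, divided by [E (t(x,U)^m)], tend to [h(t(y,x))]; comparing with the
    recursion determines all of them.

    A point of a projective space is a Hermitian idempotent [p] of trace 1, equivalently
    a Hermitian matrix of trace 1 with [p_il p_lk = p_ll p_ik].  Two-point homogeneity is
    obtained from conjugations by unitaries acting on two rows; over the octonions they
    preserve these relations because of the middle Moufang identity. *)

Require Import Defs.
From HB Require Import structures.
From mathcomp Require Import all_boot all_order all_algebra.
From mathcomp Require Import all_classical all_reals all_analysis.
From mathcomp Require Import measurable_realfun ring lra.
Set Implicit Arguments. Unset Strict Implicit. Unset Printing Implicit Defensive.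
Import Order.TTheory GRing.Theory Num.Theory.
Import numFieldNormedType.Exports.
Local Open Scope classical_set_scope.
Local Open Scope ring_scope.

(** * Cayley-Dickson algebras *)

(** The law of [U] is known only through its invariance, and the spaces are bare sets of vectors or
    matrices: no volume form, Laplacian or addition formula is at hand. Expectation over [U]
    therefore enters the analytic part as a positive, normalised, invariant linear functional [E] on
    a class of functions closed under sums and products, and the geometry enters only through the
    kernel [t]. Moving [L] across relies on second differences of polynomials with errors uniform in
    [u], so no derivative is exchanged with [E].

    Symmetry of [L] leaves one scalar free: the moments of degree below [n] against [Q_n] vanish,
    and at degree [n] the coefficient in the recursion vanishes. The concentration limit supplies
    this scalar and leads to [a_n^2 = (2n + c) / ((n + c) E(t^n))] with [c = al + be + 1].

    On the geometric side, conjugations by octonionic matrices do not compose like their matrices.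
    Homogeneity is thus reached by composing maps, each an elementary rotation of two rows, and rank
    one is tested by real identities in the entries, where the composition of norms replaces
    associativity. *)

Section CayleyDickson.
Variable R : realType.

Fixpoint cdip (j : nat) : CD R j -> CD R j -> R :=
  match j return CD R j -> CD R j -> R with
  | 0 => fun a b => a * b
  | j'.+1 => fun a b => cdip a.1 b.1 + cdip a.2 b.2
  end.

Fixpoint cdscale (j : nat) (r : R) : CD R j -> CD R j :=
  match j return CD R j -> CD R j with
  | 0 => fun a => r * a
  | j'.+1 => fun a => (cdscale r a.1, cdscale r a.2)
  end.

Lemma cdipC j (a b : CD R j) : cdip a b = cdip b a.
Proof.
elim: j a b => [|j IH] a b /=; first by rewrite mulrC.
by rewrite IH (IH a.2).
Qed.

Lemma cdipDl j (a b c : CD R j) : cdip (cdadd a b) c = cdip a c + cdip b c.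
Proof.
elim: j a b c => [|j IH] a b c /=; first by rewrite mulrDl.
by rewrite !IH addrACA.
Qed.

Lemma cdipDr j (a b c : CD R j) : cdip c (cdadd a b) = cdip c a + cdip c b.
Proof. by rewrite cdipC cdipDl !(cdipC c). Qed.

Lemma cdipNl j (a b : CD R j) : cdip (cdopp a) b = - cdip a b.
Proof.
elim: j a b => [|j IH] a b /=; first by rewrite mulNr.
by rewrite !IH opprD.
Qed.

Lemma cdipNr j (a b : CD R j) : cdip b (cdopp a) = - cdip b a.
Proof. by rewrite cdipC cdipNl cdipC. Qed.

Lemma cdipZl j r (a b : CD R j) : cdip (cdscale r a) b = r * cdip a b.
Proof.
elim: j a b => [|j IH] a b /=; first by rewrite mulrA.
by rewrite !IH mulrDr.
Qed.

Lemma cdipZr j r (a b : CD R j) : cdip b (cdscale r a) = r * cdip b a.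
Proof. by rewrite cdipC cdipZl cdipC. Qed.

Lemma cdip0l j (a : CD R j) : cdip (cd0 R j) a = 0.
Proof. by elim: j a => [|j IH] a /=; rewrite ?mul0r // !IH addr0. Qed.

Lemma cdip0r j (a : CD R j) : cdip a (cd0 R j) = 0.
Proof. by rewrite cdipC cdip0l. Qed.

Lemma cdip_ge0 j (a : CD R j) : 0 <= cdip a a.
Proof.
by elim: j a => [|j IH] a /=; [rewrite -expr2 sqr_ge0 | rewrite addr_ge0].
Qed.

Lemma cdip_eq0 j (a : CD R j) : cdip a a = 0 -> a = cd0 R j.
Proof.
elim: j a => [|j IH] a /=; first by move/eqP; rewrite mulf_eq0 orbb => /eqP.
move=> /eqP; rewrite paddr_eq0 ?cdip_ge0 // => /andP[/eqP h1 /eqP h2].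
by case: a h1 h2 => a1 a2 /= /IH -> /IH ->.
Qed.

(** [CD R j] carries no ring or module structure. Pairing both sides of an equation with an
    arbitrary [z] turns it into an identity of real numbers, which [ring] decides; most equations in
    the algebra are proved this way below. *)
Lemma cdip_ext j (a b : CD R j) : (forall z, cdip a z = cdip b z) -> a = b.
Proof.
elim: j a b => [|j IH] a b h; first by have := h 1; rewrite /= !mulr1.
case: a b h => a1 a2 [b1 b2] h; congr pair; apply: IH => z.
  by have := h (z, cd0 R j); rewrite /= !cdip0r !addr0.
by have := h (cd0 R j, z); rewrite /= !cdip0r !add0r.
Qed.

Definition cdipE := (cdipDl, cdipDr, cdipNl, cdipNr, cdipZl, cdipZr, cdip0l, cdip0r).

Lemma cdconjD j (a b : CD R j) : cdconj (cdadd a b) = cdadd (cdconj a) (cdconj b).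
Proof.
elim: j a b => [|j IH] a b //=; congr pair; first exact: IH.
by apply: cdip_ext => z; rewrite !cdipE; ring.
Qed.

Lemma cdconjN j (a : CD R j) : cdconj (cdopp a) = cdopp (cdconj a).
Proof. by elim: j a => [|j IH] a //=; rewrite IH. Qed.

Lemma cdconjZ j r (a : CD R j) : cdconj (cdscale r a) = cdscale r (cdconj a).
Proof.
elim: j a => [|j IH] a //=; congr pair; first exact: IH.
by apply: cdip_ext => z; rewrite !cdipE; ring.
Qed.

Lemma cdoppK j (a : CD R j) : cdopp (cdopp a) = a.
Proof. by apply: cdip_ext => z; rewrite !cdipE; ring. Qed.

Lemma cdconjK j (a : CD R j) : cdconj (cdconj a) = a.
Proof. by elim: j a => [|j IH] // [a b] /=; rewrite IH cdoppK. Qed.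

Lemma cdip_conj j (a b : CD R j) : cdip (cdconj a) (cdconj b) = cdip a b.
Proof. by elim: j a b => [|j IH] a b //=; rewrite IH !cdipE opprK. Qed.

Lemma cdip_conjl j (a b : CD R j) : cdip (cdconj a) b = cdip a (cdconj b).
Proof. by rewrite -cdip_conj cdconjK. Qed.

(** One induction proves both laws: the doubling formula reverses the order of some factors, so each
    law at level [j.+1] calls on both at level [j]. *)
Lemma cdmul_bilin j :
  (forall a b c : CD R j, cdmul (cdadd a b) c = cdadd (cdmul a c) (cdmul b c)) /\
  (forall a b c : CD R j, cdmul c (cdadd a b) = cdadd (cdmul c a) (cdmul c b)).
Proof.
elim: j => [|j [IHl IHr]]; first by split=> a b c /=; [exact: mulrDl|exact: mulrDr].
by split=> a b c /=; congr pair; apply: cdip_ext => z;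
  rewrite ?cdconjD !(IHl, IHr) !cdipE; ring.
Qed.

Lemma cdmulDl j (a b c : CD R j) : cdmul (cdadd a b) c = cdadd (cdmul a c) (cdmul b c).
Proof. exact: (cdmul_bilin j).1. Qed.

Lemma cdmulDr j (a b c : CD R j) : cdmul c (cdadd a b) = cdadd (cdmul c a) (cdmul c b).
Proof. exact: (cdmul_bilin j).2. Qed.

Lemma cdmul_scale j r :
  (forall a b : CD R j, cdmul (cdscale r a) b = cdscale r (cdmul a b)) /\
  (forall a b : CD R j, cdmul b (cdscale r a) = cdscale r (cdmul b a)).
Proof.
elim: j => [|j [IHl IHr]]; first by split=> a b /=; ring.
by split=> a b /=; congr pair; apply: cdip_ext => z;
  rewrite ?cdconjZ !(IHl, IHr) !cdipE; ring.
Qed.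

Lemma cdmulZl j r (a b : CD R j) : cdmul (cdscale r a) b = cdscale r (cdmul a b).
Proof. exact: (cdmul_scale j r).1. Qed.

Lemma cdmulZr j r (a b : CD R j) : cdmul b (cdscale r a) = cdscale r (cdmul b a).
Proof. exact: (cdmul_scale j r).2. Qed.

Lemma cdopp_scale j (a : CD R j) : cdopp a = cdscale (-1) a.
Proof. by apply: cdip_ext => z; rewrite !cdipE; ring. Qed.

Lemma cdmulNl j (a b : CD R j) : cdmul (cdopp a) b = cdopp (cdmul a b).
Proof. by rewrite !cdopp_scale cdmulZl. Qed.

Lemma cdmulNr j (a b : CD R j) : cdmul a (cdopp b) = cdopp (cdmul a b).
Proof. by rewrite !cdopp_scale cdmulZr. Qed.

Lemma cdconjM j (a b : CD R j) : cdconj (cdmul a b) = cdmul (cdconj b) (cdconj a).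
Proof.
elim: j a b => [|j IH] a b /=; first by rewrite mulrC.
congr pair; apply: cdip_ext => z;
  rewrite !(cdconjD, cdconjN, cdconjK, IH, cdmulNl, cdmulNr) !cdipE; ring.
Qed.

(** The adjoint of a multiplication is multiplication by the conjugate, at every level and without
    associativity. The version for right multiplication follows by conjugation, and the doubled
    product calls on both. *)
Lemma cdip_mull j (a b c : CD R j) : cdip (cdmul a b) c = cdip b (cdmul (cdconj a) c).
Proof.
elim: j a b c => [|j IH] a b c /=; first by ring.
have IHr (x y z : CD R j) : cdip (cdmul x y) z = cdip x (cdmul z (cdconj y)).
  by rewrite -cdip_conj cdconjM IH -cdip_conj !(cdconjK, cdconjM).
have h : cdip (cdmul (cdconj b.2) a.2) c.1 = cdip b.2 (cdmul a.2 (cdconj c.1)).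
  by rewrite IHr -cdip_conj cdconjK cdconjM cdconjK.
have h' : cdip (cdmul a.2 (cdconj b.1)) c.2 = cdip b.1 (cdmul (cdconj c.2) a.2).
  by rewrite IH -cdip_conj cdconjK cdconjM cdconjK.
rewrite !cdipE (IH a.1) (IHr b.2) h h' cdmulNr cdmulNl !cdipE; ring.
Qed.

Lemma cdip_mulr j (a b c : CD R j) : cdip (cdmul a b) c = cdip a (cdmul c (cdconj b)).
Proof. by rewrite -cdip_conj cdconjM cdip_mull -cdip_conj !(cdconjK, cdconjM). Qed.

Lemma cdmul0r j (a : CD R j) : cdmul (cd0 R j) a = cd0 R j.
Proof. by apply: cdip_ext => z; rewrite cdip_mulr !cdipE. Qed.

Lemma cdmulr0 j (a : CD R j) : cdmul a (cd0 R j) = cd0 R j.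
Proof. by apply: cdip_ext => z; rewrite cdip_mull !cdipE. Qed.

Lemma cdreM j (a b : CD R j) : cdre (cdmul a b) = cdip a (cdconj b).
Proof.
have reD k (x y : CD R k) : cdre (cdadd x y) = cdre x + cdre y.
  by elim: k x y => [|k IH] x y //=.
have reN k (x : CD R k) : cdre (cdopp x) = - cdre x.
  by elim: k x => [|k IH] x //=.
elim: j a b => [|j IH] a b //=.
by rewrite reD reN !IH cdip_conj cdipE (cdipC a.2).
Qed.

Lemma cdre_real j (r : R) : cdre (cdreal j r) = r.
Proof. by elim: j => [|j IH]. Qed.

Lemma cdip_real j (r : R) a : cdip (cdreal j r) a = r * cdre a.
Proof. by elim: j a => [|j IH] a //=; rewrite IH cdip0l addr0. Qed.

Lemma cdconj_fix j (a : CD R j) : cdconj a = a -> a = cdreal j (cdre a).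
Proof.
elim: j a => [|j IH] // [a b] /= [/IH ha hb]; congr pair => //.
apply: cdip_ext => z; have := congr1 (fun x => cdip x z) hb.
rewrite /= !cdipE; lra.
Qed.

Lemma cdconj_real j (r : R) : cdconj (cdreal j r) = cdreal j r.
Proof.
elim: j => [|k IHk] //=; rewrite IHk; congr pair.
by apply: cdip_ext => y; rewrite !cdipE oppr0.
Qed.

Lemma cdmul_reall j (r : R) (a : CD R j) : cdmul (cdreal j r) a = cdscale r a.
Proof.
elim: j a => [|j IH] a //=.
congr pair; first by rewrite IH cdmulr0; apply: cdip_ext => z; rewrite !cdipE; ring.
rewrite cdmul0r; apply: cdip_ext => z.
by rewrite !cdipE addr0 -[cdmul _ _]cdconjK cdconjM cdconj_real IH cdconjZ cdconjK cdipE.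
Qed.

Lemma cdmul_realr j (r : R) (a : CD R j) : cdmul a (cdreal j r) = cdscale r a.
Proof. by rewrite -[LHS]cdconjK cdconjM cdconj_real cdmul_reall cdconjZ cdconjK. Qed.

(** The two-, four- and eight-square identities, checked in coordinates; they stop at the octonions.
    The alternative, flexible and Moufang laws below are drawn from this identity by polarization
    and adjointness. *)
Lemma cd_composition j (a b : CD R j) : (j <= 3)%N ->
  cdip (cdmul a b) (cdmul a b) = cdip a a * cdip b b.
Proof.
case: j a b => [|[|[|[|j]]]] a b //= _.
- by ring.
- by ring.
- by ring.
- by ring.
Qed.

End CayleyDickson.

(** * Composition algebras up to the octonions *)

Section Composition.
Variables (R : realType) (j : nat).
Hypothesis hj : (j <= 3)%N.
Implicit Types a b c w x y z : CD R j.

Lemma cdip_mul2l a b c : cdip (cdmul a b) (cdmul a c) = cdip a a * cdip b c.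
Proof.
have h := cd_composition a (cdadd b c) hj.
rewrite cdmulDr !cdipE !cd_composition // (cdipC (cdmul a c)) (cdipC c b) in h; lra.
Qed.

Lemma cdip_mul2r a b c : cdip (cdmul a b) (cdmul c b) = cdip a c * cdip b b.
Proof.
have h := cd_composition (cdadd a c) b hj.
rewrite cdmulDl !cdipE !cd_composition // (cdipC (cdmul c b)) (cdipC c a) in h; lra.
Qed.

(** The composition identity polarized in both factors: it exchanges [b] and [z] between two
    products, which associativity would otherwise be asked to do. *)
Lemma cdip_mul_polar a b c z :
  cdip (cdmul a b) (cdmul c z) + cdip (cdmul a z) (cdmul c b) = 2 * cdip a c * cdip b z.
Proof.
have h := cdip_mul2r a (cdadd b z) c.
rewrite !cdmulDr !cdipE !cdip_mul2r (cdipC z b) in h; lra.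
Qed.

(** Adjointness moves [cdconj a] to the other side, where the composition identity applies. *)
Lemma cdmulKl a b : cdmul (cdconj a) (cdmul a b) = cdscale (cdip a a) b.
Proof. by apply: cdip_ext => z; rewrite cdip_mull cdconjK cdip_mul2l cdipE. Qed.

Lemma cdmulKVl a b : cdmul a (cdmul (cdconj a) b) = cdscale (cdip a a) b.
Proof. by rewrite -{1}[a]cdconjK cdmulKl cdip_conj. Qed.

Lemma cdmulKr a b : cdmul (cdmul b a) (cdconj a) = cdscale (cdip a a) b.
Proof. by apply: cdip_ext => z; rewrite cdip_mulr cdconjK cdip_mul2r cdipE mulrC. Qed.

Lemma cdmul_conj a : cdmul a (cdconj a) = cdreal j (cdip a a).
Proof.
by have := cdmulKr a (cdreal j 1); rewrite cdmul_reall => h; apply: cdip_ext => z;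
  have := congr1 (fun u => cdip u z) h; rewrite /= cdmulZl !cdipE !cdip_real !mul1r.
Qed.

(* Contains flexibility and the middle Moufang identity. *)
Lemma cdmul_moufang w x y z :
  cdip (cdmul (cdmul w x) (cdmul y w)) z =
  2 * cdip w (cdconj (cdmul x y)) * cdip w z - cdip w w * cdip (cdconj (cdmul x y)) z.
Proof.
rewrite cdip_mulr cdconjM.
have h := cdip_mul_polar w x z (cdmul (cdconj w) (cdconj y)).
rewrite cdmulKVl !cdipE in h.
have e1 : cdip x (cdmul (cdconj w) (cdconj y)) = cdip w (cdconj (cdmul x y)).
  by rewrite -cdip_mull cdip_mulr cdconjM.
have e2 : cdip (cdconj y) (cdmul z x) = cdip (cdconj (cdmul x y)) z.
  by rewrite cdipC cdip_mulr -cdconjM cdipC.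
rewrite e1 e2 in h; lra.
Qed.

Lemma cdmul_sandwichl w x z :
  cdip (cdmul (cdmul w x) w) z = 2 * cdip w (cdconj x) * cdip w z - cdip w w * cdip (cdconj x) z.
Proof.
have := cdmul_moufang w x (cdreal j 1) z.
by rewrite cdmul_reall cdmul_realr cdmulZr cdconjZ !cdipE !mul1r.
Qed.

Lemma cdmul_sandwichr w x z :
  cdip (cdmul w (cdmul x w)) z = 2 * cdip w (cdconj x) * cdip w z - cdip w w * cdip (cdconj x) z.
Proof.
have := cdmul_moufang w (cdreal j 1) x z.
by rewrite cdmul_reall cdmul_realr cdmulZl cdconjZ !cdipE !mul1r.
Qed.

Lemma cdmul_flex w x : cdmul (cdmul w x) w = cdmul w (cdmul x w).
Proof. by apply: cdip_ext => z; rewrite cdmul_sandwichl cdmul_sandwichr. Qed.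

(** Conjugation differs from negation by a real scalar, which commutes and associates with
    everything; flexibility for [w] thereby passes to [cdconj w]. *)
Lemma cdconjE w : cdconj w = cdadd (cdreal j (2 * cdre w)) (cdopp w).
Proof.
elim: (j) w => [|k IH] w /=; first by ring.
congr pair; first exact: IH.
by apply: cdip_ext => z; rewrite !cdipE add0r.
Qed.

Lemma cdmul_flex_conj w x : cdmul (cdmul w x) (cdconj w) = cdmul w (cdmul x (cdconj w)).
Proof.
rewrite cdconjE !cdmulDr !cdmulNr !cdmul_realr cdmul_flex; apply: cdip_ext => z.
by rewrite cdmulZr.
Qed.

Lemma cdmul_conj_flex w x : cdmul (cdmul (cdconj w) x) w = cdmul (cdconj w) (cdmul x w).
Proof. by have := cdmul_flex_conj (cdconj w) x; rewrite cdconjK. Qed.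

End Composition.

(** Serves the matrices with four or more rows, where a rotation meets products [(w x) y] of three
    unrelated factors that the flexible and Moufang laws do not reach. *)
Lemma cdmulA (R : realType) j (hj : (j <= 2)%N) (x y z : CD R j) :
  cdmul x (cdmul y z) = cdmul (cdmul x y) z.
Proof.
case: j hj x y z => [|[|[|j]]] // _; rewrite /=.
- by move=> x y z; ring.
- by move=> [x1 x2] [y1 y2] [z1 z2] /=; congr pair; ring.
- by move=> [[x1 x2] [x3 x4]] [[y1 y2] [y3 y4]] [[z1 z2] [z3 z4]] /=;
    do 2! congr pair; ring.
Qed.

(** * Rank-one projections *)

Section RankOne.
Variables (R : realType) (j N : nat).
Hypothesis hj : (j <= 3)%N.
Implicit Types X Y p q : cdmat R j N.
Implicit Types i k l : 'I_N.

Definition mip X Y : R := \sum_i \sum_k cdip (X i k) (Y i k).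
Definition adjm X : cdmat R j N := fun i k => cdconj (X k i).
Definition mdiag X i : R := cdre (X i i).
(** For [X = v v^*] over an associative algebra both sides are [|v_l|^2 v_i v_k^*]. Unlike
    [X X = X], the relation involves no sum, so it can be followed entry by entry under a rotation
    of two rows. *)
Definition rank1_rel X := forall i l k, cdmul (X i l) (X l k) = cdscale (mdiag X l) (X i k).

Lemma mipC X Y : mip X Y = mip Y X.
Proof. by do 2! apply: eq_bigr => ? _; rewrite cdipC. Qed.

Lemma mip_adj X Y : mip (adjm X) (adjm Y) = mip X Y.
Proof.
by rewrite /mip exchange_big; do 2! apply: eq_bigr => ? _; rewrite /adjm cdip_conj.
Qed.

Lemma adjmK X : adjm (adjm X) = X.
Proof. by apply/funext => i; apply/funext => k; rewrite /adjm cdconjK. Qed.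

Lemma cdip_matmul X Y i k z :
  cdip (cdmatmul X Y i k) z = \sum_l cdip (cdmul (X i l) (Y l k)) z.
Proof.
rewrite /cdmatmul -big_enum /=; elim: (enum _) => [|l s IH] /=.
  by rewrite big_nil cdip0l.
by rewrite big_cons cdipDl IH.
Qed.

Lemma mdiagE X i : adjm X = X -> X i i = cdreal j (mdiag X i).
Proof. by move=> hX; apply: cdconj_fix; rewrite -[in RHS]hX. Qed.

Lemma hermE X i k : adjm X = X -> cdconj (X i k) = X k i.
Proof. by move=> hX; rewrite -[in RHS]hX. Qed.

Lemma trace_matmul p q : adjm q = q ->
  \sum_(i < N) cdre (cdmatmul p q i i) = mip p q.
Proof.
move=> hq; apply: eq_bigr => i _.
have -> : cdre (cdmatmul p q i i) = cdip (cdmatmul p q i i) (cdreal j 1).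
  by rewrite cdipC cdip_real mul1r.
rewrite cdip_matmul; apply: eq_bigr => l _.
by rewrite cdipC cdip_real mul1r cdreM hermE.
Qed.

Lemma rank1_norm X i k : adjm X = X -> rank1_rel X ->
  cdip (X i k) (X i k) = mdiag X i * mdiag X k.
Proof.
move=> hX rX; have := congr1 (@cdre R j) (rX i k i).
rewrite cdreM hermE // => ->; rewrite mdiagE //.
have e (r : R) s : cdre (cdscale r (cdreal j s)) = r * s.
  by have := cdip_real 1 (cdscale r (cdreal j s)); rewrite cdipZr cdip_real cdre_real !mul1r.
by rewrite e mulrC.
Qed.

(** Idempotency turns sums of products of entries into single entries, which gives [\sum_l |p_ii
    p_kl - p_ki p_il|^2 = p_ii (p_ii p_kk - |p_ki|^2)]. Hence the principal minors are nonnegative.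
    Their sum over [i] and [k] is [1 - 1 = 0] by the trace condition, so they all vanish, and with
    them the differences on the left. *)
Lemma proj_rank1 p : is_rank1_proj p -> [/\ adjm p = p, rank1_rel p & \sum_i mdiag p i = 1].
Proof.
move=> [hp pp tr].
have ap : adjm p = p by apply/funext => i; apply/funext => k; rewrite /adjm -hp.
have ppE i k z : \sum_l cdip (cdmul (p i l) (p l k)) z = cdip (p i k) z.
  by rewrite -cdip_matmul pp.
have dE i : mdiag p i = \sum_l cdip (p i l) (p i l).
  have := ppE i i (cdreal j 1); rewrite [RHS]cdipC cdip_real mul1r -/(mdiag p i) => <-.
  by apply: eq_bigr => l _; rewrite cdipC cdip_real mul1r cdreM hermE.
have d_ge0 i : 0 <= mdiag p i by rewrite dE sumr_ge0 // => l _; exact: cdip_ge0.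
pose del i k l := cdadd (cdscale (mdiag p i) (p k l)) (cdopp (cdmul (p k i) (p i l))).
have delE i k : \sum_l cdip (del i k l) (del i k l) =
    mdiag p i * (mdiag p i * mdiag p k - cdip (p k i) (p k i)).
  transitivity (mdiag p i ^+ 2 * (\sum_l cdip (p k l) (p k l))
     - 2 * mdiag p i * (\sum_l cdip (cdmul (p k l) (p l i)) (p k i))
     + cdip (p k i) (p k i) * (\sum_l cdip (p i l) (p i l))).
    rewrite !mulr_sumr -sumrB -big_split /=; apply: eq_bigr => l _.
    rewrite /del !cdipE (cd_composition _ _ hj) (cdipC (p k l) (cdmul _ _)).
    have -> : cdip (cdmul (p k i) (p i l)) (p k l) = cdip (cdmul (p k l) (p l i)) (p k i).
      by rewrite cdip_mulr hermE // cdipC.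
    ring.
  rewrite ppE -!dE; ring.
have D_ge0 i k : 0 <= mdiag p i * mdiag p k - cdip (p k i) (p k i).
  have [di|di] := eqVneq (mdiag p i) 0.
    have : cdip (p i k) (p i k) = 0.
      apply/eqP; rewrite eq_le cdip_ge0 andbT -di dE (bigD1 k) //= lerDl sumr_ge0 //.
      by move=> l _; exact: cdip_ge0.
    by rewrite -cdip_conj hermE // di mul0r => ->; rewrite subr0.
  rewrite -(pmulr_rge0 _ (_ : 0 < mdiag p i)) ?lt_neqAle 1?eq_sym ?di ?d_ge0 //.
  by rewrite -delE sumr_ge0 // => l _; exact: cdip_ge0.
have S0 : \sum_i \sum_k (mdiag p i * mdiag p k - cdip (p k i) (p k i)) = 0.
  under eq_bigr => i _ do rewrite sumrB -mulr_sumr tr mulr1.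
  rewrite sumrB tr exchange_big /=; under [X in _ - X]eq_bigr => i _ do rewrite -dE.
  by rewrite tr subrr.
have D0 i k : mdiag p i * mdiag p k - cdip (p k i) (p k i) = 0.
  have h : \sum_k (mdiag p i * mdiag p k - cdip (p k i) (p k i)) = 0.
    by apply: (psumr_eq0P _ S0) => // i' _; apply: sumr_ge0.
  exact: (psumr_eq0P _ h).
split=> // k i l; have := delE i k; rewrite D0 mulr0 => /psumr_eq0P h.
have := cdip_eq0 (h (fun l _ => cdip_ge0 _) l isT) => e.
apply: cdip_ext => z; have := congr1 (fun u => cdip u z) e.
by rewrite /del /= !cdipE; lra.
Qed.

Lemma rank1_proj p : adjm p = p -> rank1_rel p -> \sum_i mdiag p i = 1 -> is_rank1_proj p.
Proof.
move=> hp rp tr; split=> //; first by move=> i k; rewrite hermE.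
apply/funext => i; apply/funext => k; apply: cdip_ext => z; rewrite cdip_matmul.
under eq_bigr => l _ do rewrite rp cdipZl.
by rewrite -mulr_suml tr mul1r.
Qed.

Lemma mip_proj p : is_rank1_proj p -> mip p p = 1.
Proof.
move=> /proj_rank1 [hp rp tr]; rewrite /mip.
under eq_bigr => i _ do (under eq_bigr => k _ do rewrite rank1_norm //; rewrite -mulr_sumr tr mulr1).
exact: tr.
Qed.

(** The real part of [X_il X_lk X_ki] for Hermitian [X]. It is symmetric in the three indices, so a
    relation need be checked for one ordering of a triple only. *)
Definition cubf X i l k := cdip (cdmul (X i l) (X l k)) (X i k).

Lemma cubf_swap12 X i l k : adjm X = X -> cubf X i l k = cubf X l i k.
Proof. by move=> hX; rewrite /cubf cdip_mull hermE // cdipC. Qed.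

Lemma cubf_swap23 X i l k : adjm X = X -> cubf X i l k = cubf X i k l.
Proof. by move=> hX; rewrite /cubf cdip_mulr hermE // cdipC. Qed.

(** The norm conditions give both sides of [rank1_rel] the same norm, and their inner product is
    [mdiag X l * cubf X i l k]; the third condition makes the difference a null vector. What remains
    to be checked are real equations, symmetric in the indices. *)
Lemma rank1_criterion X : adjm X = X ->
  (forall i k, cdip (X i k) (X i k) = mdiag X i * mdiag X k) ->
  (forall i l k, i != l -> l != k -> i != k ->
     cubf X i l k = mdiag X i * mdiag X l * mdiag X k) ->
  rank1_rel X.
Proof.
move=> hX nX cX i l k.
have c2 x y : cubf X x x y = mdiag X x * mdiag X x * mdiag X y.
  by rewrite /cubf mdiagE // cdmul_reall cdipZl nX mulrA.
have {}cX : cubf X i l k = mdiag X i * mdiag X l * mdiag X k.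
  have [<-|il] := eqVneq i l; first exact: c2.
  have [<-|lk] := eqVneq l k; first by rewrite cubf_swap12 // cubf_swap23 // c2; ring.
  have [<-|ik] := eqVneq i k; first by rewrite cubf_swap23 // c2; ring.
  exact: cX.
have h : cdip (cdadd (cdmul (X i l) (X l k)) (cdopp (cdscale (mdiag X l) (X i k))))
   (cdadd (cdmul (X i l) (X l k)) (cdopp (cdscale (mdiag X l) (X i k)))) = 0.
  rewrite !cdipE cd_composition // !nX (cdipC (X i k)).
  by rewrite -/(cubf X i l k) cX; ring.
apply: cdip_ext => z; have := congr1 (fun u => cdip u z) (cdip_eq0 h).
by rewrite /= !cdipE; lra.
Qed.
End RankOne.

(** * Rotations of two rows *)

Section Rotation.
Variables (R : realType) (j N : nat).
Hypothesis hj : (j <= 3)%N.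
Implicit Types X Y : cdmat R j N.
Implicit Types (i k l a b : 'I_N) (w : CD R j) (c s : R).

Definition mrotl a b w c s X : cdmat R j N := fun i k =>
  if i == a then cdadd (cdscale c (X a k)) (cdscale s (cdmul w (X b k)))
  else if i == b then cdadd (cdscale (- s) (cdmul (cdconj w) (X a k))) (cdscale c (X b k))
  else X i k.

Definition mrotr a b w c s X := adjm (mrotl a b w c s (adjm X)).

(* Conjugation [g X g^*] by the unitary [g] acting on rows [a] and [b] as
   [[c, s w], [- s w^*, c]]. *)
Definition mrot a b w c s X := mrotr a b w c s (mrotl a b w c s X).

Lemma mrotrE a b w c s X i k : mrotr a b w c s X i k =
  if k == a then cdadd (cdscale c (X i a)) (cdscale s (cdmul (X i b) (cdconj w)))
  else if k == b then cdadd (cdscale (- s) (cdmul (X i a) w)) (cdscale c (X i b))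
  else X i k.
Proof.
rewrite /mrotr /mrotl /adjm.
case: ifP => _; first by rewrite cdconjD !cdconjZ cdconjM !cdconjK.
case: ifP => _; first by rewrite cdconjD !cdconjZ cdconjM !cdconjK.
by rewrite cdconjK.
Qed.

Lemma adjm_mrotl a b w c s X : adjm (mrotl a b w c s X) = mrotr a b w c s (adjm X).
Proof. by rewrite /mrotr adjmK. Qed.

Lemma mrotlK a b w c s X : a != b -> cdip w w = 1 -> c ^+ 2 + s ^+ 2 = 1 ->
  mrotl a b w c (- s) (mrotl a b w c s X) = X.
Proof.
move=> ab w1 cs; apply/funext => i; apply/funext => k; rewrite /mrotl !eqxx (eq_sym b a) (negbTE ab).
case: eqVneq => [->|ia].
  rewrite !cdmulDr !cdmulZr (cdmulKVl hj) w1; apply: cdip_ext => z; rewrite !cdipE.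
  by transitivity ((c ^+ 2 + s ^+ 2) * cdip (X a k) z); [ring | rewrite cs mul1r].
case: eqVneq => [->|ib] //.
rewrite !cdmulDr !cdmulZr (cdmulKl hj) w1; apply: cdip_ext => z; rewrite !cdipE.
by transitivity ((c ^+ 2 + s ^+ 2) * cdip (X b k) z); [ring | rewrite cs mul1r].
Qed.

Lemma mrotrK a b w c s X : a != b -> cdip w w = 1 -> c ^+ 2 + s ^+ 2 = 1 ->
  mrotr a b w c (- s) (mrotr a b w c s X) = X.
Proof. by move=> *; rewrite /mrotr adjmK mrotlK // adjmK. Qed.

(** Acting on rows and acting on columns commute although octonions do not associate: only entries
    with both indices in [{a, b}] are multiplied on both sides, by [w] or [cdconj w], and there
    flexibility identifies the two bracketings. *)
Lemma mrotlrC a b w c s c' s' X :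
  mrotl a b w c s (mrotr a b w c' s' X) = mrotr a b w c' s' (mrotl a b w c s X).
Proof.
apply/funext => i; apply/funext => k; rewrite mrotrE /mrotl !mrotrE.
have [ka|ka] := eqVneq k a; have [ia|ia] := eqVneq i a => //;
have [kb|kb] := eqVneq k b; have [ib|ib] := eqVneq i b => //;
rewrite ?eqxx ?cdmulDl ?cdmulDr ?cdmulZl ?cdmulZr
  ?(cdmul_flex hj) ?(cdmul_flex_conj hj) ?(cdmul_conj_flex hj);
  apply: cdip_ext => z; rewrite !cdipE; try ring.
all: have := cdmul_flex hj (cdconj w) (X b a) => ->; ring.
Qed.

Lemma mrotK a b w c s X : a != b -> cdip w w = 1 -> c ^+ 2 + s ^+ 2 = 1 ->
  mrot a b w c (- s) (mrot a b w c s X) = X.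
Proof. by move=> *; rewrite /mrot mrotlrC mrotrK // mrotlK. Qed.

Lemma adjm_mrot a b w c s X : adjm (mrot a b w c s X) = mrot a b w c s (adjm X).
Proof. by rewrite /mrot {1}/mrotr adjmK adjm_mrotl mrotlrC. Qed.

Lemma mip_mrotl a b w c s X Y : a != b -> cdip w w = 1 -> c ^+ 2 + s ^+ 2 = 1 ->
  mip (mrotl a b w c s X) (mrotl a b w c s Y) = mip X Y.
Proof.
move=> ab w1 cs; rewrite /mip exchange_big [RHS]exchange_big /=; apply: eq_bigr => k _.
rewrite (bigD1 a) //= (bigD1 b) 1?eq_sym //= [RHS](bigD1 a) //= [X in _ = _ + X](bigD1 b) 1?eq_sym //=.
rewrite !addrA; congr (_ + _); last first.
  by apply: eq_bigr => i /andP[ia ib]; rewrite /mrotl (negbTE ia) (negbTE ib).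
rewrite /mrotl !eqxx (eq_sym b a) (negbTE ab) !cdipE !(cdip_mul2l hj) cdip_conj w1.
rewrite (cdip_mull w).
have -> : cdip (X a k) (cdmul w (Y b k)) = cdip (cdmul (cdconj w) (X a k)) (Y b k).
  by rewrite cdip_mull cdconjK.
transitivity ((c ^+ 2 + s ^+ 2) * (cdip (X a k) (Y a k) + cdip (X b k) (Y b k))).
  ring.
by rewrite cs mul1r.
Qed.

Lemma mip_mrot a b w c s X Y : a != b -> cdip w w = 1 -> c ^+ 2 + s ^+ 2 = 1 ->
  mip (mrot a b w c s X) (mrot a b w c s Y) = mip X Y.
Proof. by move=> *; rewrite /mrot /mrotr mip_adj mip_mrotl // mip_adj mip_mrotl. Qed.

(** Exchanging the two rows keeps the shape of the unitary, [w] becoming [- w^*]. Facts about row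
    [b] are obtained from those about row [a] in this way. *)
Lemma mrot_swap a b w c s X : a != b ->
  mrot a b w c s X = mrot b a (cdopp (cdconj w)) c s X.
Proof.
move=> ab.
have e Y : mrotl a b w c s Y = mrotl b a (cdopp (cdconj w)) c s Y.
  apply/funext => i; apply/funext => k; rewrite /mrotl.
  have [->|ia] := eqVneq i a.
    by rewrite (negbTE ab) cdconjN cdconjK cdmulNl; apply: cdip_ext => z; rewrite !cdipE; ring.
  by case: eqVneq => // _; rewrite cdmulNl; apply: cdip_ext => z; rewrite !cdipE; ring.
by rewrite /mrot /mrotr !e.
Qed.

Section Entries.
Variables (a b : 'I_N) (w : CD R j) (c s : R) (X : cdmat R j N).
Hypotheses (ab : a != b) (w1 : cdip w w = 1) (cs : c ^+ 2 + s ^+ 2 = 1) (hX : adjm X = X).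
Local Notation X' := (mrot a b w c s X).
Local Notation xi := (cdip (X a b) w).

Lemma mrot_other i k : i != a -> i != b -> k != a -> k != b -> X' i k = X i k.
Proof.
by move=> ia ib ka kb; rewrite /mrot mrotrE (negbTE ka) (negbTE kb) /mrotl (negbTE ia) (negbTE ib).
Qed.

Lemma mrot_al l : l != a -> l != b ->
  X' a l = cdadd (cdscale c (X a l)) (cdscale s (cdmul w (X b l))).
Proof. by move=> la lb; rewrite /mrot mrotrE (negbTE la) (negbTE lb) /mrotl eqxx. Qed.

Lemma mrot_bl l : l != a -> l != b ->
  X' b l = cdadd (cdscale (- s) (cdmul (cdconj w) (X a l))) (cdscale c (X b l)).
Proof.
by move=> la lb; rewrite /mrot mrotrE (negbTE la) (negbTE lb) /mrotl (eq_sym b a) (negbTE ab) eqxx.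
Qed.

(** The off-diagonal part of the conjugation is [c^2 X_ab - s^2 w X_ba w]. The sandwich formula
    gives [w X_ba w = 2 xi w - X_ab], so [X_ab] reappears with coefficient [c^2 + s^2]. *)
Lemma mrot_ab : X' a b =
  cdadd (X a b) (cdscale (c * s * (mdiag X b - mdiag X a) - 2 * s ^+ 2 * xi) w).
Proof.
rewrite /mrot mrotrE (eq_sym b a) (negbTE ab) eqxx /mrotl eqxx !mdiagE //.
rewrite !cdmulDl !cdmulZl cdmul_reall cdmul_realr; apply: cdip_ext => z.
rewrite !cdipE cdmul_sandwichl // w1 hermE // (cdipC w (X a b)).
transitivity ((c ^+ 2 + s ^+ 2) * cdip (X a b) z +
   (c * s * (mdiag X b - mdiag X a) - 2 * s ^+ 2 * xi) * cdip w z); last by rewrite cs mul1r.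
ring.
Qed.

Lemma mrot_aa : mdiag X' a = c ^+ 2 * mdiag X a + 2 * c * s * xi + s ^+ 2 * mdiag X b.
Proof.
have e (u : CD R j) : cdre u = cdip u (cdreal j 1) by rewrite cdipC cdip_real mul1r.
rewrite /mdiag /mrot mrotrE eqxx /mrotl eqxx !e !mdiagE // cdmulDl !cdmulZl !cdipE.
rewrite cdmul_realr cdmulZl (cdmul_conj hj) w1 !cdipE -!e !cdre_real !cdreM cdconjK hermE //.
rewrite (cdipC w); ring.
Qed.
End Entries.

Lemma mrot_bb a b w c s X : a != b -> cdip w w = 1 -> c ^+ 2 + s ^+ 2 = 1 -> adjm X = X ->
  mdiag (mrot a b w c s X) b =
  s ^+ 2 * mdiag X a - 2 * c * s * cdip (X a b) w + c ^+ 2 * mdiag X b.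
Proof.
move=> ab w1 cs hX; rewrite mrot_swap // mrot_aa // 1?eq_sym //.
  by rewrite cdipNr -cdip_conjl hermE //; ring.
by rewrite !cdipE cdip_conj opprK.
Qed.

Section RotRank1.
Variables (a b : 'I_N) (w : CD R j) (c s : R) (X : cdmat R j N).
Hypotheses (w1 : cdip w w = 1) (cs : c ^+ 2 + s ^+ 2 = 1).
Hypotheses (hX : adjm X = X) (rX : rank1_rel X).

Lemma mrot_norm_ab : a != b -> cdip (mrot a b w c s X a b) (mrot a b w c s X a b) =
  mdiag (mrot a b w c s X) a * mdiag (mrot a b w c s X) b.
Proof.
move=> ab; rewrite mrot_aa // mrot_bb // mrot_ab // !cdipE w1 (cdipC w) rank1_norm //.
set A := mdiag X a; set B := mdiag X b; set xi := cdip _ _.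
have -> : c ^+ 2 = 1 - s ^+ 2 by rewrite -cs; ring.
apply/eqP; rewrite -subr_eq0; apply/eqP.
transitivity ((c ^+ 2 + s ^+ 2 - 1) * (s ^+ 2 * ((B - A) ^+ 2 + 4 * xi ^+ 2))).
  ring.
by rewrite cs subrr mul0r.
Qed.

Lemma mrot_norm_al l : a != b -> l != a -> l != b ->
  cdip (mrot a b w c s X a l) (mrot a b w c s X a l) = mdiag (mrot a b w c s X) a * mdiag X l.
Proof.
move=> ab la lb; rewrite mrot_aa // mrot_al // !cdipE (cd_composition _ _ hj) w1 !rank1_norm //.
rewrite (cdipC (X a l)).
have -> : cdip (cdmul w (X b l)) (X a l) = mdiag X l * cdip (X a b) w.
  by rewrite cdip_mulr hermE // rX cdipZr cdipC.
ring.
Qed.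

(** Of the four products in the expansion, three reduce by the cancellation laws and [rank1_rel]. In
    the fourth, [cdconj w] multiplies [X_al] from the left and [X_lb] from the right; this is where
    the Moufang identity enters. *)
Lemma mrot_cub_abl l : a != b -> l != a -> l != b ->
  cdmul (mrot a b w c s X b l) (mrot a b w c s X l a) = cdscale (mdiag X l) (mrot a b w c s X b a).
Proof.
move=> ab la lb.
have hX' : adjm (mrot a b w c s X) = mrot a b w c s X by rewrite adjm_mrot hX.
rewrite -(hermE a l hX') -(hermE a b hX') mrot_al // mrot_bl // mrot_ab //.
rewrite !cdconjD !cdconjZ !cdconjM !hermE // !cdmulDl !cdmulDr !cdmulZl !cdmulZr.
rewrite rX -[X in cdmul (cdmul (cdconj w) _) X](hermE a l hX) (cdmulKr hj).
have -> : cdmul (X b l) (cdmul (X l b) (cdconj w)) =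
    cdscale (mdiag X l * mdiag X b) (cdconj w).
  by rewrite -(hermE b l hX) (cdmulKVl hj) rank1_norm // mulrC.
apply: cdip_ext => z; rewrite !cdipE cdmul_moufang // rX (cdip_conj w w) w1 cdconjZ !cdipE hermE //.
rewrite rank1_norm // (cdip_conjl w (X b a)) hermE // (cdipC w).
transitivity (mdiag X l * ((c ^+ 2 + s ^+ 2) * cdip (X b a) z +
  (c * s * (mdiag X b - mdiag X a) - 2 * s ^+ 2 * cdip (X a b) w) * cdip (cdconj w) z)).
  ring.
by rewrite cs mul1r.
Qed.

(** [(w X_bl) X_lk] has to be rebracketed before [rank1_rel] applies to [X_bl X_lk], whence the
    restriction to associative levels. *)
Lemma mrot_cub_alm l k : (j <= 2)%N -> a != b -> l != a -> l != b -> k != a -> k != b ->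
  cdmul (mrot a b w c s X a l) (mrot a b w c s X l k) = cdscale (mdiag X l) (mrot a b w c s X a k).
Proof.
move=> hj2 ab la lb ka kb; rewrite [mrot a b w c s X l k]mrot_other // !mrot_al //.
rewrite cdmulDl !cdmulZl -(cdmulA hj2) !rX !cdmulZr; apply: cdip_ext => z; rewrite !cdipE; ring.
Qed.
End RotRank1.
End Rotation.

(** * Two-point homogeneous spaces *)

Definition t_isometry (R : realType) (M : Type) (t : M -> M -> R) (f : M -> M) :=
  bijective f /\ forall u v, t (f u) (f v) = t u v.

Lemma t_isometry_comp (R : realType) (M : Type) (t : M -> M -> R) f g :
  t_isometry t f -> t_isometry t g -> t_isometry t (f \o g).
Proof.
by move=> [bf hf] [bg hg]; split=> [|u v]; [exact: bij_comp | rewrite /= hf hg].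
Qed.

Lemma t_isometry_inv (R : realType) (M : Type) (t : M -> M -> R) f g :
  cancel f g -> cancel g f -> t_isometry t f -> t_isometry t g.
Proof.
by move=> fg gf [bf hf]; split=> [|u v]; [exists f | rewrite -{2}[u]gf -{2}[v]gf hf].
Qed.

(* [t x y] stands for [(1 + cos rho(x, y)) / 2].  The curves [gam i] are geodesics of
   [x0] in orthogonal directions, [(c, s)] being the cosine and sine of half the arc
   length; the two sum conditions express the Laplace-Beltrami operator on functions of
   [t x0] as the Jacobi operator. *)
Record zonal_space (R : realType) (M : Type) (t : M -> M -> R) (al be : R) : Prop := {
  t_sym : forall x y, t x y = t y x;
  t_refl : forall x, t x x = 1;
  t_ge0 : forall x y, 0 <= t x y;
  t_lip : forall x y u, (t y u - t y x) ^+ 2 <= 2 * (1 - t x u);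
  t_hom : forall x y x' y', t x y = t x' y' ->
    exists f, [/\ t_isometry t f, f x = x' & f y = y'];
  t_curves : exists (x0 : M) (I : finType) (P : pred I) (i0 : I)
      (gam : I -> R -> R -> M) (A B : I -> M -> R),
    [/\ P i0,
        forall i c s u, P i -> c ^+ 2 + s ^+ 2 = 1 ->
          t (gam i c s) u = c ^+ 2 * t x0 u + s ^+ 2 * A i u + 2 * c * s * B i u,
        forall u, \sum_(i | P i) B i u ^+ 2 = t x0 u * (1 - t x0 u),
        forall u, \sum_(i | P i) (A i u - t x0 u) =
          2 * (be + 1 - (al + be + 2) * t x0 u) &
        forall i, P i -> A i x0 = 0] }.

Section RotProj.
Variables (R : realType) (j N : nat).
Hypothesis hj : (j <= 3)%N.
Hypothesis hN : (j <= 2)%N || (N <= 3)%N.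
Implicit Types X Y : cdmat R j N.
Implicit Types (i k l a b : 'I_N) (w : CD R j) (c s : R).

Lemma mdiag_ge0 X i : is_rank1_proj X -> 0 <= mdiag X i.
Proof.
move=> /(proj_rank1 hj)[hX rX trX].
have -> : mdiag X i = \sum_l cdip (X i l) (X i l).
  by under eq_bigr => l _ do rewrite rank1_norm //; rewrite -mulr_sumr trX mulr1.
by rewrite sumr_ge0 // => l _; exact: cdip_ge0.
Qed.

(** [rank1_criterion] leaves triples of distinct indices, up to order. A triple containing both [a]
    and [b] is settled by the Moufang identity, one containing exactly one of them by associativity,
    and one avoiding both is unchanged. *)
Lemma mrot_is_proj a b w c s X : a != b -> cdip w w = 1 -> c ^+ 2 + s ^+ 2 = 1 ->
  is_rank1_proj X -> is_rank1_proj (mrot a b w c s X).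
Proof.
move=> ab w1 cs /(proj_rank1 hj)[hX rX trX].
set X' := mrot a b w c s X.
have hX' : adjm X' = X' by rewrite adjm_mrot // hX.
have w1' : cdip (cdopp (cdconj w)) (cdopp (cdconj w)) = 1 by rewrite !cdipE cdip_conj opprK.
have ba : b != a by rewrite eq_sym.
have dl l : l != a -> l != b -> mdiag X' l = mdiag X l by move=> la lb; rewrite /mdiag /X' mrot_other.
have nS i k : cdip (X' i k) (X' i k) = mdiag X' i * mdiag X' k ->
    cdip (X' k i) (X' k i) = mdiag X' k * mdiag X' i.
  by rewrite -cdip_conj hermE // mulrC.
have nal l : l != a -> l != b -> cdip (X' a l) (X' a l) = mdiag X' a * mdiag X' l.
  by move=> la lb; rewrite mrot_norm_al // (dl l).
have nbl l : l != a -> l != b -> cdip (X' b l) (X' b l) = mdiag X' b * mdiag X' l.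
  by move=> la lb; rewrite /X' mrot_swap // mrot_norm_al // -mrot_swap // (dl l).
have nab : cdip (X' a b) (X' a b) = mdiag X' a * mdiag X' b by exact: mrot_norm_ab.
have nii i : cdip (X' i i) (X' i i) = mdiag X' i * mdiag X' i.
  by rewrite mdiagE // cdip_real cdre_real.
have nX i k : cdip (X' i k) (X' i k) = mdiag X' i * mdiag X' k.
  have [->|ik] := eqVneq i k; first exact: nii.
  have [ia|ia] := eqVneq i a; have [ib|ib] := eqVneq i b;
  have [ka|ka] := eqVneq k a; have [kb|kb] := eqVneq k b; subst;
  try (by match goal with H : is_true (?x != ?x) |- _ => rewrite eqxx in H end); try by [exact: nab | exact: nS | exact: nal |
    exact: nbl | apply: nS; exact: nal | apply: nS; exact: nbl].
  by rewrite !dl // /X' mrot_other // rank1_norm.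
pose cub i l k := cubf X' i l k = mdiag X' i * mdiag X' l * mdiag X' k.
have c12 i l k : cub i l k -> cub l i k by rewrite /cub cubf_swap12 // (mulrC (mdiag X' i)).
have c23 i l k : cub i l k -> cub i k l by rewrite /cub cubf_swap23 // mulrAC.
have c1 l : l != a -> l != b -> cub b l a.
  by move=> la lb; rewrite /cub /cubf mrot_cub_abl // cdipZl nX (dl l) //; ring.
(* Four distinct indices exclude [N <= 3], so the algebra is associative here. *)
have c2j l k : l != a -> l != b -> k != a -> k != b -> l != k -> (j <= 2)%N.
  move=> la lb ka kb lk; case/orP: hN => // N3.
  have : uniq [:: a; b; l; k].
    by rewrite /= !inE !negb_or ab lk (eq_sym a l) (eq_sym a k) (eq_sym b l) (eq_sym b k) la lb ka kb.
  move=> /card_uniqP e; have := max_card [in [:: a; b; l; k]].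
  by rewrite e card_ord /= leqNgt ltnS N3.
have c2a l k : l != a -> l != b -> k != a -> k != b -> l != k -> cub a l k.
  move=> la lb ka kb lk; have j2 := c2j _ _ la lb ka kb lk.
  by rewrite /cub /cubf mrot_cub_alm // cdipZl nX (dl l) //; ring.
have c2b l k : l != a -> l != b -> k != a -> k != b -> l != k -> cub b l k.
  move=> la lb ka kb lk; have j2 := c2j _ _ la lb ka kb lk.
  have e : X' = mrot b a (cdopp (cdconj w)) c s X by rewrite /X' mrot_swap.
  by rewrite /cub /cubf {1 2}e mrot_cub_alm // -e cdipZl nX (dl l) //; ring.
apply: rank1_proj => //.
  apply: (rank1_criterion hj) => // i l k il lk ik; rewrite -/(cub i l k).
  have [ia|ia] := eqVneq i a; have [ib|ib] := eqVneq i b;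
  have [la|la] := eqVneq l a; have [lb|lb] := eqVneq l b;
  have [ka|ka] := eqVneq k a; have [kb|kb] := eqVneq k b; subst;
  try (by match goal with H : is_true (?x != ?x) |- _ => rewrite eqxx in H end);
  try by [exact: c1 | apply: (c12 _ _ _); exact: c1 | apply: (c23 _ _ _); exact: c1 |
          apply: (c12 _ _ _); apply: (c23 _ _ _); exact: c1 | apply: (c23 _ _ _); apply: (c12 _ _ _); exact: c1 |
          apply: (c12 _ _ _); apply: (c23 _ _ _); apply: (c12 _ _ _); exact: c1 |
          exact: c2a | apply: (c12 _ _ _); exact: c2a | apply: (c23 _ _ _); apply: (c12 _ _ _); exact: c2a |
          exact: c2b | apply: (c12 _ _ _); exact: c2b | apply: (c23 _ _ _); apply: (c12 _ _ _); exact: c2b].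
  by rewrite /cub !dl // /cubf /X' !mrot_other // rX cdipZl rank1_norm //; ring.
rewrite (bigD1 a) //= (bigD1 b) //= mrot_aa // mrot_bb //.
rewrite (eq_bigr (mdiag X)); last by move=> l /andP[la lb]; exact: dl.
rewrite -trX [RHS](bigD1 a) //= [X in _ = _ + X](bigD1 b) //=.
transitivity ((c ^+ 2 + s ^+ 2) * (mdiag X a + mdiag X b) +
   \sum_(i < N | (i != a) && (i != b)) mdiag X i); first by ring.
by rewrite cs mul1r addrA.
Qed.

End RotProj.

(** * Two-point homogeneity of projective spaces *)

Section Homogeneity.
Variables (R : realType) (j N : nat).
Hypothesis hj : (j <= 3)%N.
Hypothesis hN : (j <= 2)%N || (N <= 3)%N.
Variables i0 i1 i2 : 'I_N.
Hypotheses (i01 : i0 != i1) (i02 : i0 != i2) (i12 : i1 != i2).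
Local Notation Pt := {p : cdmat R j N | is_rank1_proj p}.
Implicit Types (x y z u v p q : Pt) (i k l a b : 'I_N) (w : CD R j) (c s : R).

Definition projt p q : R := mip (proj1_sig p) (proj1_sig q).
Local Notation dg p i := (mdiag (proj1_sig p) i).

Lemma pt_eq p q : (forall i k, proj1_sig p i k = proj1_sig q i k) -> p = q.
Proof.
case: p q => [X hX] [Y hY] /= h.
have e : X = Y by apply/funext => i; apply/funext => k.
by move: hX; rewrite e => hX; congr exist; exact: Prop_irrelevance.
Qed.

Lemma pt_herm p : adjm (proj1_sig p) = proj1_sig p.
Proof. by case: (proj_rank1 hj (proj2_sig p)). Qed.

Lemma pt_rank1 p : rank1_rel (proj1_sig p).
Proof. by case: (proj_rank1 hj (proj2_sig p)). Qed.

Lemma pt_trace p : \sum_i dg p i = 1.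
Proof. by case: (proj_rank1 hj (proj2_sig p)). Qed.

Lemma pt_norm p i k : cdip (proj1_sig p i k) (proj1_sig p i k) = dg p i * dg p k.
Proof. exact: rank1_norm (pt_herm p) (pt_rank1 p). Qed.

Lemma pt_ge0 p i : 0 <= dg p i.
Proof. exact: mdiag_ge0 (proj2_sig p). Qed.

Lemma pt_zero p i k : dg p i = 0 -> proj1_sig p i k = cd0 R j.
Proof. by move=> h; apply: cdip_eq0; rewrite pt_norm h mul0r. Qed.

Lemma pt_zeror p i k : dg p k = 0 -> proj1_sig p i k = cd0 R j.
Proof. by move=> h; apply: cdip_eq0; rewrite pt_norm h mulr0. Qed.

Lemma rot_isometry a b w c s : a != b -> cdip w w = 1 -> c ^+ 2 + s ^+ 2 = 1 ->
  exists f : Pt -> Pt, t_isometry projt f /\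
    forall p, proj1_sig (f p) = mrot a b w c s (proj1_sig p).
Proof.
move=> ab w1 cs.
have cs' : c ^+ 2 + (- s) ^+ 2 = 1 by rewrite sqrrN.
pose f p : Pt := exist _ _ (mrot_is_proj hj hN ab w1 cs (proj2_sig p)).
pose g p : Pt := exist _ _ (mrot_is_proj hj hN ab w1 cs' (proj2_sig p)).
exists f; split=> //; split=> [|u v]; last by rewrite /projt mip_mrot.
exists g => p; apply: pt_eq => i k /=; first by rewrite mrotK.
by rewrite -{1}[s]opprK mrotK.
Qed.

Lemma mrot_fix a b w c s p : a != b -> dg p a = 0 -> dg p b = 0 ->
  mrot a b w c s (proj1_sig p) = proj1_sig p.
Proof.
move=> ab pa pb.
have e : mrotl a b w c s (proj1_sig p) = proj1_sig p.
  apply/funext => i; apply/funext => k; rewrite /mrotl.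
  case: eqVneq => [->|ia].
    by rewrite !(pt_zero _ pa) (pt_zero _ pb) cdmulr0; apply: cdip_ext => z; rewrite !cdipE; ring.
  case: eqVneq => [->|ib] //.
  by rewrite (pt_zero _ pa) !(pt_zero _ pb) cdmulr0; apply: cdip_ext => z; rewrite !cdipE; ring.
by rewrite /mrot /mrotr e pt_herm e pt_herm.
Qed.

Lemma unit_direction (x : CD R j) :
  exists2 w, cdip w w = 1 & x = cdscale (Num.sqrt (cdip x x)) w.
Proof.
have [/cdip_eq0 ->|x0] := eqVneq (cdip x x) 0.
  exists (cdreal j 1); first by rewrite cdip_real cdre_real mulr1.
  by rewrite cdip0l sqrtr0; apply: cdip_ext => z; rewrite !cdipE mul0r.
have r2 := sqr_sqrtr (cdip_ge0 x).
have r0 : Num.sqrt (cdip x x) != 0 by apply: contra_neq x0 => e; rewrite -r2 e expr0n.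
exists (cdscale (Num.sqrt (cdip x x))^-1 x).
  by rewrite !cdipE -{3}r2; field.
by apply: cdip_ext => z; rewrite !cdipE mulVKf.
Qed.

(** A Givens rotation. With [w] the direction of the [(a, b)] entry, the 2 by 2 block is that of the
    real vector [(sqrt p_aa, sqrt p_bb)], because [|p_ab|^2 = p_aa p_bb]; the angle turns this
    vector onto the axis [a]. *)
Lemma kill_diag a b p : a != b -> exists w c s,
  [/\ cdip w w = 1, c ^+ 2 + s ^+ 2 = 1 & mdiag (mrot a b w c s (proj1_sig p)) b = 0].
Proof.
move=> ab; have [w w1 xw] := unit_direction (proj1_sig p a b).
have ga := pt_ge0 p a; have gb := pt_ge0 p b.
have xiE : cdip (proj1_sig p a b) w = Num.sqrt (dg p a) * Num.sqrt (dg p b).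
  by rewrite {1}xw cdipZl w1 mulr1 pt_norm sqrtrM.
have [S0|S0] := eqVneq (dg p a + dg p b) 0.
  have cs : (1 : R) ^+ 2 + 0 ^+ 2 = 1 by ring.
  have b0 : dg p b = 0 by lra.
  by exists w, 1, 0; split=> //; rewrite mrot_bb ?pt_herm ?b0 //; ring.
have Sp : 0 < dg p a + dg p b by rewrite lt_neqAle eq_sym S0 addr_ge0.
have rS := sqr_sqrtr (ltW Sp).
have r0 : Num.sqrt (dg p a + dg p b) != 0 by rewrite gt_eqF // sqrtr_gt0.
have ra := sqr_sqrtr ga; have rb := sqr_sqrtr gb.
set c := Num.sqrt (dg p a) / Num.sqrt (dg p a + dg p b).
set s := Num.sqrt (dg p b) / Num.sqrt (dg p a + dg p b).
have cs : c ^+ 2 + s ^+ 2 = 1 by rewrite /c /s !expr_div_n ra rb rS -mulrDl divff.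
exists w, c, s; split=> //.
rewrite mrot_bb ?pt_herm // xiE.
transitivity (s ^+ 2 * Num.sqrt (dg p a) ^+ 2
  - 2 * c * s * (Num.sqrt (dg p a) * Num.sqrt (dg p b)) + c ^+ 2 * Num.sqrt (dg p b) ^+ 2).
  by rewrite ra rb.
by rewrite /c /s; field.
Qed.

(** Rotations in the planes [(a, b)], [b] in [r], collect in row [a] the weight of all rows of [r].
    Since points without weight on these rows are fixed, a second sweep can preserve the base
    point. *)
Lemma kill_seq a (r : seq 'I_N) p : a \notin r -> exists f : Pt -> Pt,
  [/\ t_isometry projt f, forall i, i \in r -> dg (f p) i = 0,
      forall q, dg q a = 0 -> (forall i, i \in r -> dg q i = 0) -> f q = q &
      forall q i, i != a -> i \notin r -> dg (f q) i = dg q i].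
Proof.
elim: r => [_|b r IH].
  by exists id; split=> //; split=> //; exists id.
rewrite inE negb_or => /andP[ab ar]; have [f [If f0 fix_f df]] := IH ar.
have [w [c [s [w1 cs kb]]]] := kill_diag (f p) ab.
have [g [Ig gE]] := rot_isometry ab w1 cs.
exists (g \o f); split; first exact: t_isometry_comp.
- move=> i; rewrite inE; have [->|ib] /= := eqVneq i b; first by rewrite gE kb.
  move=> ir; have ia : i != a by apply: contraTneq ir => ->.
  by rewrite gE /mdiag mrot_other // -/(mdiag _ _) f0.
- move=> q qa q0; rewrite /= fix_f //; last by move=> i ir; rewrite q0 // inE ir orbT.
  by apply: pt_eq => i k; rewrite gE mrot_fix // q0 // inE eqxx.
- move=> q i ia; rewrite inE negb_or => /andP[ib ir] /=.
  by rewrite gE /mdiag mrot_other // -/(mdiag _ _) df.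
Qed.

(** The right-hand side is the squared norm of [r1 x + r2 y + r3 z]: points are unit vectors for
    [mip], with [projt] as inner product. *)
Lemma projt_comb (r1 r2 r3 : R) x y z :
  0 <= r1 ^+ 2 + r2 ^+ 2 + r3 ^+ 2 + 2 * r1 * r2 * projt x y + 2 * r1 * r3 * projt x z
    + 2 * r2 * r3 * projt y z.
Proof.
pose u i k := cdadd (cdscale r1 (proj1_sig x i k))
   (cdadd (cdscale r2 (proj1_sig y i k)) (cdscale r3 (proj1_sig z i k))).
suff -> : r1 ^+ 2 + r2 ^+ 2 + r3 ^+ 2 + 2 * r1 * r2 * projt x y + 2 * r1 * r3 * projt x z
    + 2 * r2 * r3 * projt y z = mip u u.
  by do 2! apply: sumr_ge0 => ? _; exact: cdip_ge0.
have -> : r1 ^+ 2 = r1 ^+ 2 * projt x x by rewrite /projt (mip_proj hj (proj2_sig x)) mulr1.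
have -> : r2 ^+ 2 = r2 ^+ 2 * projt y y by rewrite /projt (mip_proj hj (proj2_sig y)) mulr1.
have -> : r3 ^+ 2 = r3 ^+ 2 * projt z z by rewrite /projt (mip_proj hj (proj2_sig z)) mulr1.
rewrite /projt /mip !mulr_sumr -!big_split /=; apply: eq_bigr => i _.
rewrite !mulr_sumr -!big_split /=; apply: eq_bigr => k _.
rewrite /u !cdipE (cdipC (proj1_sig y i k) (proj1_sig x i k)).
rewrite (cdipC (proj1_sig z i k) (proj1_sig x i k)) (cdipC (proj1_sig z i k) (proj1_sig y i k)).
ring.
Qed.

Lemma projt_refl x : projt x x = 1.
Proof. exact: (mip_proj hj (proj2_sig x)). Qed.

Lemma projt_sym x y : projt x y = projt y x.
Proof. exact: mipC. Qed.

Lemma projt_lip x y u : (projt y u - projt y x) ^+ 2 <= 2 * (1 - projt x u).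
Proof.
(* With [e = projt y u - projt y x] this is [|u - x - e y|^2 >= 0], that is, Cauchy-Schwarz for [y]
   and [u - x]. *)
have := projt_comb 1 (-1) (- (projt y u - projt y x)) u x y.
rewrite (projt_sym u x) (projt_sym u y) (projt_sym x y); nra.
Qed.

Definition pt0m : cdmat R j N :=
  fun i k => if (i == i0) && (k == i0) then cdreal j 1 else cd0 R j.

Lemma pt0_proj : is_rank1_proj pt0m.
Proof.
have re0 : cdre (cd0 R j) = 0 :> R by rewrite -[LHS]mul1r -cdip_real cdip0r.
have d0 i : mdiag pt0m i = (i == i0)%:R.
  by rewrite /mdiag /pt0m andbb; case: eqVneq; rewrite ?cdre_real.
have z0 r : cdscale r (cd0 R j) = cd0 R j by apply: cdip_ext => z; rewrite !cdipE mulr0.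
apply: rank1_proj.
- apply/funext => i; apply/funext => k; rewrite /adjm /pt0m andbC.
  case: ifP => _; first exact: cdconj_real.
  by apply: cdip_ext => z; rewrite cdip_conjl !cdip0l.
- move=> i l k; rewrite d0 /pt0m.
  have [_|il] := eqVneq i i0; have [_|ll] := eqVneq l i0; have [_|kl] := eqVneq k i0;
    rewrite /= ?cdmulr0 ?cdmul0r ?z0 ?cdmul_reall ?z0 //.
  by apply: cdip_ext => z; rewrite !cdipE mul0r.
- rewrite (bigD1 i0) //= d0 eqxx big1 ?addr0 // => i /negbTE ii.
  by rewrite d0 ii.
Qed.

Definition pt0 : Pt := exist _ _ pt0_proj.

Lemma mip_pt0 (X : cdmat R j N) : mip pt0m X = mdiag X i0.
Proof.
rewrite /mip (bigD1 i0) //= (bigD1 i0) //= {1}/pt0m eqxx /= cdip_real mul1r.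
rewrite !big1 ?addr0 // => [i /negbTE ii|k /negbTE kk].
  by rewrite big1 // => k _; rewrite /pt0m ii cdip0l.
by rewrite /pt0m eqxx kk cdip0l.
Qed.

Lemma projt_pt0 x : projt pt0 x = dg x i0.
Proof. exact: mip_pt0. Qed.

Lemma pt0_unique x : (forall i, i != i0 -> dg x i = 0) -> x = pt0.
Proof.
move=> x0; apply: pt_eq => i k /=; rewrite /pt0m.
have [->|ii] /= := eqVneq i i0; last by rewrite pt_zero // x0.
have [->|kk] /= := eqVneq k i0; last by rewrite pt_zeror // x0.
have := pt_trace x; rewrite (bigD1 i0) //= big1 ?addr0 // => e.
by rewrite mdiagE ?pt_herm // e.
Qed.

Lemma to_pt0 x : exists2 f : Pt -> Pt, t_isometry projt f & f x = pt0.
Proof.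
have [|f [If f0 _ _]] := @kill_seq i0 [seq i <- enum 'I_N | i != i0] x.
  by rewrite mem_filter eqxx.
exists f => //; apply: pt0_unique => i ii; apply: f0.
by rewrite mem_filter ii mem_enum.
Qed.

Lemma projt_ge0 x y : 0 <= projt x y.
Proof.
have [f [_ If] fx] := to_pt0 x.
by rewrite -If fx projt_pt0 pt_ge0.
Qed.

(** Normal form of the second point of a pair whose first point is [pt0]: [v v^*] for a nonnegative
    real vector [v] supported on [i0] and [i1]. Its only freedom is the entry at [(i0, i0)], which
    is the value of [projt pt0]. *)
Definition canonical_pt x := (forall i, i != i0 -> i != i1 -> dg x i = 0) /\
  proj1_sig x i0 i1 = cdreal j (Num.sqrt (dg x i0 * dg x i1)).

Lemma canonical_eq x y : canonical_pt x -> canonical_pt y -> dg x i0 = dg y i0 -> x = y.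
Proof.
move=> [x0 xr] [y0 yr] e.
have trE z : (forall i, i != i0 -> i != i1 -> dg z i = 0) -> dg z i1 = 1 - dg z i0.
  move=> z0; have := pt_trace z; rewrite (bigD1 i0) //= (bigD1 i1) 1?eq_sym //=.
  by rewrite big1 ?addr0 => [|i /andP[? ?]]; [lra | rewrite z0].
have e1 : dg x i1 = dg y i1 by rewrite !trE // e.
have d i : dg x i = dg y i.
  have [->|ii] := eqVneq i i0; first by [].
  by have [->|ij] := eqVneq i i1; [| rewrite x0 ?y0].
have e01 : proj1_sig x i0 i1 = proj1_sig y i0 i1 by rewrite xr yr e e1.
apply: pt_eq => i k.
have [ik|ik] := eqVneq i k; first by rewrite ik !mdiagE ?pt_herm // d.
have [ii|ii] := eqVneq i i0; have [ki|ki] := eqVneq k i0.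
- by rewrite ii ki eqxx in ik.
- have [->|kj] := eqVneq k i1; first by rewrite ii e01.
  by rewrite !pt_zeror // -?d x0.
- have [ij|ij] := eqVneq i i1; last by rewrite !pt_zero // -?d x0.
  by rewrite ki ij -(hermE i0 i1 (pt_herm x)) -(hermE i0 i1 (pt_herm y)) e01.
- have [ij|ij] := eqVneq i i1; last by rewrite !pt_zero // -?d x0.
  have kj : k != i1 by rewrite eq_sym -ij.
  by rewrite !pt_zeror // -?d x0.
Qed.

(* Two quarter turns in the plane [(i1, i2)], with unit elements [w^*] and [-1], make the
   entry [(i0, i1)] real. *)
Lemma to_canonical x y : exists f : Pt -> Pt,
  [/\ t_isometry projt f, f x = pt0 & canonical_pt (f y)].
Proof.
have [f If fx] := to_pt0 x.
have d0 i : i != i0 -> dg pt0 i = 0.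
  move=> /negbTE ii; rewrite /mdiag /= /pt0m ii /=.
  by rewrite -[LHS]mul1r -cdip_real cdip0r.
have [|g [Ig g0 gfix _]] := @kill_seq i1 [seq i <- enum 'I_N | (i != i1) && (i != i0)] (f y).
  by rewrite mem_filter eqxx.
have gp : g pt0 = pt0.
  by apply: gfix => [|i]; [rewrite d0 // eq_sym | rewrite mem_filter => /andP[/andP[? ?] _]; rewrite d0].
have z0 i : i != i0 -> i != i1 -> dg (g (f y)) i = 0.
  by move=> ii ij; apply: g0; rewrite mem_filter ii ij mem_enum.
set z := g (f y) in z0 *.
have [w w1 zw] := unit_direction (proj1_sig z i0 i1).
have o1 : cdip (cdreal j (-1)) (cdreal j (-1)) = 1 :> R by rewrite cdip_real cdre_real mulrNN mulr1.
have w1' : cdip (cdconj w) (cdconj w) = 1 by rewrite cdip_conj.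
have cs : (0 : R) ^+ 2 + 1 ^+ 2 = 1 by ring.
have [h1 [Ih1 h1E]] := rot_isometry i12 w1' cs.
have [h2 [Ih2 h2E]] := rot_isometry i12 o1 cs.
have i21 : i2 != i1 by rewrite eq_sym.
have i10 : i1 != i0 by rewrite eq_sym.
have i20 : i2 != i0 by rewrite eq_sym.
have hp h w' : (forall p, proj1_sig (h p) = mrot i1 i2 w' 0 1 (proj1_sig p)) -> h pt0 = pt0.
  by move=> hE; apply: pt_eq => i k; rewrite hE mrot_fix // d0.
exists (h2 \o (h1 \o (g \o f))); split.
- by do 3! apply: t_isometry_comp => //.
- by rewrite /= fx gp (hp _ _ h1E) (hp _ _ h2E).
rewrite /= -/z.
have dz i : i != i1 -> i != i2 -> dg (h2 (h1 z)) i = dg z i.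
  by move=> ii ij; rewrite h2E /mdiag mrot_other // h1E mrot_other.
have z2 := z0 _ i20 i21.
have e2 : dg (h2 (h1 z)) i2 = 0.
  by rewrite h2E mrot_bb ?pt_herm // h1E mrot_aa ?pt_herm // z2; ring.
have e1 : dg (h2 (h1 z)) i1 = dg z i1.
  by rewrite h2E mrot_aa ?pt_herm // h1E mrot_bb ?pt_herm // z2; ring.
split.
  move=> i ii ij; have [->|ik] := eqVneq i i2; first exact: e2.
  by rewrite dz // z0.
rewrite dz // e1 -pt_norm -(hermE _ _ (pt_herm _)).
rewrite h2E mrot_al // h1E mrot_bl // cdconjK -(hermE i0 i1 (pt_herm z)).
rewrite {1}zw cdconjZ cdmulZr (cdmul_conj hj) w1 cdmul_reall cdconjD !cdconjZ.
rewrite cdconjD !cdconjZ cdconj_real; apply: cdip_ext => u; rewrite !cdipE !cdip_real; ring.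
Qed.

Lemma projt_hom x y x' y' : projt x y = projt x' y' ->
  exists f, [/\ t_isometry projt f, f x = x' & f y = y'].
Proof.
move=> e; have [f [If fx cy]] := to_canonical x y.
have [g [Ig gx cy']] := to_canonical x' y'.
have fgy : f y = g y'.
  by apply: canonical_eq => //; rewrite -!projt_pt0 -{1}fx -gx If.2 Ig.2.
have [h gh hg] := Ig.1.
exists (h \o f); split; first exact: t_isometry_comp (t_isometry_inv gh hg Ig) If.
  by rewrite /= fx -gx gh.
by rewrite /= fgy gh.
Qed.

Fixpoint cdbasis (k m : nat) : CD R k :=
  match k return CD R k with
  | 0 => 1
  | k'.+1 => if (m < 2 ^ k')%N then (cdbasis k' m, cd0 R k')
             else (cd0 R k', cdbasis k' (m - 2 ^ k'))
  end.

Lemma cdbasis_unit (k m : nat) : cdip (cdbasis k m) (cdbasis k m) = 1.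
Proof.
elim: k m => [|k IH] m /=; first by rewrite mulr1.
by case: ifP => _ /=; rewrite IH cdip0l ?addr0 ?add0r.
Qed.

Lemma cdbasis_parseval (k : nat) (u : CD R k) :
  \sum_(m < 2 ^ k) cdip u (cdbasis k m) ^+ 2 = cdip u u.
Proof.
elim: k u => [|k IH] u /=.
  by rewrite expn0 big_ord1 mulr1 expr2.
have e : (2 ^ k.+1 = 2 ^ k + 2 ^ k)%N by rewrite expnS mul2n addnn.
rewrite -(big_mkord xpredT (fun m => cdip u (cdbasis k.+1 m) ^+ 2)) e big_mkord big_split_ord /=.
congr (_ + _); rewrite -IH; apply: eq_bigr => m _.
  by rewrite ltn_ord /= cdip0r addr0.
by rewrite ltnNge leq_addr /= cdip0r add0r addKn.
Qed.

(** The tangent directions at [pt0] are the pairs of a row [k != i0] and a basis unit [e_m] of the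
    algebra; [gam] rotates [pt0] in the rows [i0] and [k] with that unit. Then [A] is the entry
    [u_kk] and [B] the coordinate of [u_0k] along [e_m]. Parseval and [|u_0k|^2 = u_00 u_kk] give
    the sum of squares, and the trace condition gives the sum of the [A]. *)
Lemma projt_curves : exists (x0 : Pt) (I : finType) (P : pred I) (e0 : I)
    (gam : I -> R -> R -> Pt) (A B : I -> Pt -> R),
  [/\ P e0,
      forall (i : I) c s u, P i -> c ^+ 2 + s ^+ 2 = 1 ->
        projt (gam i c s) u = c ^+ 2 * projt x0 u + s ^+ 2 * A i u + 2 * c * s * B i u,
      forall u, \sum_(i | P i) B i u ^+ 2 = projt x0 u * (1 - projt x0 u),
      forall u, \sum_(i | P i) (A i u - projt x0 u) =
        (2 ^ j)%:R * (1 - N%:R * projt x0 u) &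
      forall i : I, P i -> A i x0 = 0].
Proof.
have tj : (0 < 2 ^ j)%N by rewrite expn_gt0.
pose I := ('I_N * 'I_(2 ^ j))%type.
(* The existential is total in [c] and [s]: off the unit circle it defaults to [pt0]. *)
have ex (i : I) c s : exists p : Pt, i.1 != i0 -> c ^+ 2 + s ^+ 2 = 1 -> forall u,
   projt p u = c ^+ 2 * projt pt0 u + s ^+ 2 * dg u i.1
     + 2 * c * s * cdip (proj1_sig u i0 i.1) (cdbasis j i.2).
  have [ii|] := boolP (i.1 != i0); last by exists pt0.
  have [cs|] := eqVneq (c ^+ 2 + s ^+ 2) 1; last by move=> /eqP ?; exists pt0.
  have ii' : i0 != i.1 by rewrite eq_sym.
  have cs' : c ^+ 2 + (- s) ^+ 2 = 1 by rewrite sqrrN.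
  have [f [If fE]] := rot_isometry ii' (cdbasis_unit j i.2) cs.
  have [g [Ig gE]] := rot_isometry ii' (cdbasis_unit j i.2) cs'.
  (* [f] undoes [g], so [projt (g pt0) u] is the [(i0, i0)] entry of [f u], which [mrot_aa]
     computes. *)
  exists (g pt0) => _ _ u; rewrite -If.2.
  have -> : f (g pt0) = pt0.
    by apply: pt_eq => a b; rewrite fE gE -{1}[s]opprK mrotK ?cdbasis_unit.
  by rewrite !projt_pt0 fE mrot_aa ?pt_herm ?cdbasis_unit //; ring.
pose gam (i : I) c s := projT1 (cid (ex i c s)).
exists pt0, I, (fun i : I => i.1 != i0), (i1, Ordinal tj), gam,
  (fun (i : I) u => dg u i.1), (fun (i : I) u => cdip (proj1_sig u i0 i.1) (cdbasis j i.2)).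
have pb (F : 'I_N -> 'I_(2 ^ j) -> R) :
    \sum_(i : I | i.1 != i0) F i.1 i.2 = \sum_(k | k != i0) \sum_m F k m.
  by rewrite pair_big_dep /=; apply: eq_big => // i; rewrite andbT.
have sd u : \sum_(k | k != i0) dg u k = 1 - dg u i0.
  by have := pt_trace u; rewrite (bigD1 i0) //= => <-; ring.
split.
- by rewrite /= eq_sym.
- by move=> i c s u Pi cs; rewrite /gam; case: (cid _) => p /= ->.
- move=> u; rewrite (pb (fun k m => cdip (proj1_sig u i0 k) (cdbasis j m) ^+ 2)).
  under eq_bigr => k _ do rewrite cdbasis_parseval pt_norm.
  by rewrite -mulr_sumr sd projt_pt0.
- move=> u; rewrite (pb (fun k m => dg u k - projt pt0 u)).
  under eq_bigr => k _ do rewrite sumr_const card_ord -mulr_natl.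
  rewrite -mulr_sumr sumrB sd sumr_const projt_pt0; congr (_ * _).
  rewrite (_ : #|_| = N.-1); last by rewrite cardC1 card_ord.
  have -> : N%:R = N.-1%:R + 1 :> R by rewrite natr1 prednK // (leq_ltn_trans _ (ltn_ord i0)).
  by rewrite -mulr_natl; ring.
- move=> i ii /=; rewrite /mdiag /= /pt0m (negbTE ii) /=.
  by rewrite -[LHS]mul1r -cdip_real cdip0r.
Qed.

Lemma proj_zonal (al be : R) : be + 1 = (2 ^ j)%:R / 2 -> al + be + 2 = (2 ^ j)%:R * N%:R / 2 ->
  zonal_space projt al be.
Proof.
move=> hb hab; split.
- exact: projt_sym.
- exact: projt_refl.
- exact: projt_ge0.
- exact: projt_lip.
- exact: projt_hom.
have [x0 [I [P [i [gam [A [B [h1 h2 h3 h4 h5]]]]]]]] := projt_curves.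
exists x0, I, P, i, gam, A, B; split=> // u.
by rewrite h4 hb hab; field.
Qed.
End Homogeneity.

(** * Spheres *)

Section SphereZonal.
Variables (R : realType) (N : nat).
Variables i0 i1 i2 : 'I_N.
Hypotheses (i01 : i0 != i1) (i02 : i0 != i2) (i12 : i1 != i2).
Local Notation Pt := {x : 'I_N -> R | \sum_(i < N) x i ^+ 2 = 1}.
Implicit Types (x y z u v p q : Pt) (i k l a b : 'I_N) (c s : R).
Local Notation co p i := (proj1_sig p i).

Definition spheret x y : R := (1 + \sum_i co x i * co y i) / 2.

Lemma sphere_eq p q : (forall i, co p i = co q i) -> p = q.
Proof.
case: p q => [X hX] [Y hY] /= h.
have e : X = Y by apply/funext => i.
by move: hX; rewrite e => hX; congr exist; exact: Prop_irrelevance.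
Qed.

Lemma sphere_comb (r1 r2 r3 : R) x y z :
  0 <= r1 ^+ 2 + r2 ^+ 2 + r3 ^+ 2 + 2 * r1 * r2 * (2 * spheret x y - 1)
    + 2 * r1 * r3 * (2 * spheret x z - 1) + 2 * r2 * r3 * (2 * spheret y z - 1).
Proof.
have e u v : 2 * spheret u v - 1 = \sum_i co u i * co v i by rewrite /spheret; field.
rewrite !e.
have -> : r1 ^+ 2 = r1 ^+ 2 * \sum_i co x i ^+ 2 by rewrite (proj2_sig x) mulr1.
have -> : r2 ^+ 2 = r2 ^+ 2 * \sum_i co y i ^+ 2 by rewrite (proj2_sig y) mulr1.
have -> : r3 ^+ 2 = r3 ^+ 2 * \sum_i co z i ^+ 2 by rewrite (proj2_sig z) mulr1.
rewrite !mulr_sumr -!big_split /= sumr_ge0 // => i _.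
rewrite (_ : _ + _ = (r1 * co x i + r2 * co y i + r3 * co z i) ^+ 2); last by ring.
exact: sqr_ge0.
Qed.

Lemma spheret_sym x y : spheret x y = spheret y x.
Proof. by rewrite /spheret; congr ((1 + _) / 2); apply: eq_bigr => i _; rewrite mulrC. Qed.

Lemma spheret_refl x : spheret x x = 1.
Proof.
rewrite /spheret (eq_bigr (fun i => co x i ^+ 2)); last by move=> i _; rewrite expr2.
by rewrite (proj2_sig x); field.
Qed.

Lemma spheret_ge0 x y : 0 <= spheret x y.
Proof. by have := sphere_comb 1 1 0 x y x; rewrite (spheret_sym y x); nra. Qed.

Lemma spheret_lip x y u : (spheret y u - spheret y x) ^+ 2 <= 2 * (1 - spheret x u).
Proof.
(* Cauchy-Schwarz for [y] and [u - x], the inner product being [2 * spheret - 1]. It yields the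
   bound without the factor 2, and [h], which says that [spheret x u <= 1], allows the larger
   one. *)
have := sphere_comb 1 (-1) (- (2 * (spheret y u - spheret y x))) u x y.
have h := sphere_comb 1 (-1) 0 u x y.
by move: h; rewrite (spheret_sym u x) (spheret_sym u y) (spheret_sym x y); nra.
Qed.

Definition srot a b c s (x : 'I_N -> R) : 'I_N -> R := fun i =>
  if i == a then c * x a + s * x b else if i == b then - s * x a + c * x b else x i.

Lemma sum2_split a b (F : 'I_N -> R) : a != b ->
  \sum_i F i = F a + F b + \sum_(i | (i != a) && (i != b)) F i.
Proof. by move=> ab; rewrite (bigD1 a) //= (bigD1 b) 1?eq_sym //= addrA. Qed.

Lemma srot_ip a b c s (x y : 'I_N -> R) : a != b -> c ^+ 2 + s ^+ 2 = 1 ->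
  \sum_i srot a b c s x i * srot a b c s y i = \sum_i x i * y i.
Proof.
move=> ab cs; rewrite !(sum2_split _ ab); congr (_ + _); last first.
  by apply: eq_bigr => i /andP[ia ib]; rewrite /srot (negbTE ia) (negbTE ib).
rewrite /srot !eqxx (eq_sym b) (negbTE ab).
transitivity ((c ^+ 2 + s ^+ 2) * (x a * y a + x b * y b)); first by ring.
by rewrite cs mul1r.
Qed.

Lemma srotK a b c s (x : 'I_N -> R) : a != b -> c ^+ 2 + s ^+ 2 = 1 ->
  srot a b c (- s) (srot a b c s x) = x.
Proof.
move=> ab cs; apply/funext => i; rewrite /srot !eqxx (eq_sym b) (negbTE ab).
case: eqVneq => [->|ia].
  by transitivity ((c ^+ 2 + s ^+ 2) * x a); [ring | rewrite cs mul1r].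
case: eqVneq => [->|ib] //.
by transitivity ((c ^+ 2 + s ^+ 2) * x b); [ring | rewrite cs mul1r].
Qed.

Lemma srot_isometry a b c s : a != b -> c ^+ 2 + s ^+ 2 = 1 ->
  exists f : Pt -> Pt, t_isometry spheret f /\
    forall p, proj1_sig (f p) = srot a b c s (proj1_sig p).
Proof.
move=> ab cs.
have cs' : c ^+ 2 + (- s) ^+ 2 = 1 by rewrite sqrrN.
have on c' s' (cs'' : c' ^+ 2 + s' ^+ 2 = 1) p :
    \sum_i srot a b c' s' (proj1_sig p) i ^+ 2 = 1.
  transitivity (\sum_i srot a b c' s' (proj1_sig p) i * srot a b c' s' (proj1_sig p) i).
    by apply: eq_bigr => i _; rewrite expr2.
  rewrite srot_ip //; apply: etrans (proj2_sig p).
  by apply: eq_bigr => i _; rewrite expr2.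
pose f p : Pt := exist _ _ (on c s cs p).
pose g p : Pt := exist _ _ (on c (- s) cs' p).
exists f; split=> //; split=> [|u v]; last by rewrite /spheret srot_ip.
exists g => p; apply: sphere_eq => i /=; first by rewrite srotK.
by rewrite -{1}[s]opprK srotK.
Qed.

(** A unit vector with a single nonzero coordinate is still ambiguous by a sign. The last rotation
    leaves [sqrt (A^2 + B^2) >= 0] at [a], which settles the sign as soon as there is a rotation at
    all. *)
Lemma skill_seq a (r : seq 'I_N) p : a \notin r -> exists f : Pt -> Pt,
  [/\ t_isometry spheret f, forall i, i \in r -> co (f p) i = 0,
      (r != [::]) -> 0 <= co (f p) a &
      forall q, co q a = 0 -> (forall i, i \in r -> co q i = 0) -> f q = q].
Proof.
elim: r => [_|b r IH].
  by exists id; split=> //; split=> //; exists id.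
rewrite inE negb_or => /andP[ab ar]; have [f [If f0 _ fix_f]] := IH ar.
set A := co (f p) a; set B := co (f p) b.
have [c [s [cs kb ka]]] : exists c s, [/\ c ^+ 2 + s ^+ 2 = 1, - s * A + c * B = 0 & 0 <= c * A + s * B].
  have [S0|S0] := eqVneq (A ^+ 2 + B ^+ 2) 0.
    have [A0 B0] : A = 0 /\ B = 0 by split; nra.
    by exists 1, 0; rewrite A0 B0; split; lra.
  have Sp : 0 < A ^+ 2 + B ^+ 2 by rewrite lt_neqAle eq_sym S0 addr_ge0 // sqr_ge0.
  have rS := sqr_sqrtr (ltW Sp).
  have rp : 0 < Num.sqrt (A ^+ 2 + B ^+ 2) by rewrite sqrtr_gt0.
  have r0 := lt0r_neq0 rp.
  exists (A / Num.sqrt (A ^+ 2 + B ^+ 2)), (B / Num.sqrt (A ^+ 2 + B ^+ 2)); split.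
  - by rewrite !expr_div_n rS -mulrDl divff.
  - by field.
  - rewrite (_ : _ + _ = (A ^+ 2 + B ^+ 2) / Num.sqrt (A ^+ 2 + B ^+ 2)); last by field.
    by rewrite divr_ge0 // ltW.
have [g [Ig gE]] := srot_isometry ab cs.
exists (g \o f); split; first exact: t_isometry_comp.
- move=> i; rewrite inE /= gE /srot; have [->|ib] /= := eqVneq i b.
    by rewrite eq_sym (negbTE ab) => _; exact: kb.
  move=> ir; have ia : i != a by apply: contraTneq ir => ->.
  by rewrite (negbTE ia) f0.
- by move=> _; rewrite /= gE /srot eqxx.
- move=> q qa q0; rewrite /= fix_f //; last by move=> i ir; rewrite q0 // inE ir orbT.
  have qb : co q b = 0 by rewrite q0 // inE eqxx.
  apply: sphere_eq => i; rewrite gE /srot qa qb !mulr0 addr0.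
  by case: eqVneq => [->|_]; [rewrite qa | case: eqVneq => [->|_]; rewrite ?qb].
Qed.

Lemma spt0_subproof : \sum_i (i == i0)%:R ^+ 2 = 1 :> R.
Proof.
rewrite (bigD1 i0) //= eqxx expr1n big1 ?addr0 // => i /negbTE ->.
by rewrite expr0n.
Qed.

Definition spt0 : Pt := exist _ (fun i => (i == i0)%:R) spt0_subproof.

Lemma spheret_pt0 x : spheret spt0 x = (1 + co x i0) / 2.
Proof.
rewrite /spheret /= (bigD1 i0) //= eqxx mul1r big1 ?addr0 // => i /negbTE ->.
by rewrite mul0r.
Qed.

Lemma to_spt0 x : exists2 f : Pt -> Pt, t_isometry spheret f & f x = spt0.
Proof.
have [|f [If f0 fa _]] := @skill_seq i0 [seq i <- enum 'I_N | i != i0] x.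
  by rewrite mem_filter eqxx.
exists f => //; have {}f0 i : i != i0 -> co (f x) i = 0.
  by move=> ii; apply: f0; rewrite mem_filter ii mem_enum.
have {}fa : 0 <= co (f x) i0.
  apply: fa; rewrite -size_eq0 -lt0n -has_predT; apply/hasP; exists i1 => //.
  by rewrite mem_filter mem_enum eq_sym i01.
apply: sphere_eq => i /=; have [->|ii] := eqVneq i i0; last exact: f0.
have := proj2_sig (f x); rewrite /= (bigD1 i0) //= big1 ?addr0; last first.
  by move=> k kk; rewrite f0 // expr0n.
move/eqP; rewrite sqrf_eq1 => /orP[/eqP //|/eqP e]; move: fa; rewrite e; lra.
Qed.

Lemma to_scanonical x y : exists f : Pt -> Pt,
  [/\ t_isometry spheret f, f x = spt0, forall i, i != i0 -> i != i1 -> co (f y) i = 0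
    & 0 <= co (f y) i1].
Proof.
have [f If fx] := to_spt0 x.
have d0 i : i != i0 -> co spt0 i = 0 by move=> /negbTE ii; rewrite /= ii.
have [|g [Ig g0 ga gfix]] := @skill_seq i1 [seq i <- enum 'I_N | (i != i1) && (i != i0)] (f y).
  by rewrite mem_filter eqxx.
have gp : g spt0 = spt0.
  by apply: gfix => [|i]; [rewrite d0 // eq_sym | rewrite mem_filter => /andP[/andP[? ?] _]; rewrite d0].
exists (g \o f); split; first exact: t_isometry_comp.
- by rewrite /= fx gp.
- by move=> i ii ij; apply: g0; rewrite mem_filter ii ij mem_enum.
apply: ga; rewrite -size_eq0 -lt0n -has_predT; apply/hasP; exists i2 => //.
by rewrite mem_filter mem_enum !(eq_sym i2) i12 i02.
Qed.

Lemma spheret_hom x y x' y' : spheret x y = spheret x' y' ->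
  exists f, [/\ t_isometry spheret f, f x = x' & f y = y'].
Proof.
move=> e; have [f [If fx fy fp]] := to_scanonical x y.
have [g [Ig gx gy gp]] := to_scanonical x' y'.
have e0 : co (f y) i0 = co (g y') i0.
  have : spheret spt0 (f y) = spheret spt0 (g y') by rewrite -{1}fx -gx If.2 Ig.2.
  rewrite !spheret_pt0; lra.
have sq z : (forall i, i != i0 -> i != i1 -> co z i = 0) -> co z i0 ^+ 2 + co z i1 ^+ 2 = 1.
  move=> z0; have := proj2_sig z; rewrite /= (sum2_split _ i01) big1 ?addr0 // => i /andP[? ?].
  by rewrite z0 // expr0n.
have e1 : co (f y) i1 = co (g y') i1.
  apply/eqP; rewrite -(eqrXn2 (_ : 0 < 2)%N) //; apply/eqP.
  have := sq _ fy; have := sq _ gy; rewrite e0; lra.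
have fgy : f y = g y'.
  apply: sphere_eq => i; have [->|ii] := eqVneq i i0; first by [].
  by have [->|ij] := eqVneq i i1; [| rewrite fy ?gy].
have [h gh hg] := Ig.1.
exists (h \o f); split; first exact: t_isometry_comp (t_isometry_inv gh hg Ig) If.
  by rewrite /= fx -gx gh.
by rewrite /= fgy gh.
Qed.

(** Here [gam i] is the great circle from the pole in direction [i], parametrized by half the angle:
    [A] is the value [1 - t] at the antipode and [B] is half the coordinate [u_i]. *)
Lemma sphere_zonal (al be : R) : be + 1 = N.-1%:R / 2 -> al + be + 2 = N.-1%:R ->
  zonal_space spheret al be.
Proof.
move=> hb hab; split.
- exact: spheret_sym.
- exact: spheret_refl.
- exact: spheret_ge0.
- exact: spheret_lip.
- exact: spheret_hom.
have ex i c s : exists p : Pt, i != i0 -> c ^+ 2 + s ^+ 2 = 1 -> forall u,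
   spheret p u = c ^+ 2 * spheret spt0 u + s ^+ 2 * (1 - spheret spt0 u)
     + 2 * c * s * (co u i / 2).
  have [ii|] := boolP (i != i0); last by exists spt0.
  have [cs|] := eqVneq (c ^+ 2 + s ^+ 2) 1; last by move=> /eqP ?; exists spt0.
  have ii' : i0 != i by rewrite eq_sym.
  have cs' : (c ^+ 2 - s ^+ 2) ^+ 2 + (2 * c * s) ^+ 2 = 1.
    transitivity ((c ^+ 2 + s ^+ 2) ^+ 2); first by ring.
    by rewrite cs expr1n.
  have cs'' : (c ^+ 2 - s ^+ 2) ^+ 2 + (- (2 * c * s)) ^+ 2 = 1 by rewrite sqrrN.
  have [f [If fE]] := srot_isometry ii' cs'.
  have [g [Ig gE]] := srot_isometry ii' cs''.
  exists (g spt0) => _ _ u; rewrite -If.2.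
  have -> : f (g spt0) = spt0.
    by apply: sphere_eq => a; rewrite fE gE -{1}[2 * c * s]opprK srotK.
  rewrite !spheret_pt0 fE /srot eqxx.
  transitivity ((c ^+ 2 + s ^+ 2) / 2 + ((c ^+ 2 - s ^+ 2) * co u i0 + 2 * c * s * co u i) / 2).
    by rewrite cs; field.
  by field.
pose gam i c s := projT1 (cid (ex i c s)).
exists spt0, 'I_N, (fun i => i != i0), i1, gam,
  (fun i u => 1 - spheret spt0 u), (fun i u => co u i / 2).
have cN : #|[pred i | i != i0]| = N.-1 by rewrite cardC1 card_ord.
split.
- by rewrite eq_sym.
- by move=> i c s u Pi cs; rewrite /gam; case: (cid _) => p /= ->.
- move=> u; under eq_bigr => k _ do rewrite expr_div_n.
  rewrite -mulr_suml spheret_pt0.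
  have := proj2_sig u; rewrite /= (bigD1 i0) //= => e.
  have -> : \sum_(i < N | i != i0) co u i ^+ 2 = 1 - co u i0 ^+ 2 by lra.
  by field.
- by move=> u; rewrite sumr_const cN hb hab -mulr_natl; field.
- by move=> i _; rewrite spheret_refl subrr.
Qed.
End SphereZonal.

(** * Jacobi polynomials *)

Section JacobiOperator.
Variables (R : realType) (al be : R).
Local Notation ga := (al + be + 1).

(** The Jacobi operator [(1 - x^2) D^2 + (be - al - (al + be + 2) x) D] rewritten in the variable
    [t = (1 + x) / 2]. *)
Definition jop (q : {poly R}) : {poly R} :=
  'X * (1 - 'X) * q^`()^`() + ((be + 1)%:P - (al + be + 2) *: 'X) * q^`().

Definition jlam (n : nat) : R := n%:R * (n%:R + ga).

Lemma coef_jop q m : (jop q)`_m =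
  m.+1%:R * (m.+1%:R + be) * q`_m.+1 - jlam m * q`_m.
Proof.
have -> : jop q = 'X * q^`()^`() - 'X * ('X * q^`()^`()) + (be + 1)%:P * q^`()
    - (al + be + 2)%:P * ('X * q^`()).
  by rewrite /jop -mul_polyC; ring.
rewrite coefB coefD coefB !coefCM !coefXM.
case: m => [|m] /=; rewrite ?coefXM /=.
  by rewrite !coef_deriv /jlam; ring.
case: m => [|m] /=; rewrite !coef_deriv /jlam; ring.
Qed.

Lemma jopD p q : jop (p + q) = jop p + jop q.
Proof. by rewrite /jop !derivD; ring. Qed.

Lemma jopZ c p : jop (c *: p) = c *: jop p.
Proof. by rewrite /jop !derivZ scalerDr -!scalerAr. Qed.

Lemma jop_sum (I : finType) (F : I -> {poly R}) : jop (\sum_i F i) = \sum_i jop (F i).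
Proof.
apply: (big_morph jop jopD).
by rewrite /jop !deriv0 !mulr0 addr0.
Qed.

Lemma jopX m : jop 'X^(m.+1) = (m.+1%:R * (m.+1%:R + be)) *: 'X^m - jlam m.+1 *: 'X^(m.+1).
Proof.
apply/polyP => i; rewrite coef_jop coefB !coefZ !coefXn eqSS.
case: eqVneq => [->|im]; first by rewrite (ltn_eqF (ltnSn m)) !mulr0.
by case: (eqVneq i m.+1) => [->|_]; rewrite !mulr0.
Qed.

Lemma jop1 : jop 1 = 0.
Proof. by rewrite /jop -polyC1 !derivC ?deriv0 !mulr0 addr0. Qed.

(** [jacobiP] is given in the basis [(X - 1)^s X^m] with [s + m = n], and there [jop] only trades a
    factor [X - 1] for a factor [X] or conversely. For [s = 0] or [m = 0] the truncated predecessor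
    is harmless, its coefficient being zero. *)
Lemma jop_base s m : - jop (('X - 1) ^+ s * 'X^m) =
  (s%:R * (s%:R + al)) *: (('X - 1) ^+ s.-1 * 'X^(m.+1))
  + (m%:R * (m%:R + be)) *: (('X - 1) ^+ s.+1 * 'X^(m.-1))
  + (2 * s%:R * m%:R + (be + 1) * s%:R + (al + 1) * m%:R) *: (('X - 1) ^+ s * 'X^m).
Proof.
set sg := 'X - 1 : {poly R}; set b := _ * _.
have dsg : sg^`() = 1 by rewrite /sg -polyC1 derivXsubC.
have b1 : b^`() = s%:R * (sg ^+ s.-1 * 'X^m) + m%:R * (sg ^+ s * 'X^(m.-1)).
  by rewrite /b derivM !deriv_exp dsg derivX !mul1r; ring.
have sgs : sg * (s%:R * sg ^+ s.-1) = s%:R * sg ^+ s.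
  by case: (s) => [|s'] /=; rewrite ?mul0r ?mulr0 // exprS; ring.
have Xm : 'X * (m%:R * 'X^(m.-1)) = m%:R * 'X^m :> {poly R}.
  by case: (m) => [|m'] /=; rewrite ?mul0r ?mulr0 // exprS; ring.
have Xsb : 'X * sg * b^`() = (s%:R * 'X + m%:R * sg) * b.
  rewrite b1 /b.
  transitivity ((sg * (s%:R * sg ^+ s.-1)) * 'X * 'X^m + ('X * (m%:R * 'X^(m.-1))) * sg * sg ^+ s).
    by ring.
  by rewrite sgs Xm; ring.
have dn k : (k%:R : {poly R})^`() = 0 by rewrite -polyC_natr derivC.
(* Differentiating the first-order equation satisfied by [b] yields its second derivative without
   expanding it. *)
have gen (f : {poly R}) : 'X * sg * f^`() = (s%:R * 'X + m%:R * sg) * f ->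
    'X * sg * f^`()^`() = (s%:R + m%:R) * f + ((s%:R - 1) * 'X + (m%:R - 1) * sg) * f^`().
  move=> /(congr1 (@deriv R)).
  rewrite !derivM derivX dsg !derivD !derivM derivX dsg !dn => h.
  by apply: (addrI ((1 * sg + 'X * 1) * f^`())); rewrite h; ring.
have Xsb2 := gen _ Xsb.
have -> : - jop b = (s%:R + m%:R) * b + ((s%:R + al%:P) * 'X + (m%:R + be%:P) * sg) * b^`().
  have -> : - jop b = 'X * sg * b^`()^`() + ((be%:P + 1) * sg + (al%:P + 1) * 'X) * b^`().
    by rewrite /jop /sg -mul_polyC !polyCD !polyC1; ring.
  by rewrite Xsb2; ring.
have c1 : 'X * b^`() = s%:R * (sg ^+ s.-1 * 'X^(m.+1)) + m%:R * b.
  rewrite b1 /b exprS.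
  transitivity (s%:R * (sg ^+ s.-1 * ('X * 'X^m)) + 'X * (m%:R * 'X^(m.-1)) * sg ^+ s); first by ring.
  by rewrite Xm; ring.
have c2 : sg * b^`() = s%:R * b + m%:R * (sg ^+ s.+1 * 'X^(m.-1)).
  rewrite b1 /b exprS.
  transitivity (sg * (s%:R * sg ^+ s.-1) * 'X^m + m%:R * (sg * sg ^+ s * 'X^(m.-1))); first by ring.
  by rewrite sgs; ring.
transitivity ((s%:R + m%:R) * b + ((s%:R + al%:P) * ('X * b^`()) + (m%:R + be%:P) * (sg * b^`()))).
  by ring.
rewrite c1 c2 -!mul_polyC !(polyCD, polyCM) !polyC1 !polyC_natr -/b.
by ring.
Qed.

Lemma gbinomS (z : R) k : k.+1%:R * gbinom z k.+1 = (z - k%:R) * gbinom z k.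
Proof.
rewrite /gbinom big_ord_recr /= factS natrM.
have f0 : (k`!%:R != 0 :> R) by rewrite pnatr_eq0 -lt0n fact_gt0.
have k0 : (k.+1%:R != 0 :> R) by rewrite pnatr_eq0.
by field; rewrite f0 addrC natr1 k0.
Qed.

Definition jcoef n s := gbinom (n%:R + al) (n - s) * gbinom (n%:R + be) s.

(** This ratio of consecutive coefficients makes the outer terms of [jop_base] match after a shift
    of [s]. *)
Lemma jcoefS n s : (s < n)%N ->
  s.+1%:R * (s.+1%:R + al) * jcoef n s.+1 = (n - s)%:R * ((n - s)%:R + be) * jcoef n s.
Proof.
move=> sn; rewrite /jcoef.
have e : (n - s)%N = (n - s.+1).+1 by rewrite subnS prednK // subn_gt0.
have h1 := gbinomS (n%:R + be) s.
have h2 := gbinomS (n%:R + al) (n - s.+1).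
have e1 : (n%:R + be - s%:R) = (n - s)%:R + be by rewrite natrB ?(ltnW sn) //; ring.
have e2 : (n%:R + al - (n - s.+1)%:R) = s.+1%:R + al by rewrite natrB //; ring.
rewrite -e e2 in h2; rewrite e1 in h1.
transitivity (((s.+1%:R + al) * gbinom (n%:R + al) (n - s.+1)) *
   (s.+1%:R * gbinom (n%:R + be) s.+1)); first by ring.
by rewrite -h2 h1; ring.
Qed.

Definition jpoly n : {poly R} := \sum_(s < n.+1) jcoef n s *: (('X - 1) ^+ s * 'X^(n - s)).

Lemma jpolyE n x : jacobiP al be n x = (jpoly n).[(1 + x) / 2].
Proof.
rewrite /jacobiP /jpoly horner_sum; apply: eq_bigr => s _.
rewrite hornerZ hornerM !horner_exp hornerXsubC hornerX /jcoef.
have -> : (x - 1) / 2 = (1 + x) / 2 - 1 by field.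
by rewrite (addrC x) !mulrA.
Qed.

(** After the shifts the two outer terms have traded coefficients, and [s (s + al) + (n - s) (n - s
    + be) + 2 s (n - s) + (be + 1) s + (al + 1) (n - s) = n (n + al + be + 1)] for every [s]. *)
Lemma jpoly_eigen n : jop (jpoly n) = - jlam n *: jpoly n.
Proof.
suff h : - jop (jpoly n) = jlam n *: jpoly n by rewrite scaleNr -h opprK.
rewrite /jpoly jop_sum -sumrN.
under eq_bigr => s _ do rewrite jopZ -scalerN jop_base !scalerDr !scalerA.
rewrite !big_split /= .
set b := fun s => ('X - 1) ^+ s * 'X^(n - s) : {poly R}.
have -> : \sum_(i < n.+1) (jcoef n i * (i%:R * (i%:R + al))) *:
     (('X - 1) ^+ i.-1 * 'X^((n - i).+1)) =
   \sum_(i < n.+1) (jcoef n i * ((n - i)%:R * ((n - i)%:R + be))) *: b i.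
  rewrite big_ord_recl /= mul0r mulr0 scale0r add0r [RHS]big_ord_recr /= subnn mul0r mulr0 scale0r addr0.
  apply: eq_bigr => i _; rewrite /bump /= add1n /b /= -subSn // subSS.
  by rewrite ![jcoef _ _ * _]mulrC jcoefS.
have -> : \sum_(i < n.+1) (jcoef n i * ((n - i)%:R * ((n - i)%:R + be))) *:
     (('X - 1) ^+ i.+1 * 'X^((n - i).-1)) =
   \sum_(i < n.+1) (jcoef n i * (i%:R * (i%:R + al))) *: b i.
  rewrite big_ord_recr /= subnn mul0r mulr0 scale0r addr0 [RHS]big_ord_recl /= mul0r mulr0 scale0r add0r.
  apply: eq_bigr => i _; rewrite /bump /= add1n /b /= -subnS.
  by rewrite ![jcoef _ _ * _]mulrC jcoefS.
rewrite -!big_split /= scaler_sumr; apply: eq_bigr => i _.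
rewrite -!scalerDl scalerA; congr (_ *: _).
have -> : (n - i)%:R = n%:R - i%:R :> R by rewrite natrB // -ltnS.
by rewrite /jlam; ring.
Qed.

Lemma size_jpoly n : (size (jpoly n) <= n.+1)%N.
Proof.
apply: (leq_trans (size_sum _ _ _)); apply/bigmax_leqP => s _.
apply: (leq_trans (size_scale_leq _ _)); apply: (leq_trans (size_polyMleq _ _)).
rewrite -polyC1 size_exp_XsubC size_polyXn addnS /=.
by rewrite addSn subnKC // -ltnS.
Qed.

(** The eigenvalue equation read in monomials, where [jop] is bidiagonal. *)
Lemma jpoly_coefS n m :
  m.+1%:R * (m.+1%:R + be) * (jpoly n)`_m.+1 = (jlam m - jlam n) * (jpoly n)`_m.
Proof.
have := congr1 (fun p : {poly R} => p`_m) (jpoly_eigen n).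
rewrite /= coef_jop coefZ => h; rewrite mulrBl -mulNr -h; ring.
Qed.

Lemma poch_shift (z : R) n : poch z n * (z + n%:R) = z * poch (z + 1) n.
Proof.
rewrite /poch -(big_ord_recr n (fun i => z + i%:R)) big_ord_recl /= addr0; congr (_ * _).
by apply: eq_bigr => i _; rewrite /bump /= add1n -natr1; ring.
Qed.

Lemma jpoly_coef0 n : (jpoly n)`_0 * n`!%:R = (-1) ^+ n * poch (be + 1) n.
Proof.
rewrite -horner_coef0 /jpoly horner_sum big_ord_recr /= big1 ?add0r; last first.
  move=> s _; rewrite hornerZ hornerM hornerXn.
  by rewrite expr0n subn_eq0 leqNgt ltn_ord /= !mulr0.
rewrite hornerZ hornerM hornerXn horner_exp -polyC1 hornerXsubC subnn expr0 mulr1 sub0r /jcoef subnn.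
rewrite {1}/gbinom big_ord0 fact0 divr1 mul1r /gbinom.
have f0 : (n`!%:R != 0 :> R) by rewrite pnatr_eq0 -lt0n fact_gt0.
rewrite mulrAC divfK // mulrC; congr (_ * _).
rewrite /poch (reindex_inj rev_ord_inj) /=; apply: eq_bigr => i _.
by rewrite natrB // -natr1; ring.
Qed.

(** Running the monomial recursion up from the constant coefficient gives the leading one in closed
    form and bypasses a Vandermonde summation of [jcoef]. *)
Lemma jpoly_lead n : -1 < be -> (jpoly n)`_n * n`!%:R = poch (n%:R + ga) n.
Proof.
move=> hb.
have f0 : (n`!%:R != 0 :> R) by rewrite pnatr_eq0 -lt0n fact_gt0.
have bpos (i : nat) : 0 < be + 1 + i%:R by rewrite ltr_wpDr // -(opprK 1) subr_gt0.
have pp : poch (be + 1) n != 0 by apply/prodf_neq0 => i _; rewrite gt_eqF.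
have h m : (m <= n)%N -> (jpoly n)`_m * (m`!%:R * poch (be + 1) m) =
     (jpoly n)`_0 * (-1) ^+ m * (\prod_(i < m) (n - i)%:R) * poch (n%:R + ga) m.
  elim: m => [_|m IH mn].
    by rewrite fact0 /poch !big_ord0 expr0 !mulr1.
  have e := jpoly_coefS n m.
  have {}IH := IH (ltnW mn).
  rewrite factS natrM /poch !big_ord_recr /= -!/(poch _ _) exprS.
  transitivity ((m.+1%:R * (m.+1%:R + be) * (jpoly n)`_m.+1) * (m`!%:R * poch (be + 1) m)).
    by rewrite -natr1; ring.
  rewrite e -mulrA IH /jlam natrB ?(ltnW mn) //; ring.
have fE : \prod_(i < n) (n - i)%:R = n`!%:R :> R.
  rewrite (reindex_inj rev_ord_inj) /= fact_prod natr_prod big_add1 /= big_mkord.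
  by apply: eq_bigr => i _; rewrite subKn.
have := h n (leqnn n); rewrite fE => e.
apply: (mulIf pp); rewrite -mulrA e.
rewrite -(mulrA _ (_ ^+ n)) mulrA (mulrC (_ `_0)) -!mulrA (mulrA (_`_0)) jpoly_coef0.
rewrite mulrA (mulrA _ (_ ^+ n)) -exprMn mulrNN mulr1 expr1n mul1r; ring.
Qed.
End JacobiOperator.

(** * Uniform Taylor estimates for polynomials *)

Section PolyTaylor.
Variable R : realType.
Implicit Types f g : {poly R}.

Lemma poly_bound f : exists2 C, 0 <= C & forall x : R, `|x| <= 1 -> `|f.[x]| <= C.
Proof.
elim/poly_ind: f => [|f c [C C0 hC]]; first by exists 0 => // x _; rewrite horner0 normr0.
exists (C + `|c|) => [|x x1]; first by rewrite addr_ge0.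
rewrite hornerMXaddC (le_trans (ler_normD _ _)) // lerD2r normrM.
by rewrite -[C]mulr1 ler_pM // hC.
Qed.

Lemma poly_taylor2 f : exists2 C, 0 <= C & forall x h : R, `|x| <= 1 -> `|h| <= 3 ->
  `|f.[x + h] - f.[x] - f^`().[x] * h - f^`()^`().[x] / 2 * h ^+ 2| <= C * `|h| ^+ 3.
Proof.
elim/poly_ind: f => [|g c [C C0 hC]].
  by exists 0 => // x h _ _; rewrite !deriv0 !horner0 !mul0r !subr0 normr0.
have [D D0 hD] := poly_bound g^`()^`().
exists (4 * C + D) => [|x h x1 h3]; first by rewrite addr_ge0 // mulr_ge0.
rewrite derivD derivM derivX derivC addr0 mulr1 derivD derivM derivX mulr1 !(hornerD, hornerM, hornerX, hornerC).
set r := g.[x + h] - g.[x] - g^`().[x] * h - g^`()^`().[x] / 2 * h ^+ 2.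
rewrite (_ : _ - _ = (x + h) * r + g^`()^`().[x] / 2 * h ^+ 3); last by rewrite /r; field.
rewrite (le_trans (ler_normD _ _)) // [leRHS]mulrDl lerD //.
  rewrite normrM -mulrA ler_pM ?hC //.
  by rewrite (le_trans (ler_normD _ _)) // (_ : 4 = 1 + 3) ?lerD //; ring.
rewrite normrM normrX ler_wpM2r ?exprn_ge0 // normrM.
rewrite (@ger0_norm _ 2^-1) ?invr_ge0 // ler_pdivrMr //.
by rewrite (le_trans (hD _ x1)) //; lra.
Qed.

(** The displacements are [s^2 (A - T)] plus or minus [2 c s B]; the odd parts cancel and terms of
    order [s^2] remain. The constant is uniform in [T], [A] and [B] because these will depend on a
    point over which the estimate is averaged. *)
Lemma poly_second_diff f : exists2 C, 0 <= C & forall T A B c s : R,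
  0 <= T <= 1 -> 0 <= A <= 1 -> `|B| <= 1 -> 0 <= s <= 1 -> 0 <= c -> c ^+ 2 + s ^+ 2 = 1 ->
  `|f.[c ^+ 2 * T + s ^+ 2 * A + 2 * c * s * B] + f.[c ^+ 2 * T + s ^+ 2 * A + 2 * c * (- s) * B]
     - 2 * f.[T] - s ^+ 2 * (2 * (A - T) * f^`().[T] + 4 * B ^+ 2 * f^`()^`().[T])| <= C * s ^+ 3.
Proof.
have [C C0 hC] := poly_taylor2 f.
have [D D0 hD] := poly_bound f^`()^`().
(* Two Taylor remainders at displacement at most [3 s] give [2 * 27 C]; the terms of order [s^4]
   left over from the squares give [5 D]. *)
exists (54 * C + 5 * D) => [|T A B c s /andP[T0 T1] /andP[A0 A1] B1 /andP[s0 s1] c0 cs].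
  by rewrite addr_ge0 // mulr_ge0.
have c1 : c <= 1 by nra.
pose hp := s ^+ 2 * (A - T) + 2 * c * s * B.
pose hm := s ^+ 2 * (A - T) + 2 * c * (- s) * B.
have B1' : -1 <= B <= 1 by rewrite -ler_norml.
have cB : `|c * B| <= 1 by rewrite normrM (ger0_norm c0) -[1]mulr1 ler_pM.
have sAT : `|s * (A - T)| <= 1.
  by rewrite normrM (ger0_norm s0) -[1]mulr1 ler_pM // ler_norml; lra.
have bnd e : `|e| = 1 -> `|s ^+ 2 * (A - T) + e * (2 * c * s * B)| <= 3 * s.
  move=> e1; rewrite (_ : _ + _ = s * (s * (A - T) + e * (2 * (c * B)))); last by ring.
  rewrite normrM (ger0_norm s0) mulrC ler_wpM2r // (le_trans (ler_normD _ _)) //.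
  rewrite (_ : 3 = 1 + 2 :> R); last by ring.
  rewrite lerD // normrM e1 mul1r normrM ger0_norm //.
  by rewrite -{2}[2]mulr1 ler_wpM2l.
have hpb : `|hp| <= 3 * s by have := bnd 1 (normr1 _); rewrite mul1r.
have hmb : `|hm| <= 3 * s.
  have := bnd (-1); rewrite normrN normr1 => /(_ erefl).
  by rewrite (_ : _ + _ = hm) // /hm; ring.
have s3 : 3 * s <= 3 by lra.
have T1' : `|T| <= 1 by rewrite ger0_norm.
have tb h : `|h| <= 3 * s -> `|f.[T + h] - f.[T] - f^`().[T] * h - f^`()^`().[T] / 2 * h ^+ 2|
    <= 27 * C * s ^+ 3.
  move=> hb; rewrite (le_trans (hC _ _ T1' (le_trans hb s3))) //.
  rewrite (_ : 27 * C * s ^+ 3 = C * (3 * s) ^+ 3); last by ring.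
  by rewrite ler_wpM2l // lerXn2r // nnegrE // mulr_ge0.
have c2 : c ^+ 2 = 1 - s ^+ 2 by rewrite -cs; ring.
have -> : c ^+ 2 * T + s ^+ 2 * A + 2 * c * s * B = T + hp by rewrite c2 /hp; ring.
have -> : c ^+ 2 * T + s ^+ 2 * A + 2 * c * (- s) * B = T + hm by rewrite c2 /hm; ring.
have rem : f^`().[T] * (hp + hm) + f^`()^`().[T] / 2 * (hp ^+ 2 + hm ^+ 2)
   - s ^+ 2 * (2 * (A - T) * f^`().[T] + 4 * B ^+ 2 * f^`()^`().[T])
   = s ^+ 4 * ((A - T) ^+ 2 - 4 * B ^+ 2) * f^`()^`().[T].
  have -> : hp ^+ 2 + hm ^+ 2 = 2 * s ^+ 4 * (A - T) ^+ 2 + 8 * (1 - s ^+ 2) * s ^+ 2 * B ^+ 2.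
    by rewrite -c2 /hp /hm; ring.
  by rewrite /hp /hm; field.
have remb : `|s ^+ 4 * ((A - T) ^+ 2 - 4 * B ^+ 2) * f^`()^`().[T]| <= 5 * D * s ^+ 3.
  rewrite (_ : 5 * D * s ^+ 3 = s ^+ 3 * 5 * D); last by ring.
  rewrite 2!normrM ler_pM ?mulr_ge0 //; last exact: hD.
  rewrite ler_pM //; last by rewrite ler_norml; nra.
  by rewrite normrX ger0_norm // exprS ler_piMl // exprn_ge0.
rewrite (_ : _ - _ = (f.[T + hp] - f.[T] - f^`().[T] * hp - f^`()^`().[T] / 2 * hp ^+ 2)
  + (f.[T + hm] - f.[T] - f^`().[T] * hm - f^`()^`().[T] / 2 * hm ^+ 2)
  + (f^`().[T] * (hp + hm) + f^`()^`().[T] / 2 * (hp ^+ 2 + hm ^+ 2)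
   - s ^+ 2 * (2 * (A - T) * f^`().[T] + 4 * B ^+ 2 * f^`()^`().[T]))); last by ring.
rewrite (le_trans (ler_normD _ _)) // rem [leRHS]mulrDl lerD //.
rewrite (le_trans (ler_normD _ _)) // (_ : 54 * C * _ = 27 * C * s ^+ 3 + 27 * C * s ^+ 3); last by ring.
by rewrite lerD // tb.
Qed.
Lemma poly_lip g : exists2 C, 0 <= C & forall T S : R, 0 <= T <= 1 -> 0 <= S <= 1 ->
  `|g.[T] - g.[S]| <= C * `|T - S|.
Proof.
elim/poly_ind: g => [|f c [C C0 hC]].
  by exists 0 => // T S _ _; rewrite !horner0 subrr normr0 mul0r.
have [D D0 hD] := poly_bound f.
exists (C + D) => [|T S T1 S1]; first by rewrite addr_ge0.
rewrite !hornerMXaddC (_ : _ - _ = (f.[T] - f.[S]) * T + f.[S] * (T - S)); last by ring.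
rewrite (le_trans (ler_normD _ _)) // [leRHS]mulrDl lerD // normrM.
  rewrite -[leRHS]mulr1 ler_pM ?hC // ger0_norm //; by case/andP: T1.
by rewrite ler_wpM2r // hD // ger0_norm; case/andP: S1.
Qed.

End PolyTaylor.

(** * The reproducing formula *)

Section ZonalKernel.
Variables (R : realType) (M : Type) (t : M -> M -> R) (al be : R).
Hypothesis Hz : zonal_space t al be.
Variables (good : (M -> R) -> Prop) (E : (M -> R) -> R).
Hypothesis good_cst : forall c, good (fun=> c).
Hypothesis goodD : forall f g, good f -> good g -> good (fun u => f u + g u).
Hypothesis goodM : forall f g, good f -> good g -> good (fun u => f u * g u).
Hypothesis good_t : forall x, good (t x).
Hypothesis ED : forall f g, good f -> good g -> E (fun u => f u + g u) = E f + E g.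
Hypothesis EZ : forall c f, good f -> E (fun u => c * f u) = c * E f.
Hypothesis E_le : forall f g, good f -> good g -> (forall u, f u <= g u) -> E f <= E g.
Hypothesis E1 : E (fun=> 1) = 1.
Hypothesis E_inv : forall f phi, good f -> t_isometry t phi -> E (f \o phi) = E f.
Implicit Types (f g : M -> R) (q h k p : {poly R}) (x y u : M).

Let tsym := t_sym Hz.
Let trefl := t_refl Hz.
Let tge0 := t_ge0 Hz.

Lemma t_le1 x y : t x y <= 1.
Proof. by have := t_lip Hz x y y; have := sqr_ge0 (t y y - t y x); lra. Qed.

Lemma goodZ c f : good f -> good (fun u => c * f u).
Proof. exact: goodM. Qed.

Lemma good_ext f g : f =1 g -> good f -> good g.
Proof. by move=> /funext ->. Qed.

Lemma E_ext f g : f =1 g -> E f = E g.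
Proof. by move=> /funext ->. Qed.

Lemma good_poly q x : good (fun u => q.[t x u]).
Proof.
elim/poly_ind: q => [|q c IH].
  by apply: (@good_ext (fun=> 0)) => // u; rewrite horner0.
apply: (@good_ext (fun u => q.[t x u] * t x u + c)); first by move=> u; rewrite hornerMXaddC.
by apply: goodD => //; apply: goodM.
Qed.

Lemma good_sum (I : Type) (r : seq I) (P : pred I) (F : I -> M -> R) :
  (forall i, good (F i)) -> good (fun u => \sum_(i <- r | P i) F i u).
Proof.
move=> gF; elim: r => [|i r IH].
  by apply: (@good_ext (fun=> 0)) => // u; rewrite big_nil.
apply: (@good_ext (fun u => (if P i then F i u else 0) + \sum_(j <- r | P j) F j u)).
  by move=> u; rewrite big_cons; case: ifP; rewrite ?add0r.
by apply: goodD => //; case: (P i) => //.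
Qed.

Lemma E_sum (I : Type) (r : seq I) (P : pred I) (F : I -> M -> R) :
  (forall i, good (F i)) -> E (fun u => \sum_(i <- r | P i) F i u) = \sum_(i <- r | P i) E (F i).
Proof.
move=> gF; elim: r => [|i r IH].
  rewrite big_nil (@E_ext _ (fun u => 0 * 1)); first by rewrite EZ ?mul0r.
  by move=> u; rewrite big_nil mul0r.
rewrite big_cons; case: ifP => Pi.
  rewrite -IH -ED //; last exact: good_sum.
  by apply: E_ext => u; rewrite big_cons Pi.
by rewrite -IH; apply: E_ext => u; rewrite big_cons Pi.
Qed.

Lemma E_cst c : E (fun=> c) = c.
Proof. by rewrite (@E_ext _ (fun=> c * 1)) ?EZ ?E1 ?mulr1 // => u; rewrite mulr1. Qed.

Lemma E_norm f C : good f -> (forall u, `|f u| <= C) -> `|E f| <= C.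
Proof.
move=> gf fC; rewrite ler_norml -{1}(E_cst (- C)) -{2}(E_cst C).
by apply/andP; split; apply: E_le => // u; have := fC u; rewrite ler_norml => /andP[].
Qed.

Definition zk q h x y : R := E (fun u => q.[t x u] * h.[t y u]).

Lemma good_zk q h x y : good (fun u => q.[t x u] * h.[t y u]).
Proof. by apply: goodM; exact: good_poly. Qed.

Lemma zkC q h x y : zk q h x y = zk h q y x.
Proof. by apply: E_ext => u; rewrite mulrC. Qed.

Lemma zkDl q1 q2 h x y : zk (q1 + q2) h x y = zk q1 h x y + zk q2 h x y.
Proof.
rewrite /zk -ED; [|exact: good_zk|exact: good_zk].
by apply: E_ext => u; rewrite hornerD mulrDl.
Qed.

Lemma zkZl c q h x y : zk (c *: q) h x y = c * zk q h x y.
Proof.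
rewrite /zk -EZ; last exact: good_zk.
by apply: E_ext => u; rewrite hornerZ mulrA.
Qed.

Lemma zkZr c q h x y : zk q (c *: h) x y = c * zk q h x y.
Proof. by rewrite zkC zkZl zkC. Qed.

Lemma zk_sum_coef q n h x y : (size q <= n)%N ->
  zk q h x y = \sum_(m < n) q`_m * zk 'X^m h x y.
Proof.
move=> sq; transitivity (\sum_(m < n) zk (q`_m *: 'X^m) h x y); last first.
  by apply: eq_bigr => m _; rewrite zkZl.
rewrite /zk -(@E_sum _ _ xpredT (fun (m : 'I_n) u => (q`_m *: 'X^m).[t x u] * h.[t y u])).
  apply: E_ext => u; rewrite -mulr_suml; congr (_ * _).
  by rewrite (horner_coef_wide _ sq); apply: eq_bigr => i _; rewrite hornerZ hornerXn.
by move=> m; exact: good_zk.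
Qed.

Lemma zk_inv q h x y phi : t_isometry t phi -> zk q h (phi x) (phi y) = zk q h x y.
Proof.
move=> Iphi; rewrite /zk -(E_inv (good_zk q h (phi x) (phi y)) Iphi).
by apply: E_ext => u /=; rewrite !Iphi.2.
Qed.

(* Since the sign of [s] does not affect [t x0 (gam i c s)], only the even part in
   [s] of [h] along the curve contributes, and that part is a polynomial in [c ^+ 2]. *)
Lemma zk_poly q h : exists k, forall x y, zk q h x y = k.[t x y].
Proof.
have [x0 [I [P [i0 [gam [A [B [Pi0 tg sB _ A0]]]]]]]] := t_curves Hz.
have gA : good (A i0).
  apply: (@good_ext (t (gam i0 0 1))) => // u; rewrite tg //; ring.
(* At [c = s = 1 / sqrt 2] the coefficient of [B] in the curve formula is 1, which exhibits [B i0]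
   as a combination of [good] functions. *)
pose r2 : R := Num.sqrt 2^-1.
have r2E : r2 ^+ 2 = 2^-1 by rewrite sqr_sqrtr // invr_ge0.
have gB : good (B i0).
  apply: (@good_ext (fun u => t (gam i0 r2 r2) u + - 2^-1 * t x0 u + - 2^-1 * A i0 u)).
    move=> u; rewrite tg //; last by rewrite r2E; field.
    by rewrite -mulrA -(mulrA 2) (mulrA r2) -expr2 r2E; field.
  by apply: goodD; [apply: goodD|]; rewrite //; exact: goodZ.
pose a T u := T * t x0 u + (1 - T) * A i0 u.
pose v T u := 4 * T * (1 - T) * B i0 u ^+ 2.
have ga T : good (a T) by apply: goodD; exact: goodZ.
have gB2 : good (fun u => B i0 u ^+ 2) by apply: (@good_ext (fun u => B i0 u * B i0 u)) => //; apply: goodM.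
have gv T : good (v T) by exact: goodZ.
(* [e] and [od] are the even and odd parts in [w]. Polynomiality in [T] is claimed for every weight
   [f], because each new factor of [h'] multiplies the weight by [t x0], [A i0] or [B i0 ^+ 2]. *)
have parity h' : exists e od : R -> R -> R,
  [/\ forall b w : R, h'.[b + w] = e b (w ^+ 2) + w * od b (w ^+ 2),
      forall T, good (fun u => e (a T u) (v T u)),
      forall T, good (fun u => od (a T u) (v T u)),
      forall f, good f -> exists p, forall T, E (fun u => f u * e (a T u) (v T u)) = p.[T] &
      forall f, good f -> exists p, forall T, E (fun u => f u * od (a T u) (v T u)) = p.[T]].
  elim/poly_ind: h' => [|h' c [e [od [eo ge go Ee Eo]]]].
    have z f : E (fun u => f u * 0) = 0 by rewrite (@E_ext _ (fun=> 0)) ?E_cst // => u; rewrite mulr0.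
    exists (fun _ _ => 0), (fun _ _ => 0); split=> //.
    + by move=> b w; rewrite horner0; ring.
    + by move=> f _; exists 0 => T; rewrite z horner0.
    + by move=> f _; exists 0 => T; rewrite z horner0.
  exists (fun b w => b * e b w + w * od b w + c), (fun b w => e b w + b * od b w); split.
  + by move=> b w; rewrite hornerMXaddC eo; ring.
  + by move=> T; apply: goodD => //; apply: goodD; apply: goodM.
  + by move=> T; apply: goodD => //; apply: goodM.
  + move=> f gf.
    have [p1 hp1] := Ee _ (goodM gf (good_t x0)).
    have [p2 hp2] := Ee _ (goodM gf gA).
    have [p3 hp3] := Eo _ (goodM gf gB2).
    exists ('X * p1 + (1 - 'X) * p2 + 4%:P * 'X * (1 - 'X) * p3 + (c * E f)%:P) => T.
    rewrite !(hornerD, hornerM, hornerN, hornerX, hornerC) -hp1 -hp2 -hp3.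
    have gf1 : good (fun u => f u * t x0 u * e (a T u) (v T u)) by apply: goodM => //; apply: goodM.
    have gf2 : good (fun u => f u * A i0 u * e (a T u) (v T u)) by apply: goodM => //; apply: goodM.
    have gf3 : good (fun u => f u * B i0 u ^+ 2 * od (a T u) (v T u)) by apply: goodM => //; apply: goodM.
    rewrite -!EZ // -!ED //; try by repeat (apply: goodD || apply: goodZ).
    by apply: E_ext => u; rewrite /a /v; ring.
  + move=> f gf.
    have [p1 hp1] := Ee _ gf.
    have [p2 hp2] := Eo _ (goodM gf (good_t x0)).
    have [p3 hp3] := Eo _ (goodM gf gA).
    exists (p1 + 'X * p2 + (1 - 'X) * p3) => T.
    rewrite !(hornerD, hornerM, hornerN, hornerX, hornerC) -hp1 -hp2 -hp3.
    have gf1 : good (fun u => f u * e (a T u) (v T u)) by apply: goodM.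
    have gf2 : good (fun u => f u * t x0 u * od (a T u) (v T u)) by apply: goodM => //; apply: goodM.
    have gf3 : good (fun u => f u * A i0 u * od (a T u) (v T u)) by apply: goodM => //; apply: goodM.
    rewrite -!EZ // -!ED //; try by repeat (apply: goodD || apply: goodZ).
    by apply: E_ext => u; rewrite /a /v; ring.
have [e [od [eo ge go Ee _]]] := parity h.
have [k hk] := Ee _ (good_poly q x0).
exists k => x y; rewrite -hk.
set T := t x y.
have c2 := sqr_sqrtr (tge0 x y).
have s2 : Num.sqrt (1 - T) ^+ 2 = 1 - T by rewrite sqr_sqrtr // subr_ge0 t_le1.
set c := Num.sqrt (t x y) in c2; set s := Num.sqrt (1 - T) in s2.
have B0 : B i0 x0 = 0.
  have := sB x0; rewrite trefl subrr mulr0 => /psumr_eq0P h0.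
  by apply/eqP; rewrite -sqrf_eq0 h0 // => i _; exact: sqr_ge0.
(* Homogeneity carries [(x, y)] to [(x0, gam i0 c s')] for either square root [s'] of [1 - T]. *)
have zs s' : s' ^+ 2 = 1 - T -> zk q h x y =
    E (fun u => q.[t x0 u] * (e (a T u) (v T u) + 2 * c * s' * B i0 u * od (a T u) (v T u))).
  move=> s2'; have cs : c ^+ 2 + s' ^+ 2 = 1 by rewrite c2 s2'; rewrite /T; ring.
  have tE : t x y = t x0 (gam i0 c s').
    by rewrite tsym [RHS]tsym tg // trefl A0 // B0 c2 tsym; ring.
  have [phi [Iphi hx hy]] := t_hom Hz tE.
  rewrite -(zk_inv q h x y Iphi) hx hy; apply: E_ext => u; congr (_ * _).
  rewrite tg // eo; congr (e _ _ + _ * od _ _); rewrite ?c2 ?s2' //.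
    by rewrite !exprMn c2 s2' /v /T; ring.
  by rewrite !exprMn c2 s2' /v /T; ring.
have gq := good_poly q x0.
have gqe : good (fun u => q.[t x0 u] * e (a T u) (v T u)) by exact: goodM.
have gqo : good (fun u => q.[t x0 u] * (B i0 u * od (a T u) (v T u))) by apply: goodM => //; exact: goodM.
have spl s' : E (fun u => q.[t x0 u] * (e (a T u) (v T u) + 2 * c * s' * B i0 u * od (a T u) (v T u)))
   = E (fun u => q.[t x0 u] * e (a T u) (v T u))
     + 2 * c * s' * E (fun u => q.[t x0 u] * (B i0 u * od (a T u) (v T u))).
  by rewrite -EZ // -ED //; [apply: E_ext => u; ring | exact: goodZ].
have h1 := zs s s2; have h2 := zs (- s); rewrite sqrrN in h2; have {}h2 := h2 s2.
rewrite spl in h1; rewrite spl in h2; lra.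
Qed.

(** The identity [DE] between second differences is exact. The error [C * s ^+ 3] in [lap] is
    uniform in [u], so it survives [E], and after division by [s ^+ 2] it vanishes with [s]. *)
Lemma zk_jop q h k : (forall x y, zk q h x y = k.[t x y]) ->
  forall x y, zk (jop al be q) h x y = (jop al be k).[t x y].
Proof.
move=> hk.
have [x0 [I [P [i0 [gam [A [B [Pi0 tg sB sA A0]]]]]]]] := t_curves Hz.
suff H y : zk (jop al be q) h x0 y = (jop al be k).[t x0 y].
  move=> x y; have e : t x x = t x0 x0 by rewrite !trefl.
  have [f [If fx _]] := t_hom Hz e.
  by rewrite -(zk_inv _ _ _ _ If) fx H -fx If.2.
have AE i u : P i -> 0 <= A i u <= 1.
  move=> Pi; have -> : A i u = t (gam i 0 1) u.
    by rewrite tg //; ring.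
  by rewrite tge0 t_le1.
have BE i u : P i -> `|B i u| <= 1.
  move=> Pi; have : B i u ^+ 2 <= 1.
    apply: (@le_trans _ _ (\sum_(i | P i) B i u ^+ 2)).
      by rewrite (bigD1 i) //= lerDl sumr_ge0 // => l _; exact: sqr_ge0.
    by rewrite sB; have := tge0 x0 u; have := t_le1 x0 u; nra.
  by move=> B2; rewrite ler_norml; apply/andP; split; nra.
pose D (f : {poly R}) (c s : R) u := \sum_(i | P i) (f.[t (gam i c s) u] + f.[t (gam i c (- s)) u] - 2 * f.[t x0 u]).
(* [s] is the sine of half the arc, so [4 * s ^+ 2] is the squared arc length to leading order. *)
have lap (f : {poly R}) : exists2 C, 0 <= C & forall c s u, 0 <= s <= 1 -> 0 <= c ->
    c ^+ 2 + s ^+ 2 = 1 -> `|D f c s u - 4 * s ^+ 2 * (jop al be f).[t x0 u]| <= C * s ^+ 3.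
  have [C C0 hC] := poly_second_diff f.
  exists (\sum_(i | P i) C) => [|c s u s01 c0 cs]; first exact: sumr_ge0.
  set T := t x0 u.
  have -> : 4 * s ^+ 2 * (jop al be f).[T] = \sum_(i | P i)
     s ^+ 2 * (2 * (A i u - T) * f^`().[T] + 4 * B i u ^+ 2 * f^`()^`().[T]).
    rewrite -mulr_sumr big_split /= -!mulr_suml -!mulr_sumr sB sA /jop.
    rewrite !(hornerD, hornerM, hornerN, hornerZ, hornerX, hornerC) -/T; ring.
  rewrite /D -sumrB mulr_suml (le_trans (ler_norm_sum _ _ _)) // ler_sum // => i Pi.
  rewrite !tg ?sqrrN //; apply: hC => //; [|exact: AE|exact: BE].
  by rewrite /T tge0 t_le1.
have [C1 C10 lapk] := lap k; have [C2 C20 lapq] := lap q.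
have [Ch Ch0 hCh] := poly_bound h.
have gD c s : good (fun u => D q c s u).
  apply: good_sum => i; apply: goodD; first by apply: goodD; exact: good_poly.
  by apply: (@good_ext (fun u => - 2 * q.[t x0 u])) => [u|]; [rewrite mulNr | apply: goodZ; exact: good_poly].
have DE c s : E (fun u => D q c s u * h.[t y u]) = D k c s y.
  rewrite /D; under [RHS]eq_bigr => i _ do rewrite -!hk.
  transitivity (E (fun u => \sum_(i | P i) (q.[t (gam i c s) u] * h.[t y u]
     + q.[t (gam i c (- s)) u] * h.[t y u] + (- 2) * (q.[t x0 u] * h.[t y u])))).
    by apply: E_ext => u; rewrite mulr_suml; apply: eq_bigr => i _; ring.
  have g2 : good (fun u => -2 * (q.[t x0 u] * h.[t y u])) by apply: goodZ; exact: good_zk.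
  have gi i : good (fun u => q.[t (gam i c s) u] * h.[t y u] + q.[t (gam i c (- s)) u] * h.[t y u]).
    by apply: goodD; exact: good_zk.
  rewrite E_sum; last by move=> i; exact: goodD.
  apply: eq_bigr => i _; rewrite ED // ED ?EZ -?/(zk _ _ _ _) ?mulNr //; exact: good_zk.
pose X := zk (jop al be q) h x0 y; pose Y := (jop al be k).[t x0 y].
have key s : 0 < s <= 1 -> 4 * `|X - Y| <= (C2 * Ch + C1) * s.
  move=> /andP[s0 s1]; pose c := Num.sqrt (1 - s ^+ 2).
  have s2 : 0 <= 1 - s ^+ 2 by nra.
  have cs : c ^+ 2 + s ^+ 2 = 1 by rewrite sqr_sqrtr //; ring.
  have s01 : 0 <= s <= 1 by rewrite ltW.
  have hb u : `|h.[t y u]| <= Ch by apply: hCh; rewrite ger0_norm ?tge0 ?t_le1.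
  have e1 : `|D k c s y - 4 * s ^+ 2 * Y| <= C1 * s ^+ 3 by apply: lapk => //; exact: sqrtr_ge0.
  have e2 : `|D k c s y - 4 * s ^+ 2 * X| <= C2 * s ^+ 3 * Ch.
    rewrite -DE /X /zk -EZ; last exact: good_zk.
    rewrite -mulN1r -EZ; last by apply: goodZ; exact: good_zk.
    have g1 : good (fun u => D q c s u * h.[t y u]) by apply: goodM => //; exact: good_poly.
    have g2 : good (fun u => -1 * (4 * s ^+ 2 * ((jop al be q).[t x0 u] * h.[t y u]))).
      by do 2! apply: goodZ; exact: good_zk.
    rewrite -ED //; apply: E_norm; first exact: goodD.
    move=> u; rewrite (_ : _ + _ = (D q c s u - 4 * s ^+ 2 * (jop al be q).[t x0 u]) * h.[t y u]).
      by rewrite normrM ler_pM // lapq // sqrtr_ge0.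
    by ring.
  have e3 : `|4 * s ^+ 2 * X - 4 * s ^+ 2 * Y| <= (C2 * Ch + C1) * s ^+ 3.
    rewrite (_ : _ - _ = (D k c s y - 4 * s ^+ 2 * Y) - (D k c s y - 4 * s ^+ 2 * X)); last by ring.
    rewrite (le_trans (ler_normB _ _)) //; lra.
  have s2p : 0 < s ^+ 2 by rewrite exprn_gt0.
  rewrite -(ler_pM2l s2p) (_ : s ^+ 2 * ((C2 * Ch + C1) * s) = (C2 * Ch + C1) * s ^+ 3); last by ring.
  rewrite (_ : s ^+ 2 * _ = `|4 * s ^+ 2 * X - 4 * s ^+ 2 * Y|) //.
  rewrite -mulrBr normrM ger0_norm; first by ring.
  by rewrite mulr_ge0 // ltW.
apply/eqP; rewrite -subr_eq0 -normr_eq0 -/X -/Y eq_le normr_ge0 andbT.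
have CC : 0 <= C2 * Ch + C1 by rewrite addr_ge0 // mulr_ge0.
apply/ler_addgt0Pr => eps eps0; rewrite add0r.
pose s := Num.min 1 (eps / (C2 * Ch + C1 + 1)).
have D0 : 0 < C2 * Ch + C1 + 1 by rewrite ltr_wpDl.
have s0 : 0 < s by rewrite lt_min ltr01 divr_gt0.
have s1 : s <= 1 by rewrite ge_min lexx.
have se : s * (C2 * Ch + C1 + 1) <= eps by rewrite -ler_pdivlMr // ge_min lexx orbT.
have := key s; rewrite s0 s1 => /(_ isT); have := normr_ge0 (X - Y); nra.
Qed.

Lemma zk_jop_sym q h x y : zk (jop al be q) h x y = zk q (jop al be h) x y.
Proof.
have [k hk] := zk_poly q h.
rewrite (zk_jop hk) zkC (@zk_jop h q k) ?(tsym y) // => x' y'.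
by rewrite zkC hk tsym.
Qed.

Hypotheses (al0 : 0 <= al) (be1 : -1 < be) (ga0 : 0 < al + be + 1).
Local Notation ga := (al + be + 1).

Lemma zk_eigen_rec h n m x y : jop al be h = - jlam al be n *: h ->
  (jlam al be m.+1 - jlam al be n) * zk 'X^(m.+1) h x y =
  m.+1%:R * (m.+1%:R + be) * zk 'X^m h x y.
Proof.
move=> hh; have := zk_jop_sym 'X^(m.+1) h x y.
rewrite hh zkZr jopX -scaleNr zkDl !zkZl; lra.
Qed.

Lemma zk_eigen_0 h n x y : jop al be h = - jlam al be n *: h ->
  jlam al be n * zk 1 h x y = 0.
Proof.
move=> hh; have := zk_jop_sym 1 h x y.
rewrite hh zkZr jop1.
have -> : zk 0 h x y = 0 by rewrite -[0](scale0r 1) zkZl mul0r.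
lra.
Qed.

Lemma jlamB n m : jlam al be m - jlam al be n = (m%:R - n%:R) * (m%:R + n%:R + ga).
Proof. by rewrite /jlam; ring. Qed.

Lemma jlamB_neq0 n m : m != n -> jlam al be m - jlam al be n != 0.
Proof.
move=> mn; rewrite jlamB mulf_neq0 // ?subr_eq0 ?eqr_nat // gt_eqF //.
by rewrite ltr_wpDl // addr_ge0.
Qed.

(** The recursion starts from 0 and its factors [jlam m - jlam n] do not vanish below [n]. This is
    the orthogonality that reduces [zk] of [jpoly] with itself to its leading coefficient. *)
Lemma zk_low n m x y : (m < n)%N -> zk 'X^m (jpoly al be n) x y = 0.
Proof.
have hh := jpoly_eigen al be n.
elim: m => [|m IH] mn.
  have /eqP := zk_eigen_0 x y hh; rewrite mulf_eq0 expr0 => /orP[|/eqP //].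
  have := jlamB_neq0 (negbT (ltn_eqF mn)).
  by rewrite {1}/jlam mul0r sub0r oppr_eq0 => /negbTE ->.
have := zk_eigen_rec m x y hh; rewrite (IH (ltnW mn)) mulr0 => /eqP.
by rewrite mulf_eq0 (negbTE (jlamB_neq0 (negbT (ltn_eqF mn)))) => /eqP.
Qed.

Definition zmom m x y := zk 'X^m 1 x y.

(** The constant polynomial is an eigenfunction for eigenvalue 0. The resulting moments are those of
    the Beta distribution with parameters [be + 1] and [al + 1], found without computing the law of
    [t x U]. *)
Lemma zmom_rec m x y : (m.+1%:R + ga) * zmom m.+1 x y = (m.+1%:R + be) * zmom m x y.
Proof.
have h1 : jop al be 1 = - jlam al be 0 *: 1.
  by rewrite jop1 /jlam mul0r oppr0 scale0r.
have := zk_eigen_rec m x y h1; rewrite /jlam mul0r subr0 -!mulrA.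
by apply: mulfI; rewrite pnatr_eq0.
Qed.

Lemma zmom0 x y : zmom 0 x y = 1.
Proof. by rewrite /zmom /zk expr0 (@E_ext _ (fun=> 1)) ?E1 // => u; rewrite -polyC1 !hornerC mulr1. Qed.

Lemma mga_gt0 m : 0 < m%:R + ga.
Proof. by rewrite ltr_wpDl. Qed.

Lemma mbe_gt0 m : 0 < m.+1%:R + be.
Proof. by have := ler0n R m; have := be1; rewrite -natr1; lra. Qed.

Lemma zmom_gt0 m x y : 0 < zmom m x y.
Proof.
elim: m => [|m IH]; first by rewrite zmom0.
have := zmom_rec m x y; rewrite -(pmulr_rgt0 _ (mga_gt0 m.+1)) => ->.
by rewrite mulr_gt0 // mbe_gt0.
Qed.

Lemma zmom_poch n x y : zmom n x y * poch (ga + 1) n = poch (be + 1) n.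
Proof.
elim: n => [|n IH]; first by rewrite zmom0 /poch !big_ord0 mulr1.
rewrite /poch !big_ord_recr /= -!/(poch _ _) -IH.
have := zmom_rec n x y; rewrite -natr1 => e.
transitivity (((n%:R + 1 + ga) * zmom n.+1 x y) * poch (ga + 1) n); first by ring.
by rewrite e; ring.
Qed.

(* The measures [t x u ^+ m] normalised by [zmom] concentrate at [x], because
   [1 - zmom m.+1 / zmom m] tends to [0]. *)
Lemma zk_concentrate h x y : exists2 C, 0 <= C & forall m (dl : R), 0 < dl ->
  `|zk 'X^m h x y / zmom m x y - h.[t y x]| <= dl + C / dl / m.+1%:R.
Proof.
have [L L0 hL] := poly_lip h.
exists (2 * L ^+ 2 * (al + 1)) => [|m dl dl0].
  by rewrite mulr_ge0 ?addr_ge0 // mulr_ge0 ?sqr_ge0.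
set mu := zmom m x y; have mu0 : 0 < mu by exact: zmom_gt0.
pose C := 2 * L ^+ 2.
(* [z <= dl + z^2 / dl] together with [z^2 <= C (1 - t)] trades a square root for an expression
   linear in [t], whose weighted averages are moments. *)
have pt u : `|h.[t y u] - h.[t y x]| <= dl + C / dl * (1 - t x u).
  set z := `|_|.
  have z2 : z ^+ 2 <= C * (1 - t x u).
    have h1 : z <= L * `|t y u - t y x| by apply: hL; rewrite tge0 t_le1.
    have h2 : z ^+ 2 <= L ^+ 2 * (t y u - t y x) ^+ 2.
      rewrite -[(t y u - _) ^+ 2]real_normK ?num_real // -exprMn lerXn2r ?nnegrE ?normr_ge0 //.
      by rewrite mulr_ge0.
    rewrite (le_trans h2) // (_ : C * _ = L ^+ 2 * (2 * (1 - t x u))); last by rewrite /C; ring.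
    rewrite ler_wpM2l ?sqr_ge0 //.
    exact: (t_lip Hz).
  have z0 : 0 <= z by exact: normr_ge0.
  rewrite mulrAC -(ler_pM2r dl0) mulrDl divfK ?gt_eqF //; nra.
have tx0 u : 0 <= 'X^m.[t x u] by rewrite hornerXn exprn_ge0.
have gXm : good (fun u => 'X^m.[t x u] * 1.[t y u]) by exact: good_zk.
have gXm1 : good (fun u => 'X^(m.+1).[t x u] * 1.[t y u]) by exact: good_zk.
have gXh : good (fun u => 'X^m.[t x u] * h.[t y u]) by exact: good_zk.
have one u : (1 : {poly R}).[t y u] = 1 by rewrite -polyC1 hornerC.
have key e : `|e| = 1 -> e * (zk 'X^m h x y - h.[t y x] * mu) <=
    dl * mu + C / dl * (mu - zmom m.+1 x y).
  move=> e1; rewrite (_ : e * _ = e * zk 'X^m h x y + (- e * h.[t y x]) * mu); last by ring.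
  rewrite (_ : dl * mu + _ = (dl + C / dl) * mu + (- (C / dl)) * zmom m.+1 x y); last by ring.
  rewrite /mu /zmom /zk -!EZ // -!ED //; try exact: goodZ.
  apply: E_le; try by apply: goodD; exact: goodZ.
  move=> u; rewrite !one !mulr1.
  rewrite (_ : 'X^(m.+1).[t x u] = 'X^m.[t x u] * t x u); last by rewrite !hornerXn exprSr.
  rewrite -subr_ge0 (_ : _ - _ = 'X^m.[t x u] *
    (dl + C / dl * (1 - t x u) - e * (h.[t y u] - h.[t y x]))); last by ring.
  rewrite mulr_ge0 // subr_ge0 (le_trans _ (pt u)) //.
  by rewrite -[leRHS]mul1r -e1 -normrM ler_norm.
have k1 := key 1 (normr1 _).
have k2 : -1 * (zk 'X^m h x y - h.[t y x] * mu) <= dl * mu + C / dl * (mu - zmom m.+1 x y).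
  by apply: key; rewrite normrN normr1.
(* The relative drop between consecutive moments supplies the rate [1 / m.+1]. *)
have muS : mu - zmom m.+1 x y = mu * ((al + 1) / (m.+1%:R + ga)).
  have e : zmom m.+1 x y = (m.+1%:R + be) * mu / (m.+1%:R + ga).
    by rewrite -zmom_rec mulrC mulKf // gt_eqF // mga_gt0.
  by rewrite e; field; apply: lt0r_neq0; have := mga_gt0 m.+1; rewrite -natr1; lra.
rewrite muS in k1 k2.
have -> : zk 'X^m h x y / mu - h.[t y x] = (zk 'X^m h x y - h.[t y x] * mu) / mu.
  by field; rewrite gt_eqF.
rewrite normrM [`|mu^-1|]gtr0_norm ?invr_gt0 // ler_pdivrMr //.
apply: (@le_trans _ _ (dl * mu + C / dl * (mu * ((al + 1) / (m.+1%:R + ga))))).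
  by rewrite ler_norml; apply/andP; split; lra.
rewrite [leRHS]mulrDl lerD2l.
rewrite (_ : C / dl * (mu * _) = C / dl * (al + 1) * mu * (m.+1%:R + ga)^-1); last by ring.
rewrite [leRHS](_ : _ = C / dl * (al + 1) * mu * m.+1%:R^-1); last by rewrite /C; ring.
apply: ler_wpM2l.
- by rewrite /C !mulr_ge0 ?invr_ge0 ?sqr_ge0 ?(ltW dl0) ?(ltW mu0) ?addr_ge0.
- by rewrite lef_pV2 ?posrE ?mga_gt0 ?ltr0Sn // lerDl ltW.
Qed.

Lemma poch_gt0 (z : R) n : 0 < z -> 0 < poch z n.
Proof. by move=> z0; apply: prodr_gt0 => i _; rewrite ltr_wpDr. Qed.

Lemma poch1 n : poch (1 : R) n = n`!%:R.
Proof.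
rewrite /poch fact_prod natr_prod big_add1 /= big_mkord.
by apply: eq_bigr => i _; rewrite -natr1 addrC.
Qed.

Lemma cvg_prod1 n (F : nat -> nat -> R) : (forall i, F i k @[k --> \oo] --> (1 : R)) ->
  \prod_(i < n) F i k @[k --> \oo] --> (1 : R).
Proof.
move=> hF; elim: n => [|n IH].
  by under eq_fun => k do rewrite big_ord0; exact: cvg_cst.
under eq_fun => k do rewrite big_ord_recr /=.
have h := cvgM IH (hF n); rewrite mulr1 in h. exact: h.
Qed.

Lemma cvg_shift_ratio (a b : R) : 0 <= a -> 0 < b ->
  (k%:R + a) / (k%:R + b) @[k --> \oo] --> (1 : R).
Proof.
move=> a0 b0; apply/cvgrPdist_le => eps eps0; near=> k.
have kb : 0 < k%:R + b by rewrite ltr_wpDl.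
have -> : 1 - (k%:R + a) / (k%:R + b) = (b - a) / (k%:R + b) by field; rewrite gt_eqF.
rewrite normrM [`|_^-1|]gtr0_norm ?invr_gt0 // ler_pdivrMr // mulrC -ler_pdivrMr //.
apply: (@le_trans _ _ k%:R); last by rewrite lerDl ltW.
by near: k; exact: nbhs_infty_ger.
Unshelve. all: by end_near. Qed.

(** The moments from degree [n] on are all proportional to the one of degree [n]. Normalised by
    [zmom] they tend to [g], while the explicit factor of proportionality has a limit too; comparing
    the limits expresses the moment of degree [n] through [g]. The leading coefficient and the Beta
    moment then combine into [a_sq]. *)
Lemma zk_repro n x y :
  zk (jpoly al be n) (jpoly al be n) x y * a_sq al be n = (jpoly al be n).[t x y].
Proof.
set h := jpoly al be n; set g := h.[t x y].
have hh := jpoly_eigen al be n; rewrite -/h in hh.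
have zE : zk h h x y = h`_n * zk 'X^n h x y.
  rewrite (@zk_sum_coef h n.+1) ?size_jpoly // big_ord_recr /= big1 ?add0r // => m _.
  by rewrite (zk_low x y (ltn_ord m)) mulr0.
pose A (k : nat) := zk 'X^(n + k) h x y / zmom (n + k) x y.
(* [W k / U k] is the product of the recursion ratios up to a constant, so [A k * U k / W k] does
   not depend on [k]. *)
pose U (k : nat) := poch (n%:R + k%:R + ga + 1 : R) n.
pose W (k : nat) := poch (k%:R + 1 : R) n.
have ngt (k : nat) : 0 < n%:R + k%:R + ga + 1.
  by have := ler0n R n; have := ler0n R k; have := ga0; lra.
have U0 (k : nat) : 0 < U k by exact: poch_gt0.
have W0 (k : nat) : 0 < W k by apply: poch_gt0; rewrite ltr_wpDl.
have recA (k : nat) : A k.+1 * ((k%:R + 1) * (2 * n%:R + k%:R + 1 + ga)) =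
    A k * ((n%:R + k%:R + 1) * (n%:R + k%:R + 1 + ga)).
  have := zk_eigen_rec (n + k) x y hh; have := zmom_rec (n + k) x y.
  rewrite jlamB /A addnS; set m' := zmom (n + k).+1 x y; set m0 := zmom (n + k) x y.
  set z' := zk _ h x y; set z0 := zk _ h x y.
  have m'0 : m' != 0 by rewrite gt_eqF // zmom_gt0.
  have m00 : m0 != 0 by rewrite gt_eqF // zmom_gt0.
  rewrite -natr1 natrD => e1 e2.
  apply: (mulIf m'0); apply: (mulIf m00).
  transitivity (m0 * ((n%:R + k%:R + 1 - n%:R) * (n%:R + k%:R + 1 + n%:R + ga) * z')); first by field.
  rewrite e2.
  transitivity ((n%:R + k%:R + 1) * z0 * ((n%:R + k%:R + 1 + be) * m0)); first by ring.
  by rewrite -e1; field.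
have AUW (k : nat) : A k * U k * W 0%N = A 0%N * U 0%N * W k.
  elim: k => [|k IH]; first by ring.
  have eU : U k.+1 * (n%:R + k%:R + ga + 1) = U k * (2 * n%:R + k%:R + 1 + ga).
    have := poch_shift (n%:R + k%:R + ga + 1 : R) n.
    rewrite /U -natr1 (_ : n%:R + (k%:R + 1) + ga + 1 = n%:R + k%:R + ga + 1 + 1); last by ring.
    by rewrite [_ * poch (_ + 1) _]mulrC => <-; congr (_ * _); ring.
  have eW : W k.+1 * (k%:R + 1) = W k * (n%:R + k%:R + 1).
    have := poch_shift (k%:R + 1 : R) n.
    by rewrite /W -natr1 [_ * poch (_ + 1) _]mulrC => <-; congr (_ * _); ring.
  have c1 : (k%:R + 1 : R) != 0 by rewrite gt_eqF // ltr_wpDl.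
  have c2 : n%:R + k%:R + ga + 1 != 0 by rewrite gt_eqF.
  apply: (mulIf c1); apply: (mulIf c2).
  transitivity (A k.+1 * (k%:R + 1) * (U k.+1 * (n%:R + k%:R + ga + 1)) * W 0%N); first by ring.
  rewrite eU.
  transitivity ((A k.+1 * ((k%:R + 1) * (2 * n%:R + k%:R + 1 + ga))) * U k * W 0%N); first by ring.
  rewrite recA.
  transitivity ((A k * U k * W 0%N) * (n%:R + k%:R + 1) * (n%:R + k%:R + 1 + ga)); first by ring.
  rewrite IH.
  transitivity (A 0%N * U 0%N * (W k * (n%:R + k%:R + 1)) * (n%:R + k%:R + 1 + ga)); first by ring.
  by rewrite -eW; ring.
have cA : A k @[k --> \oo] --> g.
  have [C C0 hC] := zk_concentrate h x y.
  apply/cvgrPdist_le => eps eps0; near=> k.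
  have e20 : 0 < eps / 2 by rewrite divr_gt0.
  rewrite distrC /A /g tsym (le_trans (hC _ _ e20)) // [leRHS](splitr eps) lerD2l.
  rewrite ler_pdivrMr // [leRHS]mulrC -ler_pdivrMr //.
  apply: (@le_trans _ _ k%:R); last by rewrite ler_nat (leq_trans (leq_addl n k)).
  by near: k; exact: nbhs_infty_ger.
have cWU : W k / U k @[k --> \oo] --> (1 : R).
  rewrite (_ : (fun k : nat => W k / U k) = (fun k : nat => \prod_(i < n)
     ((k%:R + (1 + (i : nat)%:R)) / (k%:R + (n%:R + ga + 1 + (i : nat)%:R))))); last first.
    apply/funext => k; rewrite /W /U /poch -prodf_div; apply: eq_bigr => i _.
    by congr (_ / _); ring.
  apply: (@cvg_prod1 n (fun i k : nat => (k%:R + (1 + i%:R)) / (k%:R + (n%:R + ga + 1 + i%:R)))) => i.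
  apply: cvg_shift_ratio; first by rewrite addr_ge0.
  by have := ler0n R n; have := ler0n R i; have := ga0; lra.
have gE : g = A 0%N * U 0%N / W 0%N.
  have : (A 0%N * U 0%N / W 0%N) * (W k / U k) @[k --> \oo] --> (A 0%N * U 0%N / W 0%N) * 1.
    by apply: cvgM => //; exact: cvg_cst.
  rewrite mulr1 (_ : (fun k : nat => _) = A); last first.
    apply/funext => k; rewrite mulrA mulrAC -[LHS]mulrA.
    have := AUW k => e; apply: (mulIf (lt0r_neq0 (U0 k))); apply: (mulIf (lt0r_neq0 (W0 0%N))).
    by rewrite e; field; rewrite !gt_eqF.
  by move=> /(cvg_unique _ cA) -> //.
have muE := zmom_poch n x y.
have f0 : 0 < n`!%:R :> R by rewrite ltr0n fact_gt0.
have lead := jpoly_lead al n be1; rewrite -/h in lead.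
rewrite zE gE /a_sq.
have W0E : W 0%N = n`!%:R by rewrite /W add0r poch1.
have e1 := poch_shift (n%:R + ga : R) n.
have e2 := poch_shift (ga : R) n.
have p1 : 0 < poch (be + 1) n by apply: poch_gt0; have := be1; lra.
have p2 : 0 < poch (ga + 1) n by apply: poch_gt0; have := ga0; lra.
have mu0 := zmom_gt0 n x y.
rewrite W0E /A /U addn0 addr0 in gE *.
rewrite -muE (_ : h`_n = poch (n%:R + ga) n / n`!%:R); last first.
  by rewrite -lead mulfK // gt_eqF.
set Z := zk _ _ _ _; set mu := zmom _ _ _ in mu0 *.
have [Fn mun p2n gan] : [/\ n`!%:R != 0 :> R, mu != 0, poch (ga + 1) n != 0 & ga != 0].
  by rewrite !gt_eqF.
transitivity ((poch (n%:R + ga) n * (n%:R + ga + n%:R)) * poch ga n * Z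
   / (n`!%:R * ga * mu * poch (ga + 1) n)).
  by field; rewrite p2n mun gan Fn.
rewrite e1.
transitivity (poch (n%:R + ga + 1) n * (poch ga n * (ga + n%:R)) * Z
   / (n`!%:R * ga * mu * poch (ga + 1) n)).
  by field; rewrite p2n mun gan Fn.
by rewrite e2; field; rewrite p2n mun gan Fn.
Unshelve. all: by end_near. Qed.
End ZonalKernel.

(** * Square-integrable random variables *)

Section RealExpectation.
Context {R : realType} {dd : measure_display} {Omega : measurableType dd}.
Variable P : probability Omega R.
Implicit Types f g : Omega -> R.

Definition itg f := P.-integrable setT (EFin \o f).
Definition sqi f := measurable_fun setT f /\ itg (fun w => f w ^+ 2).

Lemma itg_meas f : itg f -> measurable_fun setT f.
Proof. by move=> /integrableP[/measurable_EFinP]. Qed.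

Lemma itg_preimage f (A : set R) : itg f -> measurable A -> measurable (f @^-1` A).
Proof. by move=> /itg_meas mf mA; rewrite -[_ @^-1` _]setTI; exact: mf. Qed.

Lemma RexpE f : itg f -> (Rexp P f)%:E = (\int[P]_w (f w)%:E)%E.
Proof. by move=> hf; rewrite /Rexp fineK //; exact: integrable_fin_num. Qed.

Lemma itg_cst c : itg (fun=> c).
Proof. exact: finite_measure_integrable_cst. Qed.

Lemma itgD f g : itg f -> itg g -> itg (fun w => f w + g w).
Proof. by move=> hf hg; have := integrableD measurableT hf hg. Qed.

Lemma itgZ c f : itg f -> itg (fun w => c * f w).
Proof. by move=> hf; have := integrableZl measurableT c hf. Qed.

Lemma itg_le f g : measurable_fun setT f -> (forall w, `|f w| <= g w) -> itg g -> itg f.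
Proof.
move=> mf fg hg; apply: le_integrable hg => //; first exact/measurable_EFinP.
move=> w _ /=; rewrite lee_fin (le_trans (fg w)) // ler_norm //.
Qed.

Lemma RexpD f g : itg f -> itg g -> Rexp P (fun w => f w + g w) = Rexp P f + Rexp P g.
Proof.
move=> hf hg; apply: EFin_inj; rewrite EFinD !RexpE //; last exact: itgD.
by rewrite -integralD.
Qed.

Lemma RexpZ c f : itg f -> Rexp P (fun w => c * f w) = c * Rexp P f.
Proof.
move=> hf; apply: EFin_inj; rewrite EFinM !RexpE //; last exact: itgZ.
by rewrite -integralZl.
Qed.

Lemma Rexp_cst c : Rexp P (fun=> c) = c.
Proof. by rewrite /Rexp integral_cst //= probability_setT mule1. Qed.

Lemma Rexp_ge0 f : (forall w, 0 <= f w) -> 0 <= Rexp P f.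
Proof. by move=> f0; apply/fine_ge0/integral_ge0 => w _; rewrite lee_fin. Qed.

Lemma Rexp_ext f g : f =1 g -> Rexp P f = Rexp P g.
Proof. by move=> /funext ->. Qed.

Lemma RexpB f g : itg f -> itg g -> Rexp P (fun w => f w - g w) = Rexp P f - Rexp P g.
Proof.
move=> hf hg; rewrite -mulN1r -RexpZ // -RexpD //; last exact: itgZ.
by apply: Rexp_ext => w; rewrite mulN1r.
Qed.

Lemma Rexp_le f g : itg f -> itg g -> (forall w, f w <= g w) -> Rexp P f <= Rexp P g.
Proof.
move=> hf hg fg; rewrite -subr_ge0 -RexpB //; apply: Rexp_ge0 => w.
by rewrite subr_ge0.
Qed.

Lemma itg_sum (I : Type) (r : seq I) (F : I -> Omega -> R) :
  (forall i, itg (F i)) -> itg (fun w => \sum_(i <- r) F i w).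
Proof.
move=> hF; elim: r => [|i r IH].
  by rewrite (_ : (fun _ => _) = (fun=> 0)); [exact: itg_cst | apply/funext => w; rewrite big_nil].
rewrite (_ : (fun _ => _) = (fun w => F i w + \sum_(j <- r) F j w)); first exact: itgD.
by apply/funext => w; rewrite big_cons.
Qed.

Lemma Rexp_sum (I : Type) (r : seq I) (F : I -> Omega -> R) :
  (forall i, itg (F i)) -> Rexp P (fun w => \sum_(i <- r) F i w) = \sum_(i <- r) Rexp P (F i).
Proof.
move=> hF; elim: r => [|i r IH].
  by rewrite big_nil -[RHS](Rexp_cst 0); apply: Rexp_ext => w; rewrite big_nil.
rewrite big_cons -IH -RexpD //; last exact: itg_sum.
by apply: Rexp_ext => w; rewrite big_cons.
Qed.

Lemma sqiM f g : sqi f -> sqi g -> itg (fun w => f w * g w).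
Proof.
move=> [mf hf] [mg hg].
apply: (@itg_le _ (fun w => f w ^+ 2 + g w ^+ 2)); [exact: measurable_funM | | exact: itgD].
by move=> w; rewrite ler_norml; apply/andP; split; nra.
Qed.

Lemma sqi_cst c : sqi (fun=> c).
Proof. by split=> //; exact: itg_cst. Qed.

Lemma sqi_itg f : sqi f -> itg f.
Proof.
move=> hf; have := sqiM hf (sqi_cst 1).
by rewrite (_ : (fun _ => _) = f) //; apply/funext => w; rewrite mulr1.
Qed.

Lemma sqiD f g : sqi f -> sqi g -> sqi (fun w => f w + g w).
Proof.
move=> hf hg; split; first exact: measurable_funD hf.1 hg.1.
rewrite (_ : (fun _ => _) = (fun w => f w ^+ 2 + 2 * (f w * g w) + g w ^+ 2)).
  by apply: itgD hg.2; apply: itgD hf.2 _; apply: itgZ; exact: sqiM.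
by apply/funext => w; ring.
Qed.

Lemma sqiZ c f : sqi f -> sqi (fun w => c * f w).
Proof.
move=> [mf hf]; split; first exact: measurable_funM.
rewrite (_ : (fun _ => _) = (fun w => c ^+ 2 * f w ^+ 2)); first exact: itgZ.
by apply/funext => w; rewrite exprMn.
Qed.

Lemma sqiB f g : sqi f -> sqi g -> sqi (fun w => f w - g w).
Proof.
move=> hf hg; have := sqiD hf (sqiZ (-1) hg).
by rewrite (_ : (fun w => f w + _) = (fun w => f w - g w)) //; apply/funext => w; rewrite mulN1r.
Qed.

Lemma sqi_sum (I : Type) (r : seq I) (F : I -> Omega -> R) :
  (forall i, sqi (F i)) -> sqi (fun w => \sum_(i <- r) F i w).
Proof.
move=> hF; elim: r => [|i r IH].
  by rewrite (_ : (fun _ => _) = (fun=> 0)); [exact: sqi_cst | apply/funext => w; rewrite big_nil].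
rewrite (_ : (fun _ => _) = (fun w => F i w + \sum_(j <- r) F j w)); first exact: sqiD.
by apply/funext => w; rewrite big_cons.
Qed.

Lemma Rexp_CS f g : sqi f -> sqi g ->
  Rexp P (fun w => f w * g w) ^+ 2 <= Rexp P (fun w => f w ^+ 2) * Rexp P (fun w => g w ^+ 2).
Proof.
move=> hf hg; set b := Rexp P _; set a := Rexp P _; set c := Rexp P _.
have a0 : 0 <= a by apply: Rexp_ge0 => w; exact: sqr_ge0.
have c0 : 0 <= c by apply: Rexp_ge0 => w; exact: sqr_ge0.
have q (r s : R) : 0 <= r ^+ 2 * a + 2 * r * s * b + s ^+ 2 * c.
  have hf2 := hf.2; have hg2 := hg.2; have hfg := sqiM hf hg.
  have i1 := itgZ (r ^+ 2) hf2; have i2 := itgZ (2 * r * s) hfg; have i3 := itgZ (s ^+ 2) hg2.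
  rewrite -(RexpZ _ hf2) -(RexpZ _ hfg) -(RexpZ _ hg2) -(RexpD i1 i2) -(RexpD (itgD i1 i2) i3).
  by apply: Rexp_ge0 => w; rewrite (_ : _ + _ = (r * f w + s * g w) ^+ 2) ?sqr_ge0 //; ring.
have [c00|cn] := eqVneq c 0.
  (* For [c = 0] the form takes the value [- (a + 2) * b ^+ 2] at this point, which forces
     [b = 0]. *)
  by have := q (- b) (a + 1); rewrite c00; nra.
have c1 : 0 < c by rewrite lt_neqAle eq_sym cn.
have h := q c (- b); rewrite -subr_ge0 -(pmulr_rge0 _ c1).
by rewrite (_ : c * _ = c ^+ 2 * a + 2 * c * - b * b + (- b) ^+ 2 * c) //; ring.
Qed.
End RealExpectation.

(** * Expectation of products of independent variables *)

Section Independence.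
Context {R : realType} {dd : measure_display} {Omega : measurableType dd}.
Variable P : probability Omega R.
Local Open Scope ereal_scope.

(** Independence makes the joint law agree with the product law on rectangles, hence everywhere;
    Tonelli's theorem then splits the integral. *)
Lemma integral_indep (X Y : Omega -> R) (g h : R -> R) :
  measurable_fun setT X -> measurable_fun setT Y ->
  measurable_fun setT g -> measurable_fun setT h ->
  (forall x, 0 <= g x)%R -> (forall x, 0 <= h x)%R ->
  (forall A B : set R, measurable A -> measurable B ->
     P (X @^-1` A `&` Y @^-1` B) = P (X @^-1` A) * P (Y @^-1` B)) ->
  \int[P]_w (g (X w) * h (Y w))%:E = (\int[P]_w (g (X w))%:E) * (\int[P]_w (h (Y w))%:E).
Proof.
move=> mX mY mg mh g0 h0 ind.
pose X' : {mfun Omega >-> R} := HB.pack X (isMeasurableFun.Build _ _ _ _ X mX).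
pose Y' : {mfun Omega >-> R} := HB.pack Y (isMeasurableFun.Build _ _ _ _ Y mY).
have mZ : measurable_fun setT (fun w => (X w, Y w)) by exact/measurable_fun_pair.
pose Z : {mfun Omega >-> (R * R)%type} := HB.pack (fun w => (X w, Y w)) (isMeasurableFun.Build _ _ _ _ _ mZ).
pose f (z : (R * R)%type) : \bar R := (g z.1 * h z.2)%:E.
have mf : measurable_fun setT f.
  apply/measurable_EFinP; apply: measurable_funM.
    by apply: measurableT_comp => //; exact: measurable_fst.
  by apply: measurableT_comp => //; exact: measurable_snd.
have f0 z : 0 <= f z by rewrite lee_fin mulr_ge0.
have uniq C : measurable C -> (distribution P X' \x distribution P Y') C = distribution P Z C.
  apply: product_measure_unique => A B mA mB; rewrite /distribution /pushforward /=.
  by rewrite -ind.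
transitivity (\int[distribution P Z]_z f z).
  by rewrite ge0_integral_distribution.
transitivity (\int[distribution P X' \x distribution P Y']_z f z).
  by apply: eq_measure_integral => C mC _; exact/esym/uniq.
rewrite fubini_tonelli1 //.
have hY : \int[P]_w (h (Y w))%:E = \int[distribution P Y']_y (h y)%:E.
  by rewrite ge0_integral_distribution //; exact/measurable_EFinP.
have gX : \int[P]_w (g (X w))%:E = \int[distribution P X']_x (g x)%:E.
  by rewrite ge0_integral_distribution //; exact/measurable_EFinP.
rewrite hY gX /fubini_F /f /=.
transitivity (\int[distribution P X']_x ((g x)%:E * \int[distribution P Y']_y (h y)%:E)).
  apply: eq_integral => x _; rewrite -ge0_integralZl ?lee_fin //.
  - exact/measurable_EFinP.
  - by move=> y _; rewrite lee_fin.
rewrite ge0_integralZr //; first exact/measurable_EFinP.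
- by move=> x _; rewrite lee_fin.
- by apply: integral_ge0 => y _; rewrite lee_fin.
Qed.

(** The nonnegative case applied to absolute values gives integrability of the product; the formula
    follows by splitting both variables into positive and negative parts. *)
Lemma Rexp_indep (X Y : Omega -> R) : itg P X -> itg P Y ->
  (forall A B : set R, measurable A -> measurable B ->
     P (X @^-1` A `&` Y @^-1` B) = P (X @^-1` A) * P (Y @^-1` B)) ->
  itg P (fun w => X w * Y w)%R /\
  Rexp P (fun w => X w * Y w)%R = (Rexp P X * Rexp P Y)%R.
Proof.
move=> iX iY ind; have mX := itg_meas iX; have mY := itg_meas iY.
have mn : measurable_fun setT (fun x : R => `|x|%R) by exact: normr_measurable.
pose pp (x : R) : R := Num.max x 0%R; pose pm (x : R) : R := Num.max (- x)%R 0%R.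
have mpp : measurable_fun setT pp by exact: measurable_maxr.
have mpm : measurable_fun setT pm by apply: measurable_maxr => //; exact: oppr_measurable.
have pp0 x : (0 <= pp x)%R by rewrite /pp le_max lexx orbT.
have pm0 x : (0 <= pm x)%R by rewrite /pm le_max lexx orbT.
have ppm x : (x = pp x - pm x)%R.
  by rewrite /pp /pm; case: (ltrP x 0) => x0; case: (ltrP (- x) 0) => x1; lra.
have ppn x : (pp x <= `|x|)%R by rewrite /pp ge_max ler_norm normr_ge0.
have pmn x : (pm x <= `|x|)%R by rewrite /pm ge_max normr_ge0 -normrN ler_norm.
have iXY : itg P (fun w => X w * Y w)%R.
  apply/integrableP; split; first by apply/measurable_EFinP; exact: measurable_funM.
  rewrite (_ : \int[P]_w _ = \int[P]_w (`|X w| * `|Y w|)%:E); last first.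
    by apply: eq_integral => w _; rewrite /= normrM.
  rewrite (@integral_indep X Y (fun x => `|x|%R) (fun x => `|x|%R)) //.
  by rewrite lte_mul_pinfty ?integral_ge0 // ?ge0_fin_numE ?integral_ge0 //;
     [move/integrableP : iX => [_ iX] | move/integrableP : iY => [_ iY]].
have key (g h : R -> R) : measurable_fun setT g -> measurable_fun setT h ->
    (forall x, 0 <= g x <= `|x|)%R -> (forall x, 0 <= h x <= `|x|)%R ->
    itg P (fun w => g (X w) * h (Y w))%R /\
    [/\ itg P (g \o X), itg P (h \o Y) &
    Rexp P (fun w => g (X w) * h (Y w))%R = (Rexp P (g \o X) * Rexp P (h \o Y))%R].
  move=> mg mh hg hh.
  have mgX : measurable_fun setT (g \o X) by exact: measurableT_comp.
  have mhY : measurable_fun setT (h \o Y) by exact: measurableT_comp.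
  have nn (Z : Omega -> R) : itg P Z -> itg P (fun w => `|Z w|%R).
    by move=> iZ; have := integrable_norm iZ.
  have i1 : itg P (g \o X).
    apply: itg_le (nn _ iX) => // w /=; by case/andP: (hg (X w)) => g0 gx; rewrite ger0_norm.
  have i2 : itg P (h \o Y).
    apply: itg_le (nn _ iY) => // w /=; by case/andP: (hh (Y w)) => g0 gx; rewrite ger0_norm.
  have i3 : itg P (fun w => g (X w) * h (Y w))%R.
    apply: itg_le (nn _ iXY) => [|w]; first exact: measurable_funM.
    case/andP: (hg (X w)) => g0 gx; case/andP: (hh (Y w)) => h0 hy.
    by rewrite !normrM ler_pM // ger0_norm.
  split=> //; split=> //; apply: EFin_inj; rewrite EFinM !RexpE //.
  by apply: integral_indep => // x; [case/andP: (hg x) | case/andP: (hh x)].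
have hpp x : (0 <= pp x <= `|x|)%R by rewrite pp0 ppn.
have hpm x : (0 <= pm x <= `|x|)%R by rewrite pm0 pmn.
split=> //.
have [j1 [a1 b1 e1]] := key _ _ mpp mpp hpp hpp.
have [j2 [_ b2 e2]] := key _ _ mpp mpm hpp hpm.
have [j3 [a3 _ e3]] := key _ _ mpm mpp hpm hpp.
have [j4 [_ _ e4]] := key _ _ mpm mpm hpm hpm.
have eX : Rexp P X = (Rexp P (pp \o X) - Rexp P (pm \o X))%R.
  by rewrite -RexpB //; apply: Rexp_ext => w /=; exact: ppm.
have eY : Rexp P Y = (Rexp P (pp \o Y) - Rexp P (pm \o Y))%R.
  by rewrite -RexpB //; apply: Rexp_ext => w /=; exact: ppm.
transitivity (Rexp P (fun w => (pp (X w) * pp (Y w) + pm (X w) * pm (Y w))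
   - (pp (X w) * pm (Y w) + pm (X w) * pp (Y w)))%R).
  by apply: Rexp_ext => w; rewrite {1}(ppm (X w)) {1}(ppm (Y w)); ring.
by rewrite RexpB ?RexpD ?e1 ?e2 ?e3 ?e4 ?eX ?eY //; [ring | exact: itgD | exact: itgD].
Qed.
End Independence.

(** * Completeness of the space of square-integrable variables *)

Section Completeness.
Context {R : realType} {dd : measure_display} {Omega : measurableType dd}.
Variable P : probability Omega R.

Lemma limn_einf_le (u : (\bar R)^nat) c : (forall n, (u n <= c)%E) -> (limn_einf u <= c)%E.
Proof.
move=> uc; rewrite limn_einf_lim; apply: lime_le; first exact: is_cvg_einfs.
apply: nearW => n; apply: le_trans (uc n).
by apply: ereal_inf_lbound; exists n => /=.
Qed.

Lemma cvg_abs_steps (v : nat -> R) :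
  (\sum_(k <oo) (`|v k.+1 - v k|)%:E)%E \is a fin_num -> cvgn v.
Proof.
move=> hfin.
have nE n : [normed series (telescope v)] n = \sum_(0 <= k < n) `|v k.+1 - v k| by [].
have hs : cvgn (series (telescope v)).
  apply: normed_cvg; apply: nondecreasing_is_cvgn.
    by apply/nondecreasing_seqP => n; rewrite !nE big_nat_recr //= lerDl.
  exists (fine (\sum_(k <oo) (`|v k.+1 - v k|)%:E)%E) => _ [n _ <-].
  rewrite -lee_fin fineK // nE -sumEFin.
  by apply: nneseries_lim_ge => k _ _; rewrite lee_fin.
rewrite (_ : v = (fun n => v 0%N + series (telescope v) n)).
  by apply: is_cvgD => //; exact: is_cvg_cst.
by apply/funext => n; exact: eq_sum_telescope.
Qed.

(** Riesz-Fischer: along a subsequence with steps of norm at most [2^-(k+1)] the expected absolute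
    steps sum to at most 1, so the subsequence converges almost everywhere, and Fatou's lemma bounds
    the distance to the limit. *)
Lemma sqi_complete (S : nat -> Omega -> R) : (forall n, sqi P (S n)) ->
  (forall e, 0 < e -> exists N, forall m n, (N <= m)%N -> (N <= n)%N ->
     Rexp P (fun w => (S m w - S n w) ^+ 2) <= e) ->
  exists2 Z, sqi P Z & forall e, 0 < e -> exists N, forall n, (N <= n)%N ->
     Rexp P (fun w => (S n w - Z w) ^+ 2) <= e.
Proof.
move=> hS cS.
pose del (k : nat) : R := 1 / (2 ^ k.+1)%:R.
have del0 k : 0 < del k by rewrite divr_gt0 // ltr0n expn_gt0.
have {}cS k : {N : nat | forall m n, (N <= m)%N -> (N <= n)%N ->
     Rexp P (fun w => (S m w - S n w) ^+ 2) <= del k ^+ 2}.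
  by apply/cid/cS; rewrite exprn_gt0.
pose Nf k := sval (cS k).
(* The maximum makes the chosen indices nondecreasing in [k]. *)
pose K k := (\max_(i < k.+1) Nf i)%N.
have KN k i : (k <= i)%N -> (Nf k <= K i)%N.
  by rewrite -ltnS => ki; rewrite /K (bigD1 (Ordinal ki)) //= leq_maxl.
have hK k m n : (K k <= m)%N -> (K k <= n)%N ->
    Rexp P (fun w => (S m w - S n w) ^+ 2) <= del k ^+ 2.
  by move=> km kn; apply: (svalP (cS k)); [apply: leq_trans km | apply: leq_trans kn]; exact: KN.
have Kmono k i : (k <= i)%N -> (K k <= K i)%N.
  move=> ki; apply/bigmax_leqP => l _; apply: KN.
  by rewrite (leq_trans _ ki) // -ltnS.
have sB m n : sqi P (fun w => S m w - S n w) by exact: sqiB.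
pose D k w := `|S (K k.+1) w - S (K k) w|.
have mD k : measurable_fun setT (D k).
  by apply: measurableT_comp; [exact: normr_measurable | case: (sB (K k.+1) (K k))].
have iD k : itg P (D k).
  apply: (@itg_le _ _ _ P _ (fun w => 1 + (S (K k.+1) w - S (K k) w) ^+ 2)) => //.
    move=> w; rewrite /D normr_id; set z := _ - _.
    by rewrite ler_norml; apply/andP; split; nra.
  by apply: itgD; [exact: itg_cst | case: (sB (K k.+1) (K k))].
have ED k : Rexp P (D k) <= del k.
  have i2 : itg P (fun w => (S (K k.+1) w - S (K k) w) ^+ 2) by case: (sB (K k.+1) (K k)).
  apply: (@le_trans _ _ (Rexp P (fun w => (2 * del k)^-1 * (S (K k.+1) w - S (K k) w) ^+ 2 + del k / 2))).
    apply: Rexp_le => //; first by apply: itgD; [exact: itgZ | exact: itg_cst].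
    move=> w; rewrite /D; set z := _ - _; rewrite -(real_normK (num_real z)).
    have d0 := del0 k.
    rewrite -subr_ge0 (_ : _ - _ = (2 * del k)^-1 * (`|z| - del k) ^+ 2).
      by rewrite mulr_ge0 ?sqr_ge0 // invr_ge0 mulr_ge0 // ltW.
    by field; rewrite gt_eqF.
  rewrite (RexpD (itgZ _ i2) (itg_cst P _)) (RexpZ _ i2) Rexp_cst.
  have := hK k (K k.+1) (K k) (Kmono _ _ (leqnSn k)) (leqnn _); set X := Rexp _ _ => hX.
  have d0 := del0 k.
  rewrite [leRHS](splitr (del k)) lerD2r mulrC ler_pdivrMr ?mulr_gt0 //.
  by rewrite (le_trans hX) // le_eqVlt; apply/orP; left; apply/eqP; field.
pose G w := (\sum_(k <oo) (D k w)%:E)%E.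
have mG : measurable_fun setT G.
  apply: ge0_emeasurable_sum => [k w _ _|k _]; last exact/measurable_EFinP.
  by rewrite lee_fin normr_ge0.
have G0 w : (0 <= G w)%E by apply: nneseries_ge0 => k _ _; rewrite lee_fin normr_ge0.
have iG : P.-integrable setT G.
  apply/integrableP; split=> //.
  rewrite (eq_integral G); last by move=> w _; rewrite gee0_abs.
  rewrite integral_nneseries //; [|by move=> k; exact/measurable_EFinP|by move=> k w _; rewrite lee_fin normr_ge0].
  apply: (@le_lt_trans _ _ 1%:E); last exact: ltry.
  apply: le_trans (epsilon_trick0 xpredT (ler01 : 0 <= (1 : R))).
  apply: lee_nneseries => [k _ _|k _]; first by apply: integral_ge0 => w _; rewrite lee_fin normr_ge0.
  by rewrite -RexpE // lee_fin ED.
pose u k w := (S (K k) w)%:E.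
(* The upper limit is measurable everywhere; [fine] gives it the value 0 where it is infinite, which
   happens on a null set only. *)
pose Z w := fine (limn_esup (u ^~ w)).
have mZ : measurable_fun setT Z.
  apply: measurableT_comp; first exact: fine_measurable.
  by apply: measurable_fun_limn_esup => k; apply/measurable_EFinP; case: (hS (K k)).
have cvZ : {ae P, forall w, setT w -> (fun k => S (K k) w) @ \oo --> Z w}.
  apply: filterS (integrable_ae measurableT iG) => w hw _.
  have /cvg_ex[l hl] : cvgn (fun k => S (K k) w) by apply: cvg_abs_steps; exact: hw.
  suff -> : Z w = l by [].
  have : u ^~ w @ \oo --> l%:E by apply: cvg_EFin => //; exact: nearW.
  by move=> /cvg_limn_einf_sup[_ e]; rewrite /Z e.
have mh n : measurable_fun setT (fun w => (S n w - Z w) ^+ 2).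
  by apply: measurable_funX; apply: measurable_funB => //; case: (hS n).
have key j n : (K j <= n)%N -> itg P (fun w => (S n w - Z w) ^+ 2) /\
    Rexp P (fun w => (S n w - Z w) ^+ 2) <= del j ^+ 2.
  move=> jn.
  have iB k : itg P (fun w => (S n w - S (K (k + j)%N) w) ^+ 2) by case: (sB n (K (k + j)%N)).
  pose h k w := ((S n w - S (K (k + j)%N) w) ^+ 2)%:E.
  have mhk k : measurable_fun setT (h k) by apply/measurable_EFinP/itg_meas.
  have h0 k w : (0 <= h k w)%E by rewrite lee_fin sqr_ge0.
  have le : (\int[P]_w ((S n w - Z w) ^+ 2)%:E <= (del j ^+ 2)%:E)%E.
    apply: (@le_trans _ _ (\int[P]_w limn_einf (h ^~ w))%E).
      apply: ae_ge0_le_integral => //.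
      - by move=> w _; rewrite lee_fin sqr_ge0.
      - exact/measurable_EFinP.
      - move=> w _; rewrite limn_einf_lim; apply: lime_ge; first exact: is_cvg_einfs.
        by apply: nearW => k; apply: le_ereal_inf_tmp => _ [m _ <-].
      - apply: measurableT_comp; first exact: oppe_measurable.
        by apply: measurable_fun_limn_esup => k; apply: measurableT_comp; first exact: oppe_measurable.
      apply: filterS cvZ => w hw _.
      have hw' := hw I.
      suff hc : h ^~ w @ \oo --> ((S n w - Z w) ^+ 2)%:E by rewrite (cvg_limn_einf_sup hc).1.
      apply: cvg_EFin; first exact: nearW.
      apply: (@cvg_comp _ _ _ (fun k => S (K (k + j)%N) w) (fun z => (S n w - z) ^+ 2) _ (nbhs (Z w))).
        by have := hw'; rewrite -(cvg_shiftn j).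
      apply: (@continuous_comp _ _ _ (fun z => S n w - z) (fun z => z ^+ 2)).
        by apply: cvgB; [exact: cvg_cst | exact: cvg_id].
      exact: exprn_continuous.
    apply: (le_trans (fatou _ _ _ _)) => //.
    apply: limn_einf_le => k; rewrite -RexpE // lee_fin; apply: hK => //.
    by apply: Kmono; rewrite leq_addl.
  have i : itg P (fun w => (S n w - Z w) ^+ 2).
    apply/integrableP; split; first exact/measurable_EFinP.
    rewrite (eq_integral (fun w => ((S n w - Z w) ^+ 2)%:E)) ?(le_lt_trans le) ?ltry //.
    by move=> w _; rewrite gee0_abs // lee_fin sqr_ge0.
  by split=> //; rewrite -lee_fin RexpE.
exists Z.
  have [i0 _] := key 0%N (K 0%N) (leqnn _).
  have s0 : sqi P (fun w => S (K 0%N) w - Z w).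
    by split=> //; apply: measurable_funB => //; case: (hS (K 0%N)).
  have := sqiB (hS (K 0%N)) s0.
  by rewrite (_ : (fun w => S _ w - _) = Z) //; apply/funext => w; ring.
move=> e e0.
have [k hk] : exists k, del k ^+ 2 <= e.
  have [k hk] := ltr_add_invr (e0 : 0 < e); exists k.
  rewrite add0r in hk; apply: le_trans (ltW hk).
  have d1 : del k <= k.+1%:R^-1.
    by rewrite /del div1r lef_pV2 ?posrE ?ltr0n ?expn_gt0 // ler_nat ltnW // ltn_expl.
  have d2 : k.+1%:R^-1 <= 1 :> R by rewrite invf_le1 // ler1n.
  rewrite expr2 (le_trans _ d1) // -[leRHS]mulr1 ler_wpM2l ?(ltW (del0 k)) //.
  exact: le_trans d2.
by exists (K k) => n kn; have [_ h] := key k n kn; apply: le_trans h hk.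
Qed.
End Completeness.

(** * Uniform random points *)

Section ZonalRandomElement.
Variables (R : realType) (M : Type) (t : M -> M -> R) (al be : R) (rho : M -> M -> R).
Hypothesis Hz : zonal_space t al be.
Hypotheses (al0 : 0 <= al) (be1 : -1 < be) (ga0 : 0 < al + be + 1).
Hypothesis rhoE : forall x y, rho x y = acos (2 * t x y - 1).

Let tge0 := t_ge0 Hz.
Let tle1 := t_le1 Hz.

Lemma cos_rho x y : cos (rho x y) = 2 * t x y - 1.
Proof.
rewrite rhoE acosK // in_itv /=.
by have := tge0 x y; have := tle1 x y => h1 h2; apply/andP; split; lra.
Qed.

Lemma jacobi_cos_rho n x y : jacobiP al be n (cos (rho x y)) = (jpoly al be n).[t x y].
Proof. by rewrite jpolyE cos_rho; congr (_.[_]); field. Qed.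

Lemma rho_small e : 0 < e -> exists2 dl, 0 < dl & forall x y, rho x y < dl -> 1 - t x y < e.
Proof.
move=> e0; have := @continuous_cos R 0.
move=> /cvgrPdist_lt /(_ (2 * e)); rewrite mulr_gt0 // => /(_ isT).
rewrite cos0 => /nbhs_ballP[dl /= dl0 h]; exists dl => // x y xy.
have r0 : 0 <= rho x y.
  by rewrite rhoE acos_ge0 //; have := tge0 x y; have := tle1 x y => h1 h2; apply/andP; split; lra.
have := h (rho x y); rewrite /ball /= sub0r normrN ger0_norm // => /(_ xy).
rewrite cos_rho; set z := 1 - _ => hz.
have : z < 2 * e by apply: le_lt_trans hz; exact: ler_norm.
by rewrite /z; lra.
Qed.

(** Bounded and Lipschitz for the chordal distance, whose square is proportional to [1 - t]. The
    class is stable under products and its members are continuous for [rho], hence measurable. *)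
Definition tgood (f : M -> R) := exists C L : R,
  [/\ 0 <= C, 0 <= L, forall u, `|f u| <= C & forall u v, (f u - f v) ^+ 2 <= L * (1 - t u v)].

Lemma tgood_cst c : tgood (fun=> c).
Proof.
exists `|c|, 0; split=> // u v; rewrite subrr mul0r.
by rewrite expr0n.
Qed.

Lemma tgoodD f g : tgood f -> tgood g -> tgood (fun u => f u + g u).
Proof.
move=> [C [L [C0 L0 fC fL]]] [C' [L' [C0' L0' gC gL]]].
exists (C + C'), (2 * (L + L')); split; rewrite ?addr_ge0 ?mulr_ge0 ?addr_ge0 //.
  by move=> u; rewrite (le_trans (ler_normD _ _)) // lerD.
move=> u v; have := fL u v; have := gL u v.
by have := sqr_ge0 ((f u - f v) - (g u - g v)); nra.
Qed.

Lemma tgoodM f g : tgood f -> tgood g -> tgood (fun u => f u * g u).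
Proof.
move=> [C [L [C0 L0 fC fL]]] [C' [L' [C0' L0' gC gL]]].
exists (C * C'), (2 * (L * C' ^+ 2 + L' * C ^+ 2)); split.
- exact: mulr_ge0.
- by rewrite mulr_ge0 // addr_ge0 // mulr_ge0 // sqr_ge0.
- by move=> u; rewrite normrM ler_pM.
move=> u v.
have h1 : (f u - f v) ^+ 2 * g u ^+ 2 <= L * (1 - t u v) * C' ^+ 2.
  by rewrite ler_pM ?sqr_ge0 // -(real_normK (num_real (g u))) lerXn2r ?nnegrE.
have h2 : (g u - g v) ^+ 2 * f v ^+ 2 <= L' * (1 - t u v) * C ^+ 2.
  by rewrite ler_pM ?sqr_ge0 // -(real_normK (num_real (f v))) lerXn2r ?nnegrE.
have -> : f u * g u - f v * g v = (f u - f v) * g u + (g u - g v) * f v by ring.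
have := sqr_ge0 ((f u - f v) * g u - (g u - g v) * f v); nra.
Qed.

Lemma tgood_t x : tgood (t x).
Proof.
exists 1, 2; split=> // [u|u v]; first by rewrite ger0_norm ?tge0 ?tle1.
by have := t_lip Hz v x u; rewrite (t_sym Hz v u).
Qed.

Lemma tgood_comp f phi : tgood f -> t_isometry t phi -> tgood (f \o phi).
Proof.
move=> [C [L [C0 L0 fC fL]]] [_ hphi]; exists C, L; split=> // [u|u v] /=.
  exact: fC.
by rewrite -(hphi u v).
Qed.

Lemma tgood_borel f (B : set R) : tgood f -> measurable B -> rho_borel rho (f @^-1` B).
Proof.
move=> [C [L [C0 L0 fC fL]]] mB.
have {mB} : <<s @RGenOInfty.G R >> B.
  exact: (eq_ind _ (fun F : set (set R) => F B) mB _ (RGenOInfty.measurableE R)).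
move: B.
pose G : set (set R) := [set B | rho_borel rho (f @^-1` B)].
have sG : sigma_algebra setT G.
  split.
  - by rewrite /G /= preimage_set0; exact: sigma_algebra0.
  - move=> A GA; rewrite /G /= setTD preimage_setC -setTD.
    exact: sigma_algebraCD.
  - move=> F GF; rewrite /G /= preimage_bigcup.
    exact: sigma_algebra_bigcup.
apply: (smallest_sub sG) => _ [a ->]; apply: sub_sigma_algebra => x /=.
rewrite in_itv /= andbT => ax.
(* If [f y <= a < f x], then [(f x - a)^2 <= L (1 - t x y)], which this bound on [1 - t x y]
   excludes; [L + 1] keeps the denominator positive. *)
have e0 : 0 < (f x - a) ^+ 2 / (L + 1).
  by rewrite divr_gt0 ?exprn_gt0 ?subr_gt0 // ltr_wpDl.
have [dl dl0 hdl] := rho_small e0; exists dl => // y /hdl.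
rewrite ltr_pdivlMr ?ltr_wpDl // => hy /=; rewrite in_itv /= andbT.
have := fL x y; have := tle1 x y; nra.
Qed.

Section Law.
Context {dd : measure_display} {Omega : measurableType dd}.
Variables (P : probability Omega R) (U : Omega -> M).
Hypothesis hU : uniform_on rho P U.

Lemma tgood_meas f : tgood f -> measurable_fun setT (f \o U).
Proof.
move=> gf _ B mB; rewrite setTI comp_preimage; apply: hU.1.
exact: tgood_borel.
Qed.

Lemma tgood_itg f : tgood f -> itg P (f \o U).
Proof.
move=> gf; have mf := tgood_meas gf; case: gf => C [L [C0 L0 fC fL]].
by apply: (itg_le mf _ (itg_cst P C)) => w; exact: fC.
Qed.

Lemma Rexp_same_law (X Y : Omega -> R) : itg P X -> itg P Y ->
  (forall B : set R, measurable B -> P (X @^-1` B) = P (Y @^-1` B)) -> Rexp P X = Rexp P Y.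
Proof.
move=> iX iY XY; have mX := itg_meas iX; have mY := itg_meas iY.
pose X' : {mfun Omega >-> R} := HB.pack X (isMeasurableFun.Build _ _ _ _ X mX).
pose Y' : {mfun Omega >-> R} := HB.pack Y (isMeasurableFun.Build _ _ _ _ Y mY).
have mE : measurable_fun setT (EFin : R -> \bar R) by exact/measurable_EFinP.
apply: EFin_inj; rewrite !RexpE //.
rewrite -(integral_distribution (X := X') mE iX) -(integral_distribution (X := Y') mE iY).
by apply: eq_measure_integral => B mB _; exact: XY.
Qed.

Lemma Rexp_tgood_inv f phi : tgood f -> t_isometry t phi ->
  Rexp P ((f \o phi) \o U) = Rexp P (f \o U).
Proof.
move=> gf Iphi; apply: Rexp_same_law; try by apply: tgood_itg => //; exact: tgood_comp.
move=> B mB; apply: (hU.2 phi _ (f @^-1` B)); last exact: tgood_borel.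
by split; [case: Iphi | move=> x y; rewrite !rhoE Iphi.2].
Qed.

Lemma jacobi_reproducing n x y :
  Rexp P (fun w => (jpoly al be n).[t x (U w)] * (jpoly al be n).[t y (U w)]) * a_sq al be n
  = (jpoly al be n).[t x y].
Proof.
apply: (zk_repro Hz (good := tgood) (E := fun f => Rexp P (f \o U))) => //.
- exact: tgood_cst.
- exact: tgoodD.
- exact: tgoodM.
- exact: tgood_t.
- by move=> f g gf gg; rewrite -RexpD //; exact: tgood_itg.
- by move=> c f gf; rewrite -RexpZ //; exact: tgood_itg.
- by move=> f g gf gg fg; apply: Rexp_le; [exact: tgood_itg | exact: tgood_itg | move=> w; exact: fg].
- exact: Rexp_cst.
- exact: Rexp_tgood_inv.
Qed.

Lemma tgood_jpoly n x : tgood (fun u => (jpoly al be n).[t x u]).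
Proof. by apply: good_poly => //; [exact: tgood_cst | exact: tgoodD | exact: tgoodM | exact: tgood_t]. Qed.
End Law.
End ZonalRandomElement.

(** * Limits in mean square *)

Section L2Limits.
Context {R : realType} {dd : measure_display} {Omega : measurableType dd}.
Variable P : probability Omega R.

Definition l2cvg (S : nat -> Omega -> R) (Z : Omega -> R) :=
  Rexp P (fun w => (S n w - Z w) ^+ 2) @[n --> \oo] --> (0 : R).

Lemma Rexp_norm_CS f g : sqi P f -> sqi P g ->
  `|Rexp P (fun w => f w * g w)| <=
  Num.sqrt (Rexp P (fun w => f w ^+ 2)) * Num.sqrt (Rexp P (fun w => g w ^+ 2)).
Proof.
move=> hf hg; rewrite -sqrtrM; last by apply: Rexp_ge0 => w; exact: sqr_ge0.
by rewrite -sqrtr_sqr ler_sqrt ?Rexp_CS // mulr_ge0 // Rexp_ge0 // => w; exact: sqr_ge0.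
Qed.

(** [S S' - Z Z'] expands into three products, each with a factor tending to 0 in norm, and
    Cauchy-Schwarz bounds them. Means and squared distances pass to the limit through this lemma as
    well. *)
Lemma l2cvg_inner S Z S' Z' : (forall n, sqi P (S n)) -> (forall n, sqi P (S' n)) ->
  sqi P Z -> sqi P Z' -> l2cvg S Z -> l2cvg S' Z' ->
  Rexp P (fun w => S n w * S' n w) @[n --> \oo] --> Rexp P (fun w => Z w * Z' w).
Proof.
move=> hS hS' hZ hZ' cZ cZ'.
pose a n := Num.sqrt (Rexp P (fun w => (S n w - Z w) ^+ 2)).
pose b n := Num.sqrt (Rexp P (fun w => (S' n w - Z' w) ^+ 2)).
pose A := Num.sqrt (Rexp P (fun w => Z w ^+ 2)).
pose B := Num.sqrt (Rexp P (fun w => Z' w ^+ 2)).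
have ca : a n @[n --> \oo] --> (0 : R).
  by rewrite -sqrtr0; apply: continuous_cvg => //; exact: sqrt_continuous.
have cb : b n @[n --> \oo] --> (0 : R).
  by rewrite -sqrtr0; apply: continuous_cvg => //; exact: sqrt_continuous.
have bound n : `|Rexp P (fun w => Z w * Z' w) - Rexp P (fun w => S n w * S' n w)| <=
    a n * B + a n * b n + A * b n.
  have d1 := sqiB (hS n) hZ; have d2 := sqiB (hS' n) hZ'.
  rewrite distrC -RexpB; [|exact: sqiM|exact: sqiM].
  rewrite (@Rexp_ext _ _ _ P _ (fun w => ((S n w - Z w) * Z' w + (S n w - Z w) * (S' n w - Z' w))
     + Z w * (S' n w - Z' w))); last by move=> w; ring.
  have i1 := sqiM d1 hZ'; have i2 := sqiM d1 d2; have i3 := sqiM hZ d2.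
  rewrite (RexpD (itgD i1 i2) i3) (RexpD i1 i2).
  rewrite (le_trans (ler_normD _ _)) // lerD ?Rexp_norm_CS //.
  by rewrite (le_trans (ler_normD _ _)) // lerD ?Rexp_norm_CS.
have c0 : a n * B + a n * b n + A * b n @[n --> \oo] --> (0 : R).
  have := cvgD (cvgD (cvgM ca (cvg_cst B)) (cvgM ca cb)) (cvgM (cvg_cst A) cb).
  rewrite mul0r mulr0 mulr0 !addr0 => h; exact: h.
apply/cvgrPdist_le => e e0.
move/cvgrPdist_le : c0 => /(_ e e0); apply: filterS => n.
rewrite sub0r normrN => h; apply: le_trans (bound n) (le_trans (ler_norm _) h).
Qed.

Lemma l2cvg_diff (S S' : nat -> Omega -> R) Z Z' : (forall n, sqi P (S n)) ->
  (forall n, sqi P (S' n)) -> sqi P Z -> sqi P Z' -> l2cvg S Z -> l2cvg S' Z' ->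
  Rexp P (fun w => (S n w - S' n w) ^+ 2) @[n --> \oo] --> Rexp P (fun w => (Z w - Z' w) ^+ 2).
Proof.
move=> hS hS' hZ hZ' cZ cZ'.
have ex (f g : Omega -> R) : sqi P f -> sqi P g ->
    Rexp P (fun w => (f w - g w) ^+ 2) = Rexp P (fun w => f w * f w)
      + (Rexp P (fun w => g w * g w) + - 2 * Rexp P (fun w => f w * g w)).
  move=> hf hg; have i1 := sqiM hf hf; have i2 := sqiM hg hg; have i3 := itgZ (-2) (sqiM hf hg).
  rewrite -(RexpZ _ (sqiM hf hg)) -(RexpD i2 i3) -(RexpD i1 (itgD i2 i3)).
  by apply: Rexp_ext => w; ring.
rewrite ex //; under eq_fun => n do rewrite ex //.
apply: cvgD; first exact: l2cvg_inner.
apply: cvgD; first exact: l2cvg_inner.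
by apply: cvgM; [exact: cvg_cst | exact: l2cvg_inner].
Qed.

Lemma l2cvg_cst Z : l2cvg (fun=> Z) Z.
Proof.
rewrite /l2cvg (_ : (fun _ => _) = (fun=> 0)); first exact: cvg_cst.
apply/funext => n; rewrite -[RHS](Rexp_cst P 0); apply: Rexp_ext => w.
by rewrite subrr expr0n.
Qed.

Lemma l2cvg_mean S Z : (forall n, sqi P (S n)) -> sqi P Z -> l2cvg S Z ->
  Rexp P (S n) @[n --> \oo] --> Rexp P Z.
Proof.
move=> hS hZ cZ.
have := l2cvg_inner hS (fun=> sqi_cst P 1) hZ (sqi_cst P 1) cZ (l2cvg_cst (fun=> 1)).
have e (f : Omega -> R) : Rexp P (fun w => f w * 1) = Rexp P f by apply: Rexp_ext => w; rewrite mulr1.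
by rewrite e; under eq_fun => n do rewrite e.
Qed.
End L2Limits.

(** * The random field *)

Section RandomField.
Variables (R : realType) (M : Type) (t : M -> M -> R) (al be : R) (rho : M -> M -> R).
Hypothesis Hz : zonal_space t al be.
Hypotheses (al0 : 0 <= al) (be1 : -1 < be) (ga0 : 0 < al + be + 1).
Hypothesis rhoE : forall x y, rho x y = acos (2 * t x y - 1).
Variables (T : zmodType) (m : nat).
Context {dd : measure_display} {Omega : measurableType dd}.
Variables (P : probability Omega R) (B : nat -> T -> 'M[R]_m).
Variables (V : nat -> T -> Omega -> 'I_m -> R) (U : Omega -> M).
Hypothesis hB : forall i, exists l : R,
  (fun N => \sum_(n < N) B n 0 i i * jacobiP al be n 1) @ \oo --> l.
Hypothesis hV : forall n s, rvec2 P (V n s).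
Hypothesis hV0 : forall n s, meanv P (V n s) = (fun=> 0).
Hypothesis hVcov : forall n t1 t2, covm P (V n t1) (V n t2) = a_sq al be n *: B n (t1 - t2).
Hypothesis hVind : mutually_independent P (fun n => sigma_proc (V n)).
Hypothesis hU : uniform_on rho P U.
Hypothesis hUV : independent2 P (sigma_elem rho U) <<s \bigcup_n sigma_proc (V n) >>.

Local Notation Q n := (jpoly al be n).

Lemma V_sqi n s i : sqi P (fun w => V n s w i).
Proof. by have [? ?] := hV n s i. Qed.

Lemma V_mean n s i : Rexp P (fun w => V n s w i) = 0.
Proof. exact: (congr1 (fun f => f i) (hV0 n s)). Qed.

Lemma V_cov n t1 t2 i j :
  Rexp P (fun w => V n t1 w i * V n t2 w j) = a_sq al be n * B n (t1 - t2) i j.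
Proof.
have := congr1 (fun A : 'M[R]_m => A i j) (hVcov n t1 t2); rewrite !mxE => <-.
by apply: Rexp_ext => w; rewrite !hV0 !subr0.
Qed.

Lemma prob_Pr (A A' : set Omega) : measurable A -> measurable A' ->
  Pr P (A `&` A') = Pr P A * Pr P A' -> P (A `&` A') = (P A * P A')%E.
Proof.
move=> mA mA'; rewrite /Pr => e.
have fin C : measurable C -> P C = (fine (P C))%:E.
  by move=> mC; rewrite fineK //; exact: fin_num_measure.
by rewrite (fin _ mA) (fin _ mA') (fin _ (measurableI _ _ mA mA')) -EFinM e.
Qed.

Lemma V_indep n n' t1 t2 i j : n != n' -> Rexp P (fun w => V n t1 w i * V n' t2 w j) = 0.
Proof.
move=> nn; have i1 := sqi_itg (V_sqi n t1 i); have i2 := sqi_itg (V_sqi n' t2 j).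
have [|_ ->] := Rexp_indep i1 i2; last by rewrite V_mean mul0r.
move=> A A' mA mA'.
apply: prob_Pr; [exact: (itg_preimage i1) | exact: (itg_preimage i2) |].
pose F k := if k == n then (fun w => V n t1 w i) @^-1` A else (fun w => V n' t2 w j) @^-1` A'.
have Fn : F n = (fun w => V n t1 w i) @^-1` A by rewrite /F eqxx.
have Fn' : F n' = (fun w => V n' t2 w j) @^-1` A' by rewrite /F eq_sym (negbTE nn).
have := hVind (I := [:: n; n']) (A := F).
rewrite /= inE nn => /(_ isT); rewrite big_cons big_seq1 -Fn -Fn' => <-.
  congr Pr; apply/seteqP; split=> [w [h1 h2] k /=|w h].
    by rewrite !inE => /orP[/eqP ->|/eqP ->].
  by split; apply: h; rewrite /= !inE eqxx ?orbT.
move=> k; rewrite !inE => /orP[/eqP ->|/eqP ->]; rewrite ?Fn ?Fn'.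
  by apply: sub_sigma_algebra; exists t1, i, A.
by apply: sub_sigma_algebra; exists t2, j, A'.
Qed.

(** Independence of [U] is given for the sigma-algebra generated by all the processes. Regarding
    [Omega] as a measurable space with that sigma-algebra makes the product of two coordinates
    measurable for it. *)
Lemma VV_gmeas n n' t1 t2 i j (A : set R) : measurable A ->
  <<s \bigcup_n sigma_proc (V n) >> ((fun w => V n t1 w i * V n' t2 w j) @^-1` A).
Proof.
move=> mA; pose G := \bigcup_n sigma_proc (V n).
pose O := g_sigma_algebraType G.
have mV k s l : measurable_fun [set: O] ((fun w => V k s w l) : O -> R).
  move=> _ C mC; rewrite setTI; apply: sub_sigma_algebra; exists k => //.
  by apply: sub_sigma_algebra; exists s, l, C.
have := measurable_funM (mV n t1 i) (mV n' t2 j) measurableT mA.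
by rewrite setTI.
Qed.

Lemma VVf_mean n n' t1 t2 i j f : tgood t f ->
  itg P (fun w => V n t1 w i * V n' t2 w j * f (U w)) /\
  Rexp P (fun w => V n t1 w i * V n' t2 w j * f (U w)) =
  Rexp P (fun w => V n t1 w i * V n' t2 w j) * Rexp P (f \o U).
Proof.
move=> gf.
have i1 := sqiM (V_sqi n t1 i) (V_sqi n' t2 j).
have i2 := tgood_itg Hz rhoE hU gf.
apply: (Rexp_indep i1 i2) => A A' mA mA'.
apply: prob_Pr; [exact: (itg_preimage i1) | exact: (itg_preimage i2) |].
rewrite setIC mulrC; apply: hUV; last exact: (VV_gmeas n n' t1 t2 i j mA).
by exists (f @^-1` A') => //; exact: (tgood_borel Hz rhoE gf mA').
Qed.

Definition term n x s i w := V n s w i * (Q n).[t x (U w)].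

Lemma term_sqi n x s i : sqi P (term n x s i).
Proof.
have gq := tgood_jpoly Hz n x; have mq := tgood_meas Hz rhoE hU gq.
have [mV iV] := V_sqi n s i.
split; first exact: measurable_funM.
have [C [_ [C0 _ hC _]]] := gq.
apply: (@itg_le _ _ _ P _ (fun w => C ^+ 2 * V n s w i ^+ 2)); last exact: itgZ.
  by apply: measurable_funX; exact: measurable_funM.
move=> w; rewrite /term ger0_norm ?sqr_ge0 // exprMn mulrC ler_wpM2r ?sqr_ge0 //.
by rewrite -(real_normK (num_real (Q n).[_])) lerXn2r ?nnegrE.
Qed.

(** On the diagonal the factor [a_sq] in the covariance of [V n] is exactly what the reproducing
    formula consumes. *)
Lemma term_cov n n' x1 x2 t1 t2 i j :
  Rexp P (fun w => term n x1 t1 i w * term n' x2 t2 j w) =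
  if n == n' then B n (t1 - t2) i j * (Q n).[t x1 x2] else 0.
Proof.
have gf : tgood t (fun u => (Q n).[t x1 u] * (Q n').[t x2 u]).
  by apply: tgoodM; exact: tgood_jpoly.
rewrite (@Rexp_ext _ _ _ P _ (fun w => V n t1 w i * V n' t2 w j *
   ((Q n).[t x1 (U w)] * (Q n').[t x2 (U w)]))); last by move=> w; rewrite /term; ring.
rewrite (VVf_mean n n' t1 t2 i j gf).2; case: eqVneq => [<-|nn].
  rewrite V_cov -(jacobi_reproducing Hz al0 be1 ga0 rhoE hU n x1 x2) /comp; ring.
by rewrite V_indep ?mul0r.
Qed.

Definition psum N x s i w := \sum_(n < N) term n x s i w.

Lemma psum_sqi N x s i : sqi P (psum N x s i).
Proof. by apply: sqi_sum => n; exact: term_sqi. Qed.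

(** Unequal lengths are allowed so that the same formula yields the norm of the increments of the
    partial sums. *)
Lemma psum_cov N N' x1 x2 t1 t2 i j : (N <= N')%N ->
  Rexp P (fun w => psum N x1 t1 i w * psum N' x2 t2 j w) =
  \sum_(n < N) B n (t1 - t2) i j * (Q n).[t x1 x2].
Proof.
move=> NN.
rewrite (@Rexp_ext _ _ _ P _ (fun w => \sum_(n < N) \sum_(n' < N')
   (term n x1 t1 i w * term n' x2 t2 j w))); last first.
  by move=> w; rewrite /psum mulr_suml; apply: eq_bigr => n _; rewrite mulr_sumr.
have it (n : 'I_N) (n' : 'I_N') : itg P (fun w => term n x1 t1 i w * term n' x2 t2 j w).
  by apply: sqiM; exact: term_sqi.
rewrite Rexp_sum; last by move=> n; apply: itg_sum => n'.
apply: eq_bigr => n _; rewrite Rexp_sum //.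
rewrite (bigD1 (widen_ord NN n)) //= term_cov eqxx big1 ?addr0 // => n' nn'.
by rewrite term_cov; case: eqVneq => // e; move: nn'; rewrite -val_eqE /= -e eqxx.
Qed.

Lemma psum_mean N x s i : Rexp P (psum N x s i) = 0.
Proof.
rewrite /psum Rexp_sum; last by move=> n; exact: sqi_itg (term_sqi _ _ _ _).
apply: big1 => n _.
have gq := tgood_jpoly Hz n x.
have i1 := sqi_itg (V_sqi n s i).
have i2 := tgood_itg Hz rhoE hU gq.
have [|_ e] := Rexp_indep i1 i2; last by rewrite /term e V_mean mul0r.
move=> A A' mA mA'.
apply: prob_Pr; [exact: (itg_preimage i1) | exact: (itg_preimage i2) |].
rewrite setIC mulrC; apply: hUV.
  by exists ((fun u => (Q n).[t x u]) @^-1` A') => //; exact: (tgood_borel Hz rhoE gq mA').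
apply: sub_sigma_algebra; exists n => //.
by apply: sub_sigma_algebra; exists s, i, A.
Qed.

Definition sig i N := \sum_(n < N) B n 0 i i * (Q n).[1].

Lemma psum_diff N N' x s i : (N <= N')%N ->
  Rexp P (fun w => (psum N' x s i w - psum N x s i w) ^+ 2) = sig i N' - sig i N.
Proof.
move=> NN; have h k k' := sqiM (psum_sqi k x s i) (psum_sqi k' x s i).
rewrite (@Rexp_ext _ _ _ P _ (fun w => psum N' x s i w * psum N' x s i w -
   (2 * (psum N x s i w * psum N' x s i w) - psum N x s i w * psum N x s i w))); last first.
  by move=> w; ring.
have i1 := itgZ 2 (h N N').
have i2 : itg P (fun w => 2 * (psum N x s i w * psum N' x s i w) - psum N x s i w * psum N x s i w).
  have := itgD i1 (itgZ (-1) (h N N)); rewrite (_ : (fun w => _ + -1 * _) = (fun w =>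
   2 * (psum N x s i w * psum N' x s i w) - psum N x s i w * psum N x s i w)) //.
  by apply/funext => w; rewrite mulN1r.
by rewrite (RexpB (h N' N') i2) (RexpB i1 (h N N)) (RexpZ _ (h N N')) !psum_cov // subrr (t_refl Hz) /sig; ring.
Qed.

Lemma psum_diff_pts N x1 x2 s i :
  Rexp P (fun w => (psum N x1 s i w - psum N x2 s i w) ^+ 2) =
  2 * \sum_(n < N) B n 0 i i * ((Q n).[1] - (Q n).[t x1 x2]).
Proof.
have h k y y' := sqiM (psum_sqi k y s i) (psum_sqi k y' s i).
rewrite (@Rexp_ext _ _ _ P _ (fun w => psum N x1 s i w * psum N x1 s i w +
   (psum N x2 s i w * psum N x2 s i w + (- 2) * (psum N x1 s i w * psum N x2 s i w)))); last first.
  by move=> w; ring.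
have i1 := itgZ (-2) (h N x1 x2).
rewrite (RexpD (h N x1 x1) (itgD (h N x2 x2) i1)) (RexpD (h N x2 x2) i1) (RexpZ _ (h N x1 x2)).
rewrite !psum_cov // subrr !(t_refl Hz) !mulr_sumr -!big_split /=.
by apply: eq_bigr => n _; ring.
Qed.

Lemma sig_cvg i : exists l : R, sig i N @[N --> \oo] --> l.
Proof.
have [l hl] := hB i; exists l.
rewrite (_ : sig i = (fun N => \sum_(n < N) B n 0 i i * jacobiP al be n 1)) //.
apply/funext => N; apply: eq_bigr => n _; rewrite jpolyE.
by congr (_ * _.[_]); field.
Qed.

Lemma psum_cvg x s i : exists2 Z, sqi P Z & l2cvg P (fun N => psum N x s i) Z.
Proof.
have [l hl] := sig_cvg i.
have [|e e0|Z hZ cZ] := sqi_complete (P := P) (S := fun N => psum N x s i).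
- by move=> n; exact: psum_sqi.
- move/cvgrPdist_le : hl => /(_ (e / 2)); rewrite divr_gt0 // => /(_ isT)[N _ hN].
  exists N => n n' Nn Nn'.
  wlog nn : n n' Nn Nn' / (n' <= n)%N.
    move=> h; case/orP: (leq_total n' n) => nn; first exact: h.
    rewrite (@Rexp_ext _ _ _ P _ (fun w => (psum n' x s i w - psum n x s i w) ^+ 2)).
      exact: h.
    by move=> w; ring.
  rewrite psum_diff //; have := hN n Nn; have := hN n' Nn' => /=.
  by rewrite !ler_norml => /andP[a1 a2] /andP[a3 a4]; lra.
- exists Z => //; apply/cvgrPdist_le => e e0.
  have [N hN] := cZ e e0; exists N => // n /= Nn.
  rewrite sub0r normrN ger0_norm; first exact: hN.
  by apply: Rexp_ge0 => w; exact: sqr_ge0.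
Qed.

Theorem zonal_field : exists Z : M -> T -> Omega -> 'I_m -> R,
  [/\ (forall x s, rvec2 P (Z x s)),
      (forall x s k,
        (fun N => msd P
           (fun w => \sum_(n < N) V n s w k * jacobiP al be n (cos (rho x (U w))))
           (fun w => Z x s w k)) @ \oo --> 0%E),
      iso_stat P rho Z /\ ms_continuous P rho Z,
      (forall x s, meanv P (Z x s) = (fun=> 0)) &
      forall x1 x2 t1 t2 i j,
        (fun N => \sum_(n < N) B n (t1 - t2) i j * jacobiP al be n (cos (rho x1 x2)))
          @ \oo --> covm P (Z x1 t1) (Z x2 t2) i j].
Proof.
have ex x s i : {Z | sqi P Z & l2cvg P (fun N => psum N x s i) Z} by exact/cid2/psum_cvg.
pose Z x s w i := s2val (ex x s i) w.
have sZ x s i : sqi P (fun w => Z x s w i) by exact: (s2valP (ex x s i)).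
have cZ x s i : l2cvg P (fun N => psum N x s i) (fun w => Z x s w i) by exact: (s2valP' (ex x s i)).
have Z0 x s i : Rexp P (fun w => Z x s w i) = 0.
  have := l2cvg_mean (fun n => psum_sqi n x s i) (sZ x s i) (cZ x s i).
  under eq_fun => n do rewrite psum_mean.
  by move=> h; apply/esym; apply: (cvg_unique _ (@cvg_cst _ _ _ _ _) h).
have mZ x s : meanv P (Z x s) = (fun=> 0) by apply/funext => i; exact: Z0.
(* The partial sums of the series are the covariances of the partial sums of the field, so a single
   limit gives both convergence and the value. *)
have covZ x1 x2 t1 t2 i j :
    (fun N => \sum_(n < N) B n (t1 - t2) i j * jacobiP al be n (cos (rho x1 x2)))
          @ \oo --> covm P (Z x1 t1) (Z x2 t2) i j.
  rewrite mxE (@Rexp_ext _ _ _ P _ (fun w => Z x1 t1 w i * Z x2 t2 w j)); last first.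
    by move=> w; rewrite !mZ !subr0.
  have := l2cvg_inner (fun n => psum_sqi n x1 t1 i) (fun n => psum_sqi n x2 t2 j)
    (sZ x1 t1 i) (sZ x2 t2 j) (cZ x1 t1 i) (cZ x2 t2 j).
  rewrite (_ : (fun n => Rexp P _) = (fun N => \sum_(n < N) B n (t1 - t2) i j * jacobiP al be n (cos (rho x1 x2)))) //.
  apply/funext => N; rewrite psum_cov //; apply: eq_bigr => n _.
  by rewrite (jacobi_cos_rho Hz rhoE).
have msdE f g : sqi P f -> sqi P g -> msd P f g = (Rexp P (fun w => (f w - g w) ^+ 2))%:E.
  by move=> hf hg; rewrite RexpE //; case: (sqiB hf hg).
exists Z; split=> //.
  move=> x s k.
  rewrite (_ : (fun N => _) = (fun N => (Rexp P (fun w => (psum N x s k w - Z x s w k) ^+ 2))%:E)).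
    by apply: cvg_EFin; [exact: nearW | exact: cZ].
  apply/funext => N; rewrite -msdE //; last exact: psum_sqi.
  congr msd; apply/funext => w; apply: eq_bigr => n _.
  by rewrite (jacobi_cos_rho Hz rhoE).
split; last first.
  move=> s k e e0.
  have [l hl] := sig_cvg k.
  (* The mean-square tail does not depend on [x]; this makes the continuity estimate uniform over
     [M]. *)
  have tail N x : Rexp P (fun w => (Z x s w k - psum N x s k w) ^+ 2) = l - sig k N.
    have h := l2cvg_diff (fun n => psum_sqi n x s k) (fun=> psum_sqi N x s k)
      (sZ x s k) (psum_sqi N x s k) (cZ x s k) (l2cvg_cst P _).
    apply: (cvg_unique _ h) => //.
    have h' : sig k n - sig k N @[n --> \oo] --> l - sig k N by apply: cvgB => //; exact: cvg_cst.
    apply: cvg_trans h'; apply: near_eq_cvg.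
    by exists N => // n /= Nn; rewrite psum_diff.
  (* Two tails and one difference of partial sums, each below [e / 9], enter through
     [(a + c - b)^2 <= 3 (a^2 + b^2 + c^2)]. *)
  have e9 : 0 < e / 9 by rewrite divr_gt0.
  move/cvgrPdist_lt : hl => /(_ _ e9)[N _ /(_ N (leqnn N)) /= hN].
  have [C C0 hC] : exists2 C, 0 <= C & forall tau, 0 <= tau <= 1 ->
      2 * \sum_(n < N) B n 0 k k * ((Q n).[1] - (Q n).[tau]) <= C * (1 - tau).
    pose L n := s2val (cid2 (poly_lip (Q n))).
    have L0 n : 0 <= L n by exact: (s2valP (cid2 (poly_lip (Q n)))).
    have hL n tau : 0 <= tau <= 1 -> `|(Q n).[1] - (Q n).[tau]| <= L n * (1 - tau).
      move=> t01; have := s2valP' (cid2 (poly_lip (Q n))) 1 tau; rewrite ler01 lexx => /(_ isT t01).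
      by rewrite (@ger0_norm _ (1 - tau)) // subr_ge0; case/andP: t01.
    exists (2 * \sum_(n < N) `|B n 0 k k| * L n).
      by rewrite mulr_ge0 // sumr_ge0 // => n _; rewrite mulr_ge0.
    move=> tau t01; rewrite -mulrA ler_wpM2l // mulr_suml ler_sum // => n _.
    rewrite (le_trans (ler_norm _)) // normrM -mulrA ler_wpM2l //; exact: hL.
  have d0 : 0 < e / 9 / (C + 1) by rewrite divr_gt0 // ltr_wpDl.
  have [dl dl0 hdl] := rho_small Hz rhoE d0.
  exists dl => // x1 x2 /hdl hx.
  rewrite msdE // lte_fin.
  have p1 := tail N x1; have p2 := tail N x2; have p3 := psum_diff_pts N x1 x2 s k.
  have s1 := sqiB (sZ x1 s k) (psum_sqi N x1 s k).
  have s2 := sqiB (sZ x2 s k) (psum_sqi N x2 s k).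
  have s3 := sqiB (psum_sqi N x1 s k) (psum_sqi N x2 s k).
  have b3 : Rexp P (fun w => (psum N x1 s k w - psum N x2 s k w) ^+ 2) < e / 9.
    rewrite p3; apply: le_lt_trans (hC _ _) _; first by rewrite (t_ge0 Hz) (t_le1 Hz).
    have t1 : 0 <= 1 - t x1 x2 by rewrite subr_ge0 (t_le1 Hz).
    rewrite -(ltr_pM2r (_ : 0 < C + 1)) ?ltr_wpDl // in hx.
    rewrite divfK in hx; last by rewrite gt_eqF // ltr_wpDl.
    by nra.
  have lN : l - sig k N < e / 9 by apply: le_lt_trans hN; exact: ler_norm.
  apply: (@le_lt_trans _ _ (3 * (Rexp P (fun w => (Z x1 s w k - psum N x1 s k w) ^+ 2)
     + Rexp P (fun w => (Z x2 s w k - psum N x2 s k w) ^+ 2)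
     + Rexp P (fun w => (psum N x1 s k w - psum N x2 s k w) ^+ 2)))).
    have i12 := itgD s1.2 s2.2.
    rewrite -(RexpD s1.2 s2.2) -(RexpD i12 s3.2) -(RexpZ _ (itgD i12 s3.2)).
    apply: Rexp_le; [by case: (sqiB (sZ x1 s k) (sZ x2 s k)) | by apply: itgZ; exact: itgD s3.2 |].
    move=> w; set a := Z x1 s w k - psum N x1 s k w; set b := Z x2 s w k - _; set c := psum N x1 s k w - _.
    have -> : Z x1 s w k - Z x2 s w k = a + c - b by rewrite /a /b /c; ring.
    have := sqr_ge0 (a - c); have := sqr_ge0 (a + b); have := sqr_ge0 (b + c); nra.
  by rewrite p1 p2; lra.
split; first by move=> x s i; have [? ?] := sZ x s i.
split; first by exists (fun=> 0).
(* [limn] yields a total function of distance and lag; at [r = rho x1 x2] the series converges by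
   [covZ]. *)
exists (fun r s => \matrix_(i, j) limn (fun N => \sum_(n < N) B n s i j * jacobiP al be n (cos r))).
move=> x1 x2 t1 t2; apply/matrixP => i j; rewrite [RHS]mxE.
by apply/esym/cvg_lim => //; exact: covZ.
Qed.
End RandomField.

(** * The five families of spaces *)

Lemma proj_rho_acos (R : realType) (j n : nat) (hj : (j <= 3)%N) (p q : proj_pt R j n) :
  proj_rho p q = acos (2 * projt p q - 1).
Proof. by rewrite /proj_rho /proj_cosrho trace_matmul //; exact: pt_herm. Qed.

Lemma sphere_rho_acos (R : realType) d (x y : sphere_pt R d) :
  sphere_rho x y = acos (2 * spheret x y - 1).
Proof. by rewrite /sphere_rho /spheret; congr acos; field. Qed.

(** One index for the base point, one for the direction of the second point, and a spare one that
    serves to remove its phase or sign. *)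
Lemma three_ord n : (2 <= n)%N -> exists i0 i1 i2 : 'I_n.+1, [/\ i0 != i1, i0 != i2 & i1 != i2].
Proof.
move=> n2; have n1 := ltnW n2.
exists ord0, (Ordinal (n1 : (1 < n.+1)%N)), (Ordinal (n2 : (2 < n.+1)%N)).
by rewrite -!val_eqE.
Qed.

Lemma proj_space_zonal (R : realType) (j n : nat) (al be : R) :
  (j <= 3)%N -> (j <= 2)%N || (n <= 2)%N -> (2 <= n)%N ->
  be + 1 = (2 ^ j)%:R / 2 -> al + be + 2 = (2 ^ j)%:R * n.+1%:R / 2 ->
  zonal_space (@projt R j n.+1) al be.
Proof.
move=> hj hN n2 hb hab; have [i0 [i1 [i2 [i01 i02 i12]]]] := three_ord n2.
exact: (proj_zonal hj _ i01 i02 i12).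
Qed.

(** For a projective space over an algebra of real dimension [2^j] one has [d = 2^j n], and the
    curve sums ask for [be + 1 = 2^j / 2] and [al + be + 2 = 2^j (n + 1) / 2]; for the sphere they
    ask for [be + 1 = d / 2] and [al + be + 2 = d]. The parameters of each family satisfy these
    equations. *)
Lemma Mspace_zonal (R : realType) (K : cthps) (d : nat) : valid_dim K d ->
  exists t : Mspace R K d -> Mspace R K d -> R,
    [/\ zonal_space t (jac_alpha R K d) (jac_beta R K d),
        forall x y, Mrho x y = acos (2 * t x y - 1),
        0 <= jac_alpha R K d, -1 < jac_beta R K d &
        0 < jac_alpha R K d + jac_beta R K d + 1].
Proof.
case: K => /= hd.
- have d2 : 2 <= d%:R :> R by rewrite ler_nat.
  exists (@spheret R d.+1); split; try lra; last exact: sphere_rho_acos.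
  have [i0 [i1 [i2 [i01 i02 i12]]]] := three_ord hd.
  by apply: (sphere_zonal i01 i02 i12) => /=; lra.
- have d2 : 2 <= d%:R :> R by rewrite ler_nat.
  exists (@projt R 0 d.+1); split; try lra; last exact: proj_rho_acos.
  by apply: proj_space_zonal => //; rewrite expn0 -?(natr1 R d); lra.
- case/andP: hd => ev d4.
  have n2 : (2 <= d %/ 2)%N by rewrite leq_divRL.
  have dE : d%:R = 2 * (d %/ 2)%:R :> R.
    by rewrite -natrM mulnC divnK // dvdn2.
  have d2 : 2 <= (d %/ 2)%:R :> R by rewrite ler_nat.
  exists (@projt R 1 (d %/ 2).+1); rewrite dE; split; try lra; last exact: proj_rho_acos.
  by apply: proj_space_zonal => //; rewrite expn1 -?(natr1 R (d %/ 2)); lra.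
- case/andP: hd => ev d4.
  have n2 : (2 <= d %/ 4)%N by rewrite leq_divRL.
  have dE : d%:R = 4 * (d %/ 4)%:R :> R by rewrite -natrM mulnC divnK.
  have d2 : 2 <= (d %/ 4)%:R :> R by rewrite ler_nat.
  exists (@projt R 2 (d %/ 4).+1); rewrite dE; split; try lra; last exact: proj_rho_acos.
  by apply: proj_space_zonal => //; rewrite (_ : 2 ^ 2 = 4)%N // -?(natr1 R (d %/ 4)); lra.
- move/eqP: hd => ->.
  exists (@projt R 3 3); split; try lra; last exact: proj_rho_acos.
  by apply: (@proj_space_zonal R 3 2) => //; rewrite (_ : 2 ^ 3 = 8)%N //; lra.
Qed.

Theorem theorem5 (R : realType) (K : cthps) (d : nat) (hd : valid_dim K d)
  (discrete : bool) (m : nat) (hm : (0 < m)%N)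
  (dd : measure_display) (Omega : measurableType dd) (P : probability Omega R)
  (B : nat -> Tdom R discrete -> 'M[R]_m)
  (V : nat -> Tdom R discrete -> Omega -> 'I_m -> R)
  (U : Omega -> Mspace R K d) :
  let al := jac_alpha R K d in
  let be := jac_beta R K d in
  let rho := @Mrho R K d in
  (forall n, stat_cov_fun (B n)) ->
  (forall i j, exists l : R,
      (fun N => \sum_(n < N) B n 0 i j * jacobiP al be n 1) @ \oo --> l) ->
  (forall n t, rvec2 P (V n t)) ->
  (forall n t, meanv P (V n t) = (fun=> 0)) ->
  (forall n t1 t2, covm P (V n t1) (V n t2) = a_sq al be n *: B n (t1 - t2)) ->
  mutually_independent P (fun n => sigma_proc (V n)) ->
  uniform_on rho P U ->
  independent2 P (sigma_elem rho U) <<s \bigcup_n sigma_proc (V n) >> ->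
  exists Z : Mspace R K d -> Tdom R discrete -> Omega -> 'I_m -> R,
    [/\ (forall x t, rvec2 P (Z x t)),
        (forall x t k,
          (fun N => msd P
             (fun w => \sum_(n < N) V n t w k * jacobiP al be n (cos (rho x (U w))))
             (fun w => Z x t w k)) @ \oo --> 0%E),
        iso_stat P rho Z 
        /\ ms_continuous P rho Z,
        (forall x t, meanv P (Z x t) = (fun=> 0)) &
        forall x1 x2 t1 t2 i j,
          (fun N => \sum_(n < N) B n (t1 - t2) i j * jacobiP al be n (cos (rho x1 x2)))
            @ \oo --> covm P (Z x1 t1) (Z x2 t2) i j].
Proof.
move=> al be rho _ hB hV hV0 hVcov hVind hU hUV.
have [t [Hz rhoE al0 be1 ga0]] := Mspace_zonal R hd.
exact: (zonal_field Hz al0 be1 ga0 rhoE (fun i => hB i i)).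
Qed.
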